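(* For real $C,D$ let $\mathcal H_{(C,D)}=\mathcal H_V$ for the potential $V(t,q)=\frac{C}{q^2}+Dq^2$, and let $\mathcal P_D$ be the linear span of the vector fields $P_1,P_2,P_3,P_4$ (depending on $D$) defined in the context. Then: 1. For all $C\ne0$ and all $D$, $\mathcal H_{(C,D)}=\mathcal P_D$; in particular, for $C\neq0$ the algebra $\mathcal H_{(C,D)}$ does not depend on $C$. 2. $\dim\mathcal P_D=4$. 3. $\dim\mathcal H_{(0,D)}=6$. 4. $\mathcal P_D$ is a Lie subalgebra of $\mathcal H_{(0,D)}$. 5. For all $C$ and all $D$, $\mathcal H_{(C,D)}\subseteq\mathcal H_{(0,D)}$.
   Context: $\gamma>0$ is a constant; $(t,q,S,E,B)$ are coordinates with $q$ ranging over $(0,\infty)$. Put $\omega=B\,dq+E\,dt+dS$, $\Omega=d\omega=dB\wedge dq+dE\wedge dt$, $\beta=(E+\tfrac12B^2-V)\,dq\wedge dt+\tfrac{\gamma}{2}\,dB\wedge dt$, and let $I$ be the ideal of differential forms generated by $\omega,\Omega,\beta$. A vector field $N=N^t\partial_t+N^q\partial_q+N^S\partial_S+N^E\partial_E+N^B\partial_B$ is an isovector if $\mathcal L_N(I)\subset I$. $\mathcal G_V$ is the Lie algebra of isovectors and $\mathcal H_V=\{N\in\mathcal G_V:\partial N^S/\partial S=0\}$. Explicitly (known fact), $N\in\mathcal H_V$ iff there are smooth functions $T_N(t),l(t),\sigma(t)$ on $\mathbb R$ such that, with $\phi(t,q)=\tfrac14T_N''q^2+l'q-\sigma$, $$N^t=T_N,\quad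 N^q=\tfrac12T_N'q+l,\quad N^S=-\phi,\quad N^B=-\tfrac12T_N'B+\tfrac{\partial\phi}{\partial q},\quad N^E=-(\tfrac12T_N''q+l')B-T_N'E+\tfrac{\partial\phi}{\partial t},$$ $$-\tfrac{\partial\phi}{\partial t}+T_N\tfrac{\partial V}{\partial t}+(\tfrac12T_N'q+l)\tfrac{\partial V}{\partial q}-\tfrac{\gamma}{2}\tfrac{\partial^2\phi}{\partial q^2}+T_N'V=0 .$$ The $P_i$ are the vector fields $N$ given by these component formulas with $l=0$ and the following $(T_N,\sigma)$. If $D>0$, $\varepsilon=\sqrt{8D}$: $P_1:(\frac1\varepsilon e^{\varepsilon t},\frac\gamma4e^{\varepsilon t})$, $P_2:(-\frac1\varepsilon e^{-\varepsilon t},\frac\gamma4e^{-\varepsilon t})$, $P_3:(1,0)$, $P_4:(0,1)$. If $D=0$: $P_1:(t^2,\frac{\gamma}{2}t)$, $P_2:(t,0)$, $P_3:(1,0)$, $P_4:(0,1)$. If $D<0$, $\varepsilon=\sqrt{-8D}$: $P_1:(\frac1\varepsilon\sin\varepsilon t,\frac\gamma4\cos\varepsilon t)$, $P_2:(-\frac1\varepsilon\cos\varepsilon t,\frac\gamma4\sin\varepsilon t)$, $P_3:(1,0)$, $P_4:(0,1)$. *)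

(* Defs.v *)
From HB Require Import structures.
From mathcomp Require Import all_boot all_order all_algebra.
From mathcomp Require Import all_classical all_reals all_analysis.

Set Implicit Arguments.
Unset Strict Implicit.
Unset Printing Implicit Defensive.
Import Order.TTheory GRing.Theory Num.Theory.
Import numFieldNormedType.Exports.
Local Open Scope classical_set_scope.
Local Open Scope ring_scope.

(* Coordinates are ordered as (t, q, S, E, B). *)
Definition it : 'I_5 := @Ordinal 5 0 isT.
Definition iq : 'I_5 := @Ordinal 5 1 isT.
Definition iS : 'I_5 := @Ordinal 5 2 isT.
Definition iE : 'I_5 := @Ordinal 5 3 isT.
Definition iB : 'I_5 := @Ordinal 5 4 isT.

Definition M (R : realType) : Type := {x : 'rV[R]_5 | 0 < x 0 iq}.

Definition xcoord {R : realType} (k : 'I_5) (p : M R) : R := val p 0 k.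

(* Extension by 0 outside the open set M of R^5; only its germs at points of M
   are ever used, and these do not depend on the value chosen outside M. *)
Definition ext {R : realType} (f : M R -> R) (x : 'rV[R]_5) : R :=
  if insub x is Some p then f p else 0.

Definition pd {R : realType} (k : 'I_5) (f : M R -> R) (p : M R) : R :=
  'D_(delta_mx 0 k) (ext f) (val p).

(* C^infinity: every iterated partial derivative (including f itself) is
   Frechet differentiable, hence continuous, at every point of M. *)
Definition smooth {R : realType} (f : M R -> R) : Prop :=
  forall (s : seq 'I_5) (p : M R), differentiable (ext (foldr pd f s)) (val p).

Definition vfield (R : realType) : Type := M R -> 'rV[R]_5.
HB.instance Definition _ (R : realType) := GRing.Lmodule.on (vfield R).

Definition vcomp {R : realType} (N : vfield R) (k : 'I_5) (p : M R) : R :=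
  N p 0 k.

Definition smooth_vfield {R : realType} (N : vfield R) : Prop :=
  forall k, smooth (vcomp N k).

Definition bracket {R : realType} (X Y : vfield R) : vfield R :=
  fun p => \row_k \sum_j (vcomp X j p * pd j (vcomp Y k) p
                          - vcomp Y j p * pd j (vcomp X k) p).

(* A (not necessarily homogeneous) differential form on M is given by its
   coefficients: a A is the coefficient of dx_{i1} /\ ... /\ dx_{ik}, where
   A = {i1 < ... < ik}. *)
Definition dform (R : realType) : Type := {set 'I_5} -> M R -> R.
HB.instance Definition _ (R : realType) := GRing.Zmodule.on (dform R).

Definition smooth_form {R : realType} (a : dform R) : Prop :=
  forall A, smooth (a A).

(* For disjoint A and B, dx_A /\ dx_B = wsign A B dx_{A :|: B}. *)
Definition wsign {R : realType} (A B : {set 'I_5}) : R :=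
  (-1) ^+ (\sum_(i in A) \sum_(j in B) (j < i))%N.

Definition wedge {R : realType} (a b : dform R) : dform R := fun K p =>
  \sum_(A : {set 'I_5} | A \subset K)
     wsign A (K :\: A)%SET * a A p * b (K :\: A)%SET p.

Definition fmul {R : realType} (f : M R -> R) (a : dform R) : dform R :=
  fun A p => f p * a A p.

Definition dx {R : realType} (k : 'I_5) : dform R :=
  fun A _ => (A == [set k]%SET)%:R.

(* d (f dx_A) = \sum_k (pd k f) dx_k /\ dx_A *)
Definition ext_d {R : realType} (a : dform R) : dform R := fun K p =>
  \sum_(k in K) wsign [set k]%SET (K :\ k)%SET * pd k (a (K :\ k)%SET) p.

Definition interior_prod {R : realType} (N : vfield R) (a : dform R) : dform R :=
  fun J p => \sum_(k | k \notin J)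
     wsign [set k]%SET J * vcomp N k p * a (k |: J)%SET p.

(* Lie derivative, by Cartan's formula. *)
Definition lie_deriv {R : realType} (N : vfield R) (a : dform R) : dform R :=
  ext_d (interior_prod N a) + interior_prod N (ext_d a).

Definition is_ideal {R : realType} (J : set (dform R)) : Prop :=
  [/\ J `<=` smooth_form,
      J 0,
      forall a b, J a -> J b -> J (a + b) &
      forall a b, smooth_form a -> J b -> J (wedge a b) /\ J (wedge b a)].

Definition omega {R : realType} : dform R :=
  fmul (xcoord iB) (dx iq) + fmul (xcoord iE) (dx it) + dx iS.

Definition Omega {R : realType} : dform R := ext_d omega.

Definition beta {R : realType} (gamma : R) (V : R -> R -> R) : dform R :=
  fmul (fun p => xcoord iE p + xcoord iB p ^+ 2 / 2 - V (xcoord it p) (xcoord iq p))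
       (wedge (dx iq) (dx it))
  + fmul (fun=> gamma / 2) (wedge (dx iB) (dx it)).

Definition HJB_ideal {R : realType} (gamma : R) (V : R -> R -> R) :
    set (dform R) :=
  smallest is_ideal [set a | [\/ a = omega, a = Omega | a = beta gamma V]].

Definition GV {R : realType} (gamma : R) (V : R -> R -> R) : set (vfield R) :=
  [set N | smooth_vfield N /\
     forall a, HJB_ideal gamma V a -> HJB_ideal gamma V (lie_deriv N a)].

Definition HV {R : realType} (gamma : R) (V : R -> R -> R) : set (vfield R) :=
  [set N | GV gamma V N /\ forall p, pd iS (vcomp N iS) p = 0].

Definition potential {R : realType} (C D : R) : R -> R -> R :=
  fun _ q => C / q ^+ 2 + D * q ^+ 2.

Definition HCD {R : realType} (gamma C D : R) : set (vfield R) :=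
  HV gamma (potential C D).

Definition phi {R : realType} (T l sigma : R -> R) (t q : R) : R :=
  derive1n 2 T t / 4 * q ^+ 2 + derive1 l t * q - sigma t.

Definition field_of {R : realType} (T l sigma : R -> R) : vfield R := fun p =>
  let t := xcoord it p in let q := xcoord iq p in
  let E := xcoord iE p in let B := xcoord iB p in
  \row_(k < 5)
    [:: T t;
        derive1 T t * q / 2 + l t;
        - phi T l sigma t q;
        - (derive1n 2 T t * q / 2 + derive1 l t) * B - derive1 T t * E
          + derive1 (fun s => phi T l sigma s q) t;
        - (derive1 T t / 2) * B + derive1 (phi T l sigma t) q]`_k.

(* The pairs (T, sigma) of P_1, ..., P_4 (indexed from 0). *)
Definition Pdata {R : realType} (gamma D : R) :
    4.-tuple ((R -> R) * (R -> R)) :=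
  if 0 < D then
    let e := Num.sqrt (8 * D) in
    [tuple (fun t => expR (e * t) / e, fun t => gamma / 4 * expR (e * t));
           (fun t => - (expR (- (e * t)) / e),
            fun t => gamma / 4 * expR (- (e * t)));
           (fun=> 1, fun=> 0);
           (fun=> 0, fun=> 1)]
  else if D == 0 then
    [tuple (fun t => t ^+ 2, fun t => gamma / 2 * t);
           (fun t => t, fun=> 0);
           (fun=> 1, fun=> 0);
           (fun=> 0, fun=> 1)]
  else
    let e := Num.sqrt (- (8 * D)) in
    [tuple (fun t => sin (e * t) / e, fun t => gamma / 4 * cos (e * t));
           (fun t => - (cos (e * t) / e), fun t => gamma / 4 * sin (e * t));
           (fun=> 1, fun=> 0);
           (fun=> 0, fun=> 1)].

Definition Pgen {R : realType} (gamma D : R) (i : 'I_4) : vfield R :=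
  field_of (tnth (Pdata gamma D) i).1 (fun=> 0) (tnth (Pdata gamma D) i).2.

Definition span_of {R : realType} {W : lmodType R} {n : nat} (b : 'I_n -> W) :
    set W :=
  [set v | exists c : 'I_n -> R, v = \sum_i c i *: b i].

Definition lin_indep {R : realType} {W : lmodType R} {n : nat}
    (b : 'I_n -> W) : Prop :=
  forall c : 'I_n -> R, \sum_i c i *: b i = 0 -> forall i, c i = 0.

(* U is a linear subspace of dimension n. *)
Definition has_dim {R : realType} {W : lmodType R} (U : set W) (n : nat) :
    Prop :=
  exists b : 'I_n -> W, lin_indep b /\ U = span_of b.

Definition PD {R : realType} (gamma D : R) : set (vfield R) :=
  span_of (Pgen gamma D).

Definition is_lie_subalgebra {R : realType} (L H : set (vfield R)) : Prop :=
  [/\ L `<=` H,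
      L 0,
      forall (c : R) X Y, L X -> L Y -> L (c *: X + Y) &
      forall X Y, L X -> L Y -> L (bracket X Y)].

(* Main.v *)
Require Import Defs.
From HB Require Import structures.
From mathcomp Require Import all_boot all_order all_algebra.
From mathcomp Require Import all_classical all_reals all_analysis.
From mathcomp Require Import ring lra.

Set Implicit Arguments.
Unset Strict Implicit.
Unset Printing Implicit Defensive.
Import Order.TTheory GRing.Theory Num.Theory.
Import numFieldNormedType.Exports.
Local Open Scope classical_set_scope.
Local Open Scope ring_scope.

(** Let [h = E + B^2 / 2 - V]. The theorem holds because the isovectors in question
    form the solution space of a linear system of ordinary differential equations
    with constant coefficients, in which [C] enters only through the condition
    [C l = 0].

    The ideal is explicit ([HJB_idealE]). A one-form lies in it iff it is a multiple
    of [omega]. A two-form lies in it iff its reduction modulo [omega], obtained from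
    [dS = - E dt - B dq], is a combination of the reductions of [Omega] and [beta];
    this is four linear equations for the coefficients. All forms of degree at least
    three lie in it, because [Omega] is symplectic in [(t, q, E, B)], so that already
    its products with one-forms give all three-forms without [dS]. As the Lie
    derivative preserves degrees and acts on reductions ([red_lie]), a field is an
    isovector iff its components satisfy finitely many differential equations.

    These equations are solved by comparing coefficients in [E] and [B]
    ([structure_equations]): the components [N^t] and [G = B N^q + N^S] turn out to be
    independent of [E], and later [N^t], [N^q] and [N^S] of [B], so differentiating in
    these variables separates the coefficients, and [N^S] is independent of [S] by
    assumption. The only commutation of second derivatives needed is that a function
    constant along the lines of one coordinate has partial derivatives with the same
    property ([pd_pd0]). The result is that the field is determined by three functions
    [T], [l], [s] of time, subject to one equation which, for
    [V = C / q^2 + D q^2], is a polynomial identity in [q] up to a factor [q^3]. Its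
    coefficients say that [T''' = 8 D T'], [l'' = 2 D l], [s' = (gamma / 4) T''] and
    [C l = 0]; such a triple is called a profile. Conversely every profile defines an
    isovector ([profile_HCD]): the Lie derivative of [omega] along the field
    vanishes, and the equations turn into an identity for the derivative of [h] along
    the field ([field_ham]).

    The five claims follow. Solutions are determined by six initial values, and the
    fields depend linearly and injectively on them; when [C <> 0] the function [l]
    vanishes and four remain. The generators are profiles with [l = 0] whose initial
    values form a basis ([Pdata_profiles]). Forgetting the condition [C l = 0] gives
    the inclusion into the case [C = 0]. Finally, the bracket of two profiles with
    [l = 0] is the profile of [T T1' - T' T1], where [T1] and [T1'] are the derivatives
    of [T] and [T'] ([bracket_field], [profile_bracket]). *)

(** * Partial derivatives on the domain *)

Section Calculus.
Context {R : realType}.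
Implicit Types (f g : M R -> R) (p : M R) (i k : 'I_5) (c : R).

Lemma val_gt0 p : 0 < val p 0 iq. Proof. by case: p. Qed.

Lemma ext_val f p : ext f (val p) = f p.
Proof. by rewrite /ext valK. Qed.

Lemma near_M p : \forall x \near val p, 0 < (x : 'rV[R]_5) 0 iq.
Proof.
have := @coord_continuous R 1 5 0 iq (val p).
by move/cvgr_gt; apply; exact: val_gt0.
Qed.

Definition mkM (x : 'rV[R]_5) (x0 : 0 < x 0 iq) : M R := exist _ x x0.

Lemma ext_near f (F : 'rV[R]_5 -> R) p :
  (forall q, f q = F (val q)) -> \forall x \near val p, F x = ext f x.
Proof.
move=> fF; apply: filterS (near_M p) => x x0.
by rewrite -[x]/(val (mkM x0)) ext_val fF.
Qed.

(** Differentiability at a point depends on the germ only; this is what makes the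
    extension by zero outside the domain harmless. *)
Lemma near_eq_differentiable (F G : 'rV[R]_5 -> R) x :
  (\forall y \near x, F y = G y) -> differentiable F x -> differentiable G x.
Proof.
move=> FG /diff_locallyP[cF dF].
have dG : G \o shift x = cst (G x) + 'd F x +o_ 0 id.
  apply/eqaddoP => e e0; move/eqaddoP: dF => /(_ e e0) dF.
  have FG0 : \forall y \near (0 : 'rV[R]_5), F (y + x) = G (y + x).
    by move: FG; rewrite (near_shift 0 x) subr0.
  apply: filterS2 FG0 dF => y /= yE; rewrite !fctE /= /shift /= yE.
  by rewrite (nbhs_singleton FG).
have E := diff_unique cF dG.
by apply/diff_locallyP; rewrite E.
Qed.

Definition diffble f := forall p, differentiable (ext f) (val p).

Lemma diffble_near f (F : 'rV[R]_5 -> R) : (forall q, f q = F (val q)) ->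
  (forall p, differentiable F (val p)) -> diffble f.
Proof.
move=> fF dF p; apply: near_eq_differentiable (dF p).
exact: ext_near.
Qed.

Lemma pd_near f (F : 'rV[R]_5 -> R) k p : (forall q, f q = F (val q)) ->
  pd k f p = 'D_(delta_mx 0 k) F (val p).
Proof. by move=> fF; rewrite /pd -(near_eq_derive _ (ext_near p fF)). Qed.

Lemma extD f g : ext (fun p => f p + g p) = ext f + ext g.
Proof.
apply/funext => x; rewrite /ext fctE; case: insubP => //= _.
by rewrite addr0.
Qed.

Lemma extM f g : ext (fun p => f p * g p) = ext f * ext g.
Proof.
apply/funext => x; rewrite /ext fctE; case: insubP => //= _.
by rewrite mulr0.
Qed.

Lemma extV f : ext (fun p => (f p)^-1) = (fun x => (ext f x)^-1).
Proof.
by apply/funext => x; rewrite /ext; case: insubP => //= _; rewrite invr0.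
Qed.

Lemma diffbleD f g : diffble f -> diffble g -> diffble (fun p => f p + g p).
Proof. by move=> df dg p; rewrite extD; exact: differentiableD. Qed.

Lemma diffbleM f g : diffble f -> diffble g -> diffble (fun p => f p * g p).
Proof. by move=> df dg p; rewrite extM; exact: differentiableM. Qed.

Lemma diffbleV f : (forall p, f p != 0) -> diffble f ->
  diffble (fun p => (f p)^-1).
Proof.
move=> f0 df p; rewrite extV; apply: differentiableV => //.
by rewrite ext_val.
Qed.

Lemma diffble_cst c : diffble (fun=> c).
Proof. by apply: (@diffble_near _ (fun=> c)). Qed.

Lemma diffble_comp (h : R -> R) k :
  (forall x, derivable h x 1) -> diffble (fun p => h (xcoord k p)).
Proof.
move=> dh; apply: (@diffble_near _ (h \o (fun x : 'rV[R]_5 => x 0 k))) => // p.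
apply: differentiable_comp; first exact: differentiable_coord.
exact/derivable1_diffP.
Qed.

Lemma diffble_derivable f p k :
  diffble f -> derivable (ext f) (val p) (delta_mx 0 k).
Proof. by move=> df; exact: diff_derivable. Qed.
Local Hint Resolve diffble_derivable : core.

Lemma pdD k f g p : diffble f -> diffble g ->
  pd k (fun p => f p + g p) p = pd k f p + pd k g p.
Proof. by move=> df dg; rewrite /pd extD deriveD; auto. Qed.

Lemma pdM k f g p : diffble f -> diffble g ->
  pd k (fun p => f p * g p) p = pd k f p * g p + f p * pd k g p.
Proof.
move=> df dg; rewrite /pd extM deriveM; auto.
by rewrite !ext_val addrC [_ *: pd _ _ _]mulrC.
Qed.

Lemma pd_cst k c p : pd k (fun=> c) p = 0.
Proof. by rewrite (@pd_near _ (cst c)) // derive_cst. Qed.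

Lemma pdN k f p : diffble f -> pd k (fun p => - f p) p = - pd k f p.
Proof.
move=> df; have -> : (fun p => - f p) = (fun p => -1 * f p).
  by apply/funext => q; rewrite mulN1r.
rewrite pdM //; last exact: diffble_cst.
by rewrite pd_cst mul0r add0r mulN1r.
Qed.

Lemma pdV k f p : (forall p, f p != 0) -> diffble f ->
  pd k (fun p => (f p)^-1) p = - ((f p)^-1 * (f p)^-1) * pd k f p.
Proof.
move=> f0 df; rewrite /pd extV deriveV ?ext_val //; last by auto.
by rewrite expr2 invfM.
Qed.

Lemma pd_comp k j (h h' : R -> R) p :
  (forall x : R, is_derive x 1 h (h' x)) ->
  pd k (fun p => h (xcoord j p)) p = (k == j)%:R * h' (xcoord j p).
Proof.
move=> dh; rewrite (@pd_near _ (h \o (fun x : 'rV[R]_5 => x 0 j))) //.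
have dh1 x : differentiable h x by apply/derivable1_diffP; have [] := dh x.
rewrite deriveE; last first.
  by apply: differentiable_comp => //; exact: differentiable_coord.
rewrite diff_comp //; last exact: differentiable_coord.
have lin : linear (fun x : 'rV[R]_5 => x 0 j) by move=> a u v; rewrite !mxE.
pose L := GRing.isLinear.Build _ _ _ _ _ lin.
pose F : {linear 'rV[R]_5 -> R} := HB.pack (fun x : 'rV[R]_5 => x 0 j) L.
rewrite (@diff_lin _ _ _ F); last exact: coord_continuous.
rewrite /= diff1E // /F /= !mxE eqxx /= eq_sym.
by rewrite derive1E; have [_ ->] := dh (val p 0 j).
Qed.

End Calculus.

(** * Smooth functions *)

Section Smooth.
Context {R : realType}.
Implicit Types (f g : M R -> R) (p : M R) (i k : 'I_5) (c : R).

Lemma smooth_diffble f : smooth f -> diffble f.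
Proof. by move=> sf p; exact: (sf [::]). Qed.

Lemma smooth_pd k f : smooth f -> smooth (pd k f).
Proof. by move=> sf s p; rewrite -foldr_rcons; exact: sf. Qed.

(** Smoothness is the greatest property that implies differentiability and passes
    to partial derivatives. *)
Lemma smooth_coind (P : (M R -> R) -> Prop) :
  (forall f, P f -> diffble f /\ forall k, P (pd k f)) ->
  forall f, P f -> smooth f.
Proof.
move=> PP f Pf s; elim/last_ind: s f Pf => [|s k IH] f Pf p.
  by have [+ _] := PP f Pf; apply.
by rewrite foldr_rcons; apply: IH; have [_] := PP f Pf; apply.
Qed.

(** Closing a class under ring operations and inverses before asking that it be
    stable under differentiation avoids iterated Leibniz rules: the closure of the
    smooth functions satisfies [smooth_coind] by itself, and so does the closure of
    finitely many functions of time solving a first-order system. *)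
Inductive ring_closure (P : (M R -> R) -> Prop) : (M R -> R) -> Prop :=
| closure_base f : P f -> ring_closure P f
| closure_cst c : ring_closure P (fun=> c)
| closure_add f g : ring_closure P f -> ring_closure P g ->
    ring_closure P (fun p => f p + g p)
| closure_mul f g : ring_closure P f -> ring_closure P g ->
    ring_closure P (fun p => f p * g p)
| closure_inv f : (forall p, f p != 0) -> ring_closure P f ->
    ring_closure P (fun p => (f p)^-1).

Lemma smooth_ring_closure (P : (M R -> R) -> Prop) :
  (forall f, P f -> diffble f /\ forall k, ring_closure P (pd k f)) ->
  forall f, ring_closure P f -> smooth f.
Proof.
move=> PP; apply: smooth_coind => f; elim=> {f}.
- exact: PP.
- move=> c; split=> [|k]; first exact: diffble_cst.
  have -> : pd k (fun=> c) = fun=> 0 by apply/funext => p; exact: pd_cst.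
  exact: closure_cst.
- move=> f g _ [df Pf] _ [dg Pg]; split=> [|k]; first exact: diffbleD.
  have -> : pd k (fun p => f p + g p) = fun p => pd k f p + pd k g p.
    by apply/funext => p; exact: pdD.
  by apply: closure_add.
- move=> f g af [df Pf] ag [dg Pg]; split=> [|k]; first exact: diffbleM.
  have -> : pd k (fun p => f p * g p)
      = fun p => pd k f p * g p + f p * pd k g p.
    by apply/funext => p; exact: pdM.
  by apply: closure_add; apply: closure_mul.
- move=> f f0 af [df Pf]; split=> [|k]; first exact: diffbleV.
  have -> : pd k (fun p => (f p)^-1)
      = fun p => -1 * ((f p)^-1 * (f p)^-1) * pd k f p.
    by apply/funext => p; rewrite pdV // mulN1r.
  apply: closure_mul => //; apply: closure_mul; first exact: closure_cst.
  by apply: closure_mul; exact: closure_inv.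
Qed.

Lemma smooth_closed f : ring_closure smooth f -> smooth f.
Proof.
apply: smooth_ring_closure => {}f sf; split=> [|k]; first exact: smooth_diffble.
by apply: closure_base; exact: smooth_pd.
Qed.

Lemma smooth_cst c : smooth (fun _ : M R => c).
Proof. exact/smooth_closed/closure_cst. Qed.

Lemma smoothD f g : smooth f -> smooth g -> smooth (fun p => f p + g p).
Proof. by move=> sf sg; apply/smooth_closed/closure_add; exact: closure_base. Qed.

Lemma smoothM f g : smooth f -> smooth g -> smooth (fun p => f p * g p).
Proof. by move=> sf sg; apply/smooth_closed/closure_mul; exact: closure_base. Qed.

Lemma smoothV f : (forall p, f p != 0) -> smooth f ->
  smooth (fun p => (f p)^-1).
Proof. by move=> f0 sf; apply/smooth_closed/closure_inv => //; exact: closure_base. Qed.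

Lemma smoothN f : smooth f -> smooth (fun p => - f p).
Proof.
move=> sf; have -> : (fun p => - f p) = fun p => -1 * f p.
  by apply/funext => p; rewrite mulN1r.
by apply: smoothM => //; exact: smooth_cst.
Qed.

Lemma smoothX f n : smooth f -> smooth (fun p => f p ^+ n).
Proof.
move=> sf; elim: n => [|n IH]; first exact: smooth_cst.
have -> : (fun p => f p ^+ n.+1) = fun p => f p * f p ^+ n.
  by apply/funext => p; rewrite exprS.
exact: smoothM.
Qed.

Lemma smooth_sum (I : Type) (r : seq I) (P : pred I) (F : I -> M R -> R) :
  (forall j, P j -> smooth (F j)) -> smooth (fun p => \sum_(j <- r | P j) F j p).
Proof.
move=> sF; elim: r => [|x r IH].
  have -> : (fun p => \sum_(j <- [::] | P j) F j p) = fun=> 0.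
    by apply/funext => p; rewrite big_nil.
  exact: smooth_cst.
have [Px|nPx] := boolP (P x).
  have -> : (fun p => \sum_(j <- x :: r | P j) F j p)
      = fun p => F x p + \sum_(j <- r | P j) F j p.
    by apply/funext => p; rewrite big_cons Px.
  by apply: smoothD => //; exact: sF.
have -> // : (fun p => \sum_(j <- x :: r | P j) F j p)
    = fun p => \sum_(j <- r | P j) F j p.
by apply/funext => p; rewrite big_cons (negbTE nPx).
Qed.

Lemma pd_xcoord k i p : pd k (xcoord i) p = (k == i)%:R.
Proof. by rewrite (@pd_comp _ k i id (fun=> 1)) ?mulr1. Qed.

Lemma smooth_xcoord i : smooth (@xcoord R i).
Proof.
apply/smooth_closed; move: (closure_base); apply.
move=> s; case/lastP: s => [|s k] p.
  exact: (@diffble_comp _ id).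
rewrite foldr_rcons.
have -> : pd k (xcoord i) = fun=> (k == i)%:R :> R.
  by apply/funext => q; exact: pd_xcoord.
exact: smooth_cst.
Qed.

End Smooth.

Section PartialDerivatives.
Context {R : realType}.
Implicit Types (f g : M R -> R) (p : M R) (i k : 'I_5) (c : R).

Lemma pd_ext k f g : (forall p, f p = g p) -> forall p, pd k f p = pd k g p.
Proof. by move=> fg p; have -> : f = g by apply/funext. Qed.

Lemma pd_add k f g p : smooth f -> smooth g ->
  pd k (fun p => f p + g p) p = pd k f p + pd k g p.
Proof. by move=> sf sg; apply: pdD; exact: smooth_diffble. Qed.

Lemma pd_mul k f g p : smooth f -> smooth g ->
  pd k (fun p => f p * g p) p = pd k f p * g p + f p * pd k g p.
Proof. by move=> sf sg; apply: pdM; exact: smooth_diffble. Qed.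

Lemma pd_opp k f p : smooth f -> pd k (fun p => - f p) p = - pd k f p.
Proof. by move=> sf; apply: pdN; exact: smooth_diffble. Qed.

Lemma pd_sqr k f p : smooth f ->
  pd k (fun p => f p ^+ 2) p = 2 * f p * pd k f p.
Proof.
move=> sf; have -> : (fun p => f p ^+ 2) = fun p => f p * f p.
  by apply/funext => q; rewrite expr2.
by rewrite pd_mul //; ring.
Qed.

Lemma is_derive_line (F : 'rV[R]_5 -> R) (x v : 'rV[R]_5) (u : R) :
  derivable F (u *: v + x) v ->
  is_derive u 1 (fun u : R => F (u *: v + x)) ('D_v F (u *: v + x)).
Proof.
move=> dF.
have E : (fun h : R => h^-1 *: (F ((h *: (1 : R) + u) *: v + x) - F (u *: v + x)))
    = (fun h : R => h^-1 *: (F (h *: v + (u *: v + x)) - F (u *: v + x))).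
  by apply/funext => h; rewrite [_ *: 1]mulr1 scalerDl addrA.
by split; rewrite /derivable /derive /= E.
Qed.

Lemma xcoord_inj p q : (forall j, xcoord j p = xcoord j q) -> p = q.
Proof. by move=> pq; apply/val_inj/rowP. Qed.

(** The mean value theorem along the segment from [p] to [q], which stays in the
    domain because a half-space is convex. *)
Lemma pd0_invar i f : smooth f -> (forall p, pd i f p = 0) ->
  forall p q, (forall j, j != i -> xcoord j p = xcoord j q) -> f p = f q.
Proof.
move=> sf f0 p q; wlog pq : p q / xcoord i p <= xcoord i q.
  move=> H; have [/H|/ltW/H] := leP (xcoord i p) (xcoord i q); first exact.
  by move=> /[swap] pqE -> // j ji; rewrite pqE.
move=> pqE; set d : 'rV[R]_5 := delta_mx 0 i; set s := xcoord i q - xcoord i p.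
have qE : val q = s *: d + val p.
  apply/rowP => j; rewrite !mxE eqxx /=.
  have [->|ji] := eqVneq j i; first by rewrite mulr1 subrK.
  by rewrite mulr0 add0r [LHS](esym (pqE j ji)).
have pos (u : R) : 0 <= u -> 0 < (u *: d + val p) 0 iq.
  move=> u0; rewrite !mxE ltr_wpDl ?val_gt0 //.
  by rewrite mulr_ge0 //; case: (_ && _).
have der (u : R) : 0 <= u -> is_derive u 1 (fun u : R => ext f (u *: d + val p)) (0 : R).
  move=> u0; pose m := mkM (pos u u0).
  have D0 : 'D_d (ext f) (u *: d + val p) = 0 := f0 m.
  have dm : derivable (ext f) (val m) d.
    by apply: diffble_derivable; exact: smooth_diffble.
  by have := is_derive_line dm; rewrite D0.
have s0 : 0 <= s by rewrite subr_ge0.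
have [] := @MVT_segment R (fun u => ext f (u *: d + val p)) (fun=> 0) 0 s s0.
- by move=> u; rewrite in_itv /= => /andP[/ltW u0 _]; exact: der.
- apply: derivable_within_continuous => u; rewrite in_itv /= => /andP[u0 _].
  by have [] := der u u0.
move=> _ _ /eqP; rewrite mul0r subr_eq0 scale0r add0r -qE !ext_val.
by move=> /eqP.
Qed.

(** Only a special case of the symmetry of second derivatives is used, and it
    needs no second-order analysis: if [f] is constant along the [i]-lines then
    so are all its partial derivatives. *)
Lemma pd_pd0 i k f : smooth f -> (forall p, pd i f p = 0) ->
  forall p, pd i (pd k f) p = 0.
Proof.
move=> sf f0 p; set d : 'rV[R]_5 := delta_mx 0 i.
have shift_pos (x : 'rV[R]_5) :
    0 < x 0 iq -> \forall h \near (0 : R), 0 < (h *: d + x) 0 iq.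
  move=> x0; have : (fun h : R => h * d 0 iq + x 0 iq) @ (0 : R)
      --> 0 * d 0 iq + x 0 iq.
    apply: cvgD; last exact: cvg_cst.
    by apply: cvgM; [exact: cvg_id|exact: cvg_cst].
  rewrite mul0r add0r => /cvgr_gt /(_ 0 x0).
  by apply: filterS => h; rewrite !mxE.
have inv (h : R) (m m' : M R) : val m' = h *: d + val m ->
    pd k f m' = pd k f m.
  move=> mE; rewrite /pd mE.
  have -> : 'D_(delta_mx 0 k) (ext f) (h *: d + val m)
      = 'D_(delta_mx 0 k) (fun x => ext f (h *: d + x)) (val m).
    have E : (fun e : R => e^-1 *: (ext f (e *: delta_mx 0 k + (h *: d + val m))
          - ext f (h *: d + val m)))
        = (fun e : R => e^-1 *: (ext f (h *: d + (e *: delta_mx 0 k + val m))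
          - ext f (h *: d + val m))).
      by apply/funext => e; rewrite addrCA.
    by rewrite /derive /= E.
  apply: near_eq_derive.
  have shiftM : \forall x \near val m, 0 < (h *: d + x) 0 iq.
    have : (fun x : 'rV[R]_5 => h * d 0 iq + x 0 iq) @ (val m : 'rV[R]_5)
        --> h * d 0 iq + val m 0 iq.
      have C := @coord_continuous R 1 5 0 iq (val m).
      exact: (cvgD (cvg_cst _) C).
    have := val_gt0 m'; rewrite mE !mxE => m0 /cvgr_gt /(_ 0 m0).
    by apply: filterS => x; rewrite !mxE.
  apply: filterS2 (near_M m) shiftM => x x0 hx0.
  rewrite -[x]/(val (mkM x0)).
  rewrite -[h *: d + _]/(val (mkM hx0)) !ext_val.
  apply: (pd0_invar sf f0) => j ji; rewrite /xcoord /= !mxE.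
  by rewrite (negbTE ji) andbF mulr0 add0r.
(* The difference quotients vanish for small increments, hence so does their
   limit. *)
have E : \forall h \near 0^', h^-1 *: (ext (pd k f) (h *: d + val p)
    - ext (pd k f) (val p)) = 0 :> R.
  apply: cvg_within; apply: filterS (shift_pos _ (val_gt0 p)) => h h0.
  rewrite -[_ + val p]/(val (mkM h0)) !ext_val.
  by rewrite (inv h p) // subrr scaler0.
rewrite {1}/pd /derive; apply: cvg_lim => //.
apply: cvg_near_cst; exact: E.
Qed.

End PartialDerivatives.

(** * Forms of degree at most two *)

Section LowDegree.
Context {R : realType}.
Implicit Types (N : vfield R) (a b : dform R) (p : M R) (i j k : 'I_5).

Lemma pd_sum (I : Type) (r : seq I) (P : pred I) (F : I -> M R -> R) k p :
  (forall x, P x -> smooth (F x)) ->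
  pd k (fun p => \sum_(x <- r | P x) F x p) p
    = \sum_(x <- r | P x) pd k (F x) p.
Proof.
move=> sF; elim: r => [|x r IH].
  have -> : (fun p => \sum_(x <- [::] | P x) F x p) = fun=> 0.
    by apply/funext => q; rewrite big_nil.
  by rewrite big_nil pd_cst.
rewrite [RHS]big_cons -IH; case: ifP => Px.
  rewrite -pd_add; [|exact: sF|exact: smooth_sum].
  by congr (pd k _ p); apply/funext => q; rewrite big_cons Px.
by congr (pd k _ p); apply/funext => q; rewrite big_cons Px.
Qed.

(** Splitting the subsets of [x |: K] according to whether they contain [x]: the
    wedge product on small sets is evaluated by peeling off one index at a time. *)
Lemma sum_subsetU1 (I : finType) (V : nmodType) (x : I) (K : {set I})
    (F : {set I} -> V) : x \notin K ->
  \sum_(A : {set I} | A \subset (x |: K)%SET) F A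
    = \sum_(A : {set I} | A \subset K) F A
      + \sum_(A : {set I} | A \subset K) F (x |: A)%SET.
Proof.
move=> xK; rewrite (bigID (fun A : {set I} => x \in A)) /= addrC; congr (_ + _).
  apply: eq_bigl => A; apply/andP/idP => [[AK xA]|AK].
    apply/fintype.subsetP => y yA; have := fintype.subsetP AK _ yA; rewrite finset.in_setU1.
    by case/predU1P => // yx; rewrite yx in yA; rewrite yA in xA.
  split; first exact: fintype.subset_trans AK (finset.subsetUr _ _).
  by apply: contra xK => /(fintype.subsetP AK).
rewrite (reindex_onto (fun A => x |: A)%SET (fun A => A :\ x)%SET) /=.
  apply: eq_bigl => A; rewrite finset.setU11 andbT.
  apply/andP/idP => [[xAK /eqP <-]|AK].
    apply/fintype.subsetP => y; rewrite !inE => /andP[/negPf yx yA].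
    have := fintype.subsetP xAK y; rewrite !inE yx /=; apply.
    by move: yA; rewrite yx.
  have xA : x \notin A by apply: contra xK => /(fintype.subsetP AK).
  by rewrite finset.setUS // finset.setU1K.
by move=> A /andP[_ xA]; rewrite finset.setD1K.
Qed.

Lemma sum_subset0 (I : finType) (V : nmodType) (F : {set I} -> V) :
  \sum_(A : {set I} | A \subset (finset.set0 : {set I})) F A = F finset.set0.
Proof.
by rewrite (big_pred1 finset.set0) // => A; rewrite finset.subset0.
Qed.

Lemma wsign0l (A : {set 'I_5}) : @wsign R finset.set0 A = 1.
Proof. by rewrite /wsign finset.big_set0 expr0. Qed.

Lemma wsign0r (A : {set 'I_5}) : @wsign R A finset.set0 = 1.
Proof.
rewrite /wsign big1 ?expr0 // => i _; exact: finset.big_set0.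
Qed.

Lemma wsign11 i j : @wsign R [set i]%SET [set j]%SET = (-1) ^+ (j < i)%N.
Proof. by rewrite /wsign !finset.big_set1. Qed.

Lemma wsign12 k i j : i != j ->
  @wsign R [set k]%SET [set i; j]%SET = (-1) ^+ (i < k)%N * (-1) ^+ (j < k)%N.
Proof.
move=> ij; rewrite /wsign finset.big_set1 finset.big_setU1 ?inE //= finset.big_set1.
by rewrite exprD.
Qed.

(** The degree-two part of [a] as an antisymmetric matrix: with it the formulas
    below need no case distinction on the order of the indices. *)
Definition alt a i j : M R -> R :=
  fun p => ((i < j)%N%:R - (j < i)%N%:R) * a [set i; j]%SET p.

Lemma wedge_0 a b p : wedge a b finset.set0 p = a finset.set0 p * b finset.set0 p.
Proof. by rewrite /wedge sum_subset0 finset.setD0 wsign0l mul1r. Qed.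

Lemma wedge_1 a b i p : wedge a b [set i]%SET p
  = a finset.set0 p * b [set i]%SET p + a [set i]%SET p * b finset.set0 p.
Proof.
rewrite /wedge -(finset.setU0 [set i]%SET) sum_subsetU1 ?inE //.
rewrite !sum_subset0 !finset.setU0 finset.setD0 finset.setDv.
by rewrite wsign0l wsign0r !mul1r.
Qed.

Lemma wedge_2 a b i j p : (i < j)%N -> wedge a b [set i; j]%SET p
  = a finset.set0 p * b [set i; j]%SET p
    + (a [set i]%SET p * b [set j]%SET p - a [set j]%SET p * b [set i]%SET p)
    + a [set i; j]%SET p * b finset.set0 p.
Proof.
move=> ij; have nij : i != j by rewrite neq_ltn ij.
rewrite /wedge sum_subsetU1 ?inE // -(finset.setU0 [set j]%SET).
rewrite !sum_subsetU1 ?inE // !sum_subset0 !finset.setU0 finset.setD0.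
have -> : ([set i; j] :\: [set j])%SET = [set i]%SET.
  by rewrite -[X in (_ :\: X)%SET]/([set j]%SET) finset.setUC finset.setU1K // inE eq_sym.
have -> : ([set i; j] :\: [set i])%SET = [set j]%SET.
  by rewrite finset.setU1K // inE.
rewrite finset.setDv wsign0l wsign0r !wsign11 ij.
by rewrite (ltnNge j) (ltnW ij) /= expr0 expr1; ring.
Qed.

Lemma ext_d_0 a p : ext_d a finset.set0 p = 0.
Proof. exact: finset.big_set0. Qed.

Lemma ext_d_1 a i p : ext_d a [set i]%SET p = pd i (a finset.set0) p.
Proof. by rewrite /ext_d finset.big_set1 finset.setDv wsign0r mul1r. Qed.

Lemma setD1_2l i j : i != j -> ([set i; j] :\ i)%SET = [set j]%SET.
Proof. by move=> ij; rewrite finset.setU1K // inE. Qed.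

Lemma setD1_2r i j : i != j -> ([set i; j] :\ j)%SET = [set i]%SET.
Proof. by move=> ij; rewrite finset.setUC setD1_2l // eq_sym. Qed.

Lemma ext_d_2 a i j p : (i < j)%N -> ext_d a [set i; j]%SET p
  = pd i (a [set j]%SET) p - pd j (a [set i]%SET) p.
Proof.
move=> ij; have nij : i != j by rewrite neq_ltn ij.
rewrite /ext_d finset.big_setU1 ?inE //= finset.big_set1 setD1_2l // setD1_2r //.
by rewrite !wsign11 ij (ltnNge j) (ltnW ij) /= expr0 expr1 mul1r mulN1r.
Qed.

Lemma alt_ext_d a i j p :
  alt (ext_d a) i j p = pd i (a [set j]%SET) p - pd j (a [set i]%SET) p.
Proof.
rewrite /alt; case: (ltngtP i j) => [ij|ji|/val_inj ->].
- by rewrite ext_d_2 // subr0 mul1r.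
- by rewrite finset.setUC ext_d_2 // sub0r mulN1r opprB.
- by rewrite subrr mul0r subrr.
Qed.

Lemma interior_0 N a p :
  interior_prod N a finset.set0 p = \sum_k vcomp N k p * a [set k]%SET p.
Proof.
apply: eq_big => [k|k _]; first by rewrite inE.
by rewrite wsign0r mul1r finset.setU0.
Qed.

Lemma interior_1 N a j p :
  interior_prod N a [set j]%SET p = \sum_k vcomp N k p * alt a k j p.
Proof.
rewrite /interior_prod big_mkcond /=; apply: eq_bigr => k _; rewrite inE /alt.
case: (ltngtP k j) => [kj|jk|/val_inj ->].
- by rewrite neq_ltn kj wsign11 (ltnNge j) (ltnW kj) /= expr0; ring.
- by rewrite neq_ltn jk orbT wsign11 jk expr1 /=; ring.
- by rewrite eqxx subrr mul0r mulr0.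
Qed.

Lemma smooth_alt a i j : smooth_form a -> smooth (alt a i j).
Proof. by move=> sa; apply: smoothM; [exact: smooth_cst|exact: sa]. Qed.

Lemma pd_scale k (c : R) (f : M R -> R) p : smooth f ->
  pd k (fun p => c * f p) p = c * pd k f p.
Proof.
by move=> sf; rewrite pd_mul //; [rewrite pd_cst; ring|exact: smooth_cst].
Qed.

Lemma pd_alt a i j k p : smooth_form a -> pd k (alt a i j) p
  = ((i < j)%N%:R - (j < i)%N%:R) * pd k (a [set i; j]%SET) p.
Proof. by move=> sa; rewrite pd_scale. Qed.

(** The three-index component of an exterior derivative is needed only after
    contraction with a vector field, where the sign of the contraction restores
    antisymmetry. *)
Lemma ext_d_3 a i j k p : (i < j)%N -> k \notin [set i; j]%SET ->
    smooth_form a ->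
  wsign [set k]%SET [set i; j]%SET * ext_d a (k |: [set i; j])%SET p
    = pd k (alt a i j) p - pd i (alt a k j) p + pd j (alt a k i) p.
Proof.
move=> ij; rewrite !inE negb_or => /andP[ki kj] sa.
have nij : i != j by rewrite neq_ltn ij.
rewrite /ext_d finset.big_setU1 ?inE ?negb_or ?ki //= finset.big_setU1 ?inE //= finset.big_set1.
have -> : ((k |: [set i; j]) :\ k)%SET = [set i; j]%SET.
  by rewrite finset.setU1K // !inE negb_or ki.
have -> : ((k |: [set i; j]) :\ i)%SET = [set k; j]%SET.
  rewrite finset.setUCA finset.setU1K // !inE negb_or nij andbT.
  by rewrite eq_sym.
have -> : ((k |: [set i; j]) :\ j)%SET = [set k; i]%SET.
  rewrite [X in (_ |: X)%SET]finset.setUC finset.setUCA finset.setU1K //.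
  by rewrite !inE negb_or (eq_sym j i) nij (eq_sym j k) kj.
rewrite !pd_alt // !wsign12 //.
have ji : (j < i)%N = false by rewrite ltnNge (ltnW ij).
rewrite ij ji.
case: (ltngtP k i) => [ki'|ki'|/val_inj ki']; last by rewrite ki' eqxx in ki.
  have kj' := ltn_trans ki' ij.
  have jk : (j < k)%N = false by rewrite ltnNge (ltnW kj').
  rewrite kj' jk /= !expr0 !expr1; ring.
case: (ltngtP k j) => [kj'|kj'|/val_inj kj']; last by rewrite kj' eqxx in kj.
  rewrite /= !expr0 !expr1; ring.
rewrite /= !expr0 !expr1; ring.
Qed.

Lemma interior_d_2 N a i j p : (i < j)%N -> smooth_form a ->
  interior_prod N (ext_d a) [set i; j]%SET p
    = \sum_k vcomp N k p
        * (pd k (alt a i j) p - pd i (alt a k j) p + pd j (alt a k i) p).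
Proof.
move=> ij sa; rewrite /interior_prod big_mkcond /=; apply: eq_bigr => k _.
case: ifPn => [kij|/negPn]; first by rewrite -ext_d_3 //; ring.
have ji : (j < i)%N = false by rewrite ltnNge (ltnW ij).
rewrite !inE => /orP[] /eqP ->; rewrite !pd_alt // ij ji ltnn /=.
  ring.
by rewrite finset.setUC; ring.
Qed.

Lemma lie_derivE N a (K : {set 'I_5}) p : lie_deriv N a K p
  = ext_d (interior_prod N a) K p + interior_prod N (ext_d a) K p.
Proof. by []. Qed.

Lemma lie_0 N a p :
  lie_deriv N a finset.set0 p = \sum_k vcomp N k p * pd k (a finset.set0) p.
Proof.
rewrite lie_derivE ext_d_0 add0r interior_0.
by apply: eq_bigr => k _; rewrite ext_d_1.
Qed.

(** In Cartan's formula the derivatives of [a] along other directions than [N]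
    cancel between the two terms; the same happens in degree two. *)
Lemma lie_1 N a i p : smooth_vfield N -> smooth_form a ->
  lie_deriv N a [set i]%SET p
    = \sum_k (vcomp N k p * pd k (a [set i]%SET) p
              + pd i (vcomp N k) p * a [set k]%SET p).
Proof.
move=> sN sa.
rewrite lie_derivE ext_d_1 interior_1.
have -> : interior_prod N a finset.set0
    = fun p => \sum_k vcomp N k p * a [set k]%SET p.
  by apply/funext => q; exact: interior_0.
rewrite pd_sum => [|k _]; last by apply: smoothM.
rewrite -big_split /=; apply: eq_bigr => k _.
by rewrite pd_mul // alt_ext_d; ring.
Qed.

Lemma lie_2 N a i j p : (i < j)%N -> smooth_vfield N -> smooth_form a ->
  lie_deriv N a [set i; j]%SET p
    = \sum_k (vcomp N k p * pd k (a [set i; j]%SET) p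
              + pd i (vcomp N k) p * alt a k j p
              - pd j (vcomp N k) p * alt a k i p).
Proof.
move=> ij sN sa.
rewrite lie_derivE ext_d_2 // interior_d_2 //.
have E l : interior_prod N a [set l]%SET
    = fun p => \sum_k vcomp N k p * alt a k l p.
  by apply/funext => q; exact: interior_1.
rewrite !E !pd_sum => [|k _|k _]; last first.
- by apply: smoothM; [exact: sN|exact: smooth_alt].
- by apply: smoothM; [exact: sN|exact: smooth_alt].
rewrite -sumrB -big_split /=; apply: eq_bigr => k _.
have ji : (j < i)%N = false by rewrite ltnNge (ltnW ij).
have -> : pd k (a [set i; j]%SET) p = pd k (alt a i j) p.
  by rewrite pd_alt // ij ji /=; ring.
rewrite (pd_mul i p (sN k) (smooth_alt k j sa)).
rewrite (pd_mul j p (sN k) (smooth_alt k i sa)).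
ring.
Qed.

Lemma smooth_wedge a b : smooth_form a -> smooth_form b ->
  smooth_form (wedge a b).
Proof.
move=> sa sb K; apply: smooth_sum => A _.
by apply: smoothM => //; apply: smoothM => //; exact: smooth_cst.
Qed.

Lemma smooth_ext_d a : smooth_form a -> smooth_form (ext_d a).
Proof.
move=> sa K; apply: smooth_sum => k _.
by apply: smoothM; [exact: smooth_cst|exact: smooth_pd].
Qed.

Lemma smooth_interior N a : smooth_vfield N -> smooth_form a ->
  smooth_form (interior_prod N a).
Proof.
move=> sN sa K; apply: smooth_sum => k _.
apply: smoothM => //; apply: smoothM; [exact: smooth_cst|exact: sN].
Qed.

Lemma smooth_lie N a : smooth_vfield N -> smooth_form a ->
  smooth_form (lie_deriv N a).
Proof.
move=> sN sa K; apply: smoothD.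
  by apply: smooth_ext_d; exact: smooth_interior.
by apply: smooth_interior => //; exact: smooth_ext_d.
Qed.

End LowDegree.

(** * Reduction modulo the contact form *)

Section Ideal.
Context {R : realType}.
Implicit Types (N : vfield R) (a b : dform R) (p : M R) (i j k : 'I_5).
Implicit Types (f g : M R -> R) (A B K : {set 'I_5}) (J : set (dform R)).

Lemma ord5_ind (P : 'I_5 -> Prop) :
  P it -> P iq -> P iS -> P iE -> P iB -> forall i, P i.
Proof.
move=> ht hq hS hE hB [[|[|[|[|[|//]]]]] lti].
- by rewrite (_ : Ordinal lti = it) //; exact/val_inj.
- by rewrite (_ : Ordinal lti = iq) //; exact/val_inj.
- by rewrite (_ : Ordinal lti = iS) //; exact/val_inj.
- by rewrite (_ : Ordinal lti = iE) //; exact/val_inj.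
- by rewrite (_ : Ordinal lti = iB) //; exact/val_inj.
Qed.

Lemma sum5 (V : nmodType) (F : 'I_5 -> V) :
  \sum_k F k = F it + F iq + F iS + F iE + F iB.
Proof.
rewrite !big_ord_recl big_ord0 addr0 !addrA.
by congr (_ + _ + _ + _ + _); congr F; exact/val_inj.
Qed.

Definition omega_coef i p : R := [:: xcoord iE p; xcoord iB p; 1; 0; 0]`_i.

Lemma smooth_omega_coef i : smooth (omega_coef i).
Proof.
by elim/ord5_ind: i; [exact: smooth_xcoord|exact: smooth_xcoord|
  exact: smooth_cst|exact: smooth_cst|exact: smooth_cst].
Qed.

Lemma pd_omega_coef i k p :
  pd k (omega_coef i) p = (i == it)%:R * (k == iE)%:R + (i == iq)%:R * (k == iB)%:R.
Proof.
elim/ord5_ind: i; rewrite -!val_eqE /= ?mul0r ?mul1r ?addr0 ?add0r;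
  [exact: pd_xcoord|exact: pd_xcoord|exact: pd_cst|exact: pd_cst|exact: pd_cst].
Qed.

Lemma omegaE K p : omega K p = xcoord iB p * (K == [set iq]%SET)%:R
  + xcoord iE p * (K == [set it]%SET)%:R + (K == [set iS]%SET)%:R.
Proof. by []. Qed.

Lemma omega_0 : omega finset.set0 = (fun=> 0) :> (M R -> R).
Proof.
apply/funext => p.
have E (k : 'I_5) : (finset.set0 == [set k]%SET) = false.
  by rewrite eq_sym -finset.cards_eq0 cards1.
rewrite omegaE !E /=; ring.
Qed.

Lemma omega_1 i : omega [set i]%SET = omega_coef i.
Proof.
apply/funext => p.
have E (k : 'I_5) : ([set i]%SET == [set k]%SET) = (i == k).
  exact: (inj_eq finset.set1_inj).
rewrite omegaE !E /=.
by elim/ord5_ind: i {E}; rewrite -!val_eqE /omega_coef /=; ring.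
Qed.

Lemma omega_big K : (1 < #|K|)%N -> omega K = (fun=> 0) :> (M R -> R).
Proof.
move=> K1; apply/funext => p.
have E (k : 'I_5) : (K == [set k]%SET) = false.
  by apply/eqP => Kk; rewrite Kk cards1 in K1.
rewrite omegaE !E /=; ring.
Qed.

Lemma smooth_omega : smooth_form (@omega R).
Proof.
move=> K; apply: smoothD; first apply: smoothD.
- by apply: smoothM; [exact: smooth_xcoord|exact: smooth_cst].
- by apply: smoothM; [exact: smooth_xcoord|exact: smooth_cst].
- exact: smooth_cst.
Qed.

Lemma alt_anti a i j p : alt a i j p = - alt a j i p.
Proof. by rewrite /alt finset.setUC; ring. Qed.

Lemma alt_diag a i p : alt a i i p = 0.
Proof. by rewrite /alt subrr mul0r. Qed.

Lemma alt_lt a i j p : (i < j)%N -> alt a i j p = a [set i; j]%SET p.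
Proof. by move=> ij; rewrite /alt ij ltnNge (ltnW ij) /= subr0 mul1r. Qed.

Lemma alt_add a b i j p : alt (a + b) i j p = alt a i j p + alt b i j p.
Proof. exact: mulrDr. Qed.

Lemma alt_fmul f a i j p : alt (fmul f a) i j p = f p * alt a i j p.
Proof. by rewrite /alt /fmul; ring. Qed.

Lemma alt_wedge a b i j p : alt (wedge a b) i j p
  = a finset.set0 p * alt b i j p
    + (a [set i]%SET p * b [set j]%SET p - a [set j]%SET p * b [set i]%SET p)
    + alt a i j p * b finset.set0 p.
Proof.
case: (ltngtP i j) => [ij|ji|/val_inj ->].
- by rewrite !(alt_lt _ _ ij) wedge_2.
- by rewrite alt_anti (alt_anti a) (alt_anti b) !(alt_lt _ _ ji) wedge_2 //; ring.
- by rewrite !alt_diag; ring.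
Qed.

Lemma alt_lie N a i j p : smooth_vfield N -> smooth_form a ->
  alt (lie_deriv N a) i j p
    = \sum_k (vcomp N k p * pd k (alt a i j) p
              + pd i (vcomp N k) p * alt a k j p
              - pd j (vcomp N k) p * alt a k i p).
Proof.
move=> sN sa; case: (ltngtP i j) => [ij|ji|/val_inj ->].
- rewrite (alt_lt _ _ ij) lie_2 //; apply: eq_bigr => k _.
  by rewrite pd_alt // ij (ltnNge j) (ltnW ij) /= subr0 mul1r.
- rewrite alt_anti (alt_lt _ _ ji) lie_2 // -sumrN; apply: eq_bigr => k _.
  rewrite pd_alt // ji (ltnNge i) (ltnW ji) /= (finset.setUC [set i]%SET).
  ring.
- rewrite alt_diag big1 // => k _.
  by rewrite pd_alt // ltnn /=; ring.
Qed.

(** The degree-two part of [a] after the substitution [dS = - E dt - B dq], which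
    annihilates the multiples of [omega]. *)
Definition red a i j p :=
  alt a i j p - omega_coef i p * alt a iS j p - omega_coef j p * alt a i iS p.

Lemma red_anti a i j p : red a i j p = - red a j i p.
Proof.
by rewrite /red (alt_anti a i j) (alt_anti a iS j) (alt_anti a i iS); ring.
Qed.

Lemma red_Sl a j p : red a iS j p = 0.
Proof. by rewrite /red alt_diag /omega_coef /=; ring. Qed.

Lemma smooth_red a i j : smooth_form a -> smooth (red a i j).
Proof.
move=> sa; have sm := smooth_alt _ _ sa.
have -> : red a i j = fun p => (alt a i j p + - (omega_coef i p * alt a iS j p))
                               + - (omega_coef j p * alt a i iS p) by [].
apply: smoothD; first apply: smoothD => //.
  by apply: smoothN; apply: smoothM => //; exact: smooth_omega_coef.
by apply: smoothN; apply: smoothM => //; exact: smooth_omega_coef.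
Qed.

Lemma pd_red a i j k p : smooth_form a -> pd k (red a i j) p
  = pd k (alt a i j) p
    - (pd k (omega_coef i) p * alt a iS j p + omega_coef i p * pd k (alt a iS j) p)
    - (pd k (omega_coef j) p * alt a i iS p + omega_coef j p * pd k (alt a i iS) p).
Proof.
move=> sa; have sm x y := smooth_alt x y sa; have sw := smooth_omega_coef.
have -> : red a i j = fun p => (alt a i j p + - (omega_coef i p * alt a iS j p))
                               + - (omega_coef j p * alt a i iS p) by [].
have sM x y z : smooth (fun p => omega_coef x p * alt a y z p) by apply: smoothM.
rewrite pd_add; [|by apply: smoothD => //; apply: smoothN|by apply: smoothN].
rewrite pd_add //; last exact: smoothN.
by rewrite !pd_opp // (pd_mul _ _ (sw i) (sm iS j)) (pd_mul _ _ (sw j) (sm i iS)).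
Qed.

Definition lie_omega N i p : R :=
  \sum_k (vcomp N k p * pd k (omega_coef i) p + pd i (vcomp N k) p * omega_coef k p).

Lemma lie_omegaE N i p : smooth_vfield N ->
  lie_deriv N omega [set i]%SET p = lie_omega N i p.
Proof.
move=> sN; rewrite lie_1 //; last exact: smooth_omega.
by apply: eq_bigr => k _; rewrite !omega_1.
Qed.

Definition Dred N i k p : R :=
  pd i (vcomp N k) p - omega_coef i p * pd iS (vcomp N k) p.

(** Up to the failure of [N] to preserve the line spanned by [omega], the
    Lie derivative descends to the quotient by [omega]; there the coordinate
    derivatives become the total derivatives [Dred]. *)
Lemma red_lie N a i j p : smooth_vfield N -> smooth_form a ->
  red (lie_deriv N a) i j p
    = \sum_k (vcomp N k p * pd k (red a i j) p
              + Dred N i k p * red a k j p - Dred N j k p * red a k i p)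
      + (lie_omega N i p - omega_coef i p * lie_omega N iS p) * alt a iS j p
      - (lie_omega N j p - omega_coef j p * lie_omega N iS p) * alt a iS i p.
Proof.
move=> sN sa; rewrite {1}/red !alt_lie // /lie_omega.
rewrite !mulr_sumr -!sumrB !mulr_suml -!big_split -!sumrB /=.
apply: eq_bigr => k _; rewrite pd_red // /Dred /red.
have -> : pd k (omega_coef iS) p = 0 by exact: pd_cst.
rewrite (alt_anti a k iS) (alt_anti a i iS).
have -> : pd k (alt a i iS) p = - pd k (alt a iS i) p.
  have -> : alt a i iS = fun p => - alt a iS i p.
    by apply/funext => q; exact: alt_anti.
  by rewrite pd_opp //; exact: smooth_alt.
move: (pd k (omega_coef i) p) (pd k (omega_coef j) p) (pd k _ p) (pd k _ p) (pd k _ p) => x1 x2 x3 x4 x5.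
move: (pd i _ p) (pd j _ p) (pd iS _ p) (vcomp _ _ _) => x6 x7 x8 x9.
move: (alt _ _ _ _) (alt _ _ _ _) (alt _ _ _ _) (alt _ _ _ _) (alt _ _ _ _) => y1 y2 y3 y4 y5.
move: (omega_coef _ _) (omega_coef _ _) (omega_coef _ _) => z1 z2 z3.
ring.
Qed.

End Ideal.

(** * An explicit description of the ideal *)

Section IdealMembership.
Context {R : realType}.
Variables (gamma : R) (V : R -> R -> R).
Hypothesis gamma0 : gamma != 0.
Implicit Types (N : vfield R) (a b : dform R) (p : M R) (i j k : 'I_5).
Implicit Types (f g : M R -> R) (A B K : {set 'I_5}) (J : set (dform R)).

Definition ham p : R :=
  xcoord iE p + xcoord iB p ^+ 2 / 2 - V (xcoord it p) (xcoord iq p).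

Hypothesis sham : smooth ham.

(** There is no condition in degree three and above. The four equations in degree
    two say that the reduced two-form is a combination of the reductions
    [- dq dB - dt dE] of [Omega] and [- h dt dq - (gamma / 2) dt dB] of [beta]. *)
Definition in_ideal a : Prop := smooth_form a /\ forall p,
  [/\ a finset.set0 p = 0,
      forall i, a [set i]%SET p = omega_coef i p * a [set iS]%SET p &
      [/\ red a iq iE p = 0, red a iE iB p = 0, red a it iE p = red a iq iB p
        & gamma * red a it iq p = 2 * ham p * red a it iB p]].

Lemma betaE K p : beta gamma V K p
  = ham p * wedge (dx iq) (dx it) K p
    + gamma / 2 * wedge (dx iB) (dx it) K p.
Proof. by []. Qed.

Lemma dx_0 k p : dx k finset.set0 p = 0 :> R.
Proof. by rewrite /dx eq_sym -finset.cards_eq0 cards1. Qed.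

Lemma dx_1 k i p : dx k [set i]%SET p = (i == k)%:R :> R.
Proof. by rewrite /dx (inj_eq finset.set1_inj). Qed.

Lemma smooth_dx k : smooth_form (@dx R k).
Proof. move=> K; exact: smooth_cst. Qed.

Lemma smooth_beta : smooth_form (beta gamma V).
Proof.
move=> K; have sw k l := smooth_wedge (smooth_dx k) (smooth_dx l).
by apply: smoothD; apply: smoothM => //; [exact: sw|exact: smooth_cst|exact: sw].
Qed.

Lemma beta_0 p : beta gamma V finset.set0 p = 0.
Proof. by rewrite betaE !wedge_0 !dx_0; ring. Qed.

Lemma beta_1 i p : beta gamma V [set i]%SET p = 0.
Proof. by rewrite betaE !wedge_1 !dx_0; ring. Qed.

Lemma alt_beta i j p : alt (beta gamma V) i j p
  = ham p * ((i == iq)%:R * (j == it)%:R - (j == iq)%:R * (i == it)%:R)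
    + gamma / 2 * ((i == iB)%:R * (j == it)%:R - (j == iB)%:R * (i == it)%:R).
Proof.
have E : alt (beta gamma V) i j p = ham p * alt (wedge (dx iq) (dx it)) i j p
    + gamma / 2 * alt (wedge (dx iB) (dx it)) i j p.
  by rewrite /alt betaE; ring.
by rewrite E !alt_wedge !dx_0 !dx_1; ring.
Qed.

Lemma Omega_0 p : Omega finset.set0 p = 0 :> R.
Proof. exact: ext_d_0. Qed.

Lemma Omega_1 i p : Omega [set i]%SET p = 0 :> R.
Proof. by rewrite /Omega ext_d_1 omega_0 pd_cst. Qed.

Lemma alt_Omega i j p : alt Omega i j p
  = (j == it)%:R * (i == iE)%:R + (j == iq)%:R * (i == iB)%:R
    - ((i == it)%:R * (j == iE)%:R + (i == iq)%:R * (j == iB)%:R) :> R.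
Proof. by rewrite /Omega alt_ext_d !omega_1 !pd_omega_coef. Qed.

Lemma smooth_Omega : smooth_form (@Omega R).
Proof. exact/smooth_ext_d/smooth_omega. Qed.

Lemma alt_omega i j p : alt omega i j p = 0 :> R.
Proof.
have [->|ij] := eqVneq i j; first exact: alt_diag.
by rewrite /alt omega_big ?mulr0 // cards2 ij.
Qed.

Lemma red_wedge_l a b i j p : in_ideal b ->
  red (wedge a b) i j p = a finset.set0 p * red b i j p.
Proof.
move=> [_ /(_ p)[b0 b1 _]]; rewrite /red !alt_wedge b0.
rewrite (b1 i) (b1 j).
by ring.
Qed.

Lemma red_wedge_r a b i j p : in_ideal b ->
  red (wedge b a) i j p = a finset.set0 p * red b i j p.
Proof.
move=> [_ /(_ p)[b0 b1 _]]; rewrite /red !alt_wedge b0.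
rewrite (b1 i) (b1 j).
by ring.
Qed.

Lemma in_ideal_wedge a b : smooth_form a -> in_ideal b ->
  in_ideal (wedge a b) /\ in_ideal (wedge b a).
Proof.
move=> sa ib; have [sb cb] := ib.
split; (split; first exact: smooth_wedge) => p;
  have [b0 b1 [c1 c2 c3 c4]] := cb p; split.
- by rewrite wedge_0 b0 mulr0.
- by move=> i; rewrite !wedge_1 b0 (b1 i); ring.
- by rewrite !red_wedge_l // c1 c2 c3 mulr0 mulrCA c4; split => //; ring.
- by rewrite wedge_0 b0 mul0r.
- by move=> i; rewrite !wedge_1 b0 (b1 i); ring.
- by rewrite !red_wedge_r // c1 c2 c3 mulr0 mulrCA c4; split => //; ring.
Qed.

Lemma red_add a b i j p : red (a + b) i j p = red a i j p + red b i j p.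
Proof. by rewrite /red !alt_add; ring. Qed.

Lemma red0 i j p : red (0 : dform R) i j p = 0.
Proof. by rewrite /red /alt !mulr0 !subr0. Qed.

Lemma in_ideal_is_ideal : is_ideal in_ideal.
Proof.
split.
- by move=> a [].
- split=> [K|p]; first exact: smooth_cst.
  by split=> [//|i|]; rewrite ?mulr0 // !red0 !mulr0.
- move=> a b [sa ca] [sb cb]; split=> [K|p]; first exact: smoothD.
  have [a0 a1 [a2 a3 a4 a5]] := ca p; have [b0 b1 [b2 b3 b4 b5]] := cb p.
  have D K : (a + b) K p = a K p + b K p by [].
  split=> [|i|]; first by rewrite D a0 b0 addr0.
    by rewrite !D (a1 i) (b1 i) mulrDr.
  rewrite !red_add; split; [by rewrite a2 b2 addr0|by rewrite a3 b3 addr0|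
    by rewrite a4 b4|by rewrite [gamma * _]mulrDr a5 b5 -mulrDr].
- exact: in_ideal_wedge.
Qed.

Lemma red_omega i j p : red omega i j p = 0 :> R.
Proof. by rewrite /red !alt_omega !mulr0 !subr0. Qed.

Lemma red_Omega i j p : red Omega i j p = alt Omega i j p :> R.
Proof.
by rewrite /red 2!alt_Omega (alt_Omega i iS) -!val_eqE /=; ring.
Qed.

Lemma red_beta i j p : red (beta gamma V) i j p = alt (beta gamma V) i j p.
Proof.
by rewrite /red 2!alt_beta (alt_beta i iS) -!val_eqE /=; ring.
Qed.

Lemma in_ideal_gens a :
  [\/ a = omega, a = Omega | a = beta gamma V] -> in_ideal a.
Proof.
case=> ->; split=> [|p].
- exact: smooth_omega.
- by rewrite omega_0 !red_omega !mulr0; split=> // i; rewrite !omega_1 /omega_coef /= mulr1.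
- exact: smooth_Omega.
- rewrite Omega_0; split=> // [i|]; first by rewrite !Omega_1 mulr0.
  by rewrite !red_Omega !alt_Omega -!val_eqE /=; split; ring.
- exact: smooth_beta.
- rewrite beta_0; split=> // [i|]; first by rewrite !beta_1 mulr0.
  rewrite !red_beta !alt_beta -!val_eqE /=; split; try ring.
  by field.
Qed.

Lemma HJB_in_ideal a : HJB_ideal gamma V a -> in_ideal a.
Proof.
apply; split; first exact: in_ideal_is_ideal.
exact: in_ideal_gens.
Qed.

End IdealMembership.

(** * Generating the ideal *)

Section Generation.
Context {R : realType}.
Variables (gamma : R) (V : R -> R -> R).
Hypothesis gamma0 : gamma != 0.
Implicit Types (a b : dform R) (p : M R) (i j k : 'I_5).
Implicit Types (f g : M R -> R) (A B K : {set 'I_5}).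

Hypothesis sham : smooth (ham V).

Definition mono f A : dform R := fun K p => (K == A)%:R * f p.

Lemma smooth_mono f A : smooth f -> smooth_form (mono f A).
Proof. by move=> sf K; apply: smoothM => //; exact: smooth_cst. Qed.

Lemma wedge_mono f A g B : [disjoint A & B]%B -> wedge (mono f A) (mono g B)
  = mono (fun p => wsign A B * f p * g p) (A :|: B)%SET.
Proof.
move=> AB; apply/funext => K; apply/funext => p; rewrite /wedge /mono.
have AUB : ((A :|: B) :\: A)%SET = B.
  by rewrite finset.setDUl finset.setDv finset.set0U; apply/finset.setDidPl;
     rewrite disjoint_sym.
have [->|KAB] := eqVneq K (A :|: B)%SET; last first.
  rewrite mul0r big1 // => C CK; have [CA|_] := eqVneq C A;
    last by rewrite !(mul0r, mulr0).
  have [KC|_] := eqVneq (K :\: C)%SET B;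
    last by rewrite !(mul0r, mulr0).
  case/eqP: KAB; rewrite -CA -KC; apply/finset.setP => x.
  by rewrite !inE; case: (boolP (x \in C)) => //= /(fintype.subsetP CK).
rewrite (bigD1 A) ?finset.subsetUl //= eqxx AUB eqxx big1 ?addr0 /=; first by ring.
by move=> C /andP[_ /negbTE ->]; rewrite !(mul0r, mulr0).
Qed.

Lemma wedge_mono0 f A g B : ~~ [disjoint A & B]%B ->
  wedge (mono f A) (mono g B) = 0.
Proof.
move=> AB; apply/funext => K; apply/funext => p; rewrite /wedge /mono.
rewrite big1 // => C CK; have [CA|_] := eqVneq C A;
    last by rewrite !(mul0r, mulr0).
have [KC|_] := eqVneq (K :\: C)%SET B;
    last by rewrite !(mul0r, mulr0).
case/negP: AB; rewrite -KC -CA -setI_eq0; apply/eqP/finset.setP => x.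
by rewrite !inE; case: (x \in C).
Qed.

Lemma dform_add a b K p : (a + b) K p = a K p + b K p.
Proof. by []. Qed.

Lemma dform_opp a K p : (- a) K p = - a K p.
Proof. by []. Qed.

Lemma wedgeDr a b (c : dform R) : wedge a (b + c) = wedge a b + wedge a c.
Proof.
apply/funext => K; apply/funext => p.
rewrite dform_add /wedge -big_split /=.
by apply: eq_bigr => A _; rewrite -mulrDr.
Qed.

Lemma wedge_fun f b : wedge (mono f finset.set0) b = fmul f b.
Proof.
apply/funext => K; apply/funext => p; rewrite /wedge /mono /fmul.
rewrite (bigD1 finset.set0) ?finset.sub0set //= eqxx big1 => [|A].
  by rewrite wsign0l finset.setD0 /=; ring.
by case/andP=> _ /negbTE ->; rewrite !(mul0r, mulr0).
Qed.

Lemma card_sum5 A : #|A| = ((it \in A) + (iq \in A) + (iS \in A) + (iE \in A)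
  + (iB \in A))%N.
Proof.
rewrite -sum1_card big_mkcond /= (sum5 (fun k => if k \in A then 1%N else 0%N)).
by do 5! case: (_ \in A).
Qed.

Lemma omega_mono : omega = mono (xcoord iB) [set iq]%SET
  + mono (xcoord iE) [set it]%SET + mono (fun=> 1) [set iS]%SET.
Proof.
apply/funext => K; apply/funext => p; rewrite omegaE.
by rewrite mulrC [xcoord iE p * _]mulrC -[X in _ + X]mulr1.
Qed.

Lemma Omega_big K : (2 < #|K|)%N -> Omega K = (fun=> 0) :> (M R -> R).
Proof.
move=> K2; apply/funext => p; rewrite /Omega /ext_d big1 // => k kK.
rewrite omega_big ?pd_cst ?mulr0 //.
by move: K2; rewrite (cardsD1 k) kK.
Qed.

(** A principle for comparing forms that separates the degrees treated by explicit
    formulas from the degrees in which everything lies in the ideal. *)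
Lemma dform_eq a b :
  (forall p, a finset.set0 p = b finset.set0 p) ->
  (forall i p, a [set i]%SET p = b [set i]%SET p) ->
  (forall i j p, alt a i j p = alt b i j p) ->
  (forall K p, (2 < #|K|)%N -> a K p = b K p) -> a = b.
Proof.
move=> h0 h1 h2 h3; apply/funext => K; apply/funext => p.
case: (ltnP 2 #|K|) => [|K2]; first exact: h3.
case E : #|K| K2 => [|[|[|//]]] _.
- by rewrite (finset.cards0_eq E).
- by have /eqP/cards1P[i ->] := E.
- have /eqP/cards2P[i [j [ij ->]]] := E.
  wlog lij : i j ij / (i < j)%N.
    move=> H; move: (ij); rewrite neq_ltn => /orP[|] lij; first exact: H.
    by rewrite finset.setUC; apply: H => //; rewrite eq_sym.
  by have := h2 i j p; rewrite !alt_lt.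
Qed.

Lemma alt_mono f i j k (l : 'I_5) p : (k < l)%N -> alt (mono f [set k; l]%SET) i j p
  = ((i == k)%:R * (j == l)%:R - (j == k)%:R * (i == l)%:R) * f p.
Proof.
move=> kl.
have E : mono f [set k; l]%SET = wedge (mono f [set k]%SET) (mono (fun=> 1) [set l]%SET).
  rewrite wedge_mono; last first.
    by rewrite disjoints1 inE neq_ltn kl.
  congr mono; apply/funext => q.
  by rewrite wsign11 (ltnNge l) (ltnW kl) expr0; ring.
have F (g : M R -> R) m : mono g [set m]%SET finset.set0 p = 0.
  by rewrite /mono eq_sym -finset.cards_eq0 cards1 mul0r.
have G (g : M R -> R) m n : mono g [set m]%SET [set n]%SET p = (n == m)%:R * g p.
  by rewrite /mono (inj_eq finset.set1_inj).
by rewrite E alt_wedge !F !G; ring.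
Qed.

Lemma Omega_mono : Omega = mono (fun=> -1) [set it; iE]%SET
  + mono (fun=> -1) [set iq; iB]%SET.
Proof.
apply: dform_eq.
- move=> p; rewrite Omega_0 dform_add /mono.
  by rewrite ![finset.set0 == _]eq_sym -!finset.cards_eq0 !cards2 !mul0r addr0.
- move=> i p; rewrite Omega_1 dform_add /mono.
  have E (k l : 'I_5) : k != l -> ([set i]%SET == [set k; l]%SET) = false.
    move=> kl; apply/eqP => /(congr1 (fun A : {set 'I_5} => #|A|)).
    by rewrite cards1 cards2 kl.
  by rewrite !E // !mul0r addr0.
- by move=> i j p; rewrite alt_Omega alt_add !alt_mono //; ring.
- move=> K p K2; rewrite Omega_big //.
  rewrite dform_add /mono.
  have E (k l : 'I_5) : k != l -> (K == [set k; l]%SET) = false.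
    by move=> kl; apply/eqP => Kkl; rewrite Kkl cards2 kl in K2.
  by rewrite !E // !mul0r addr0.
Qed.

Variable J : set (dform R).
Hypothesis idJ : is_ideal J.
Hypothesis Jomega : J omega.
Hypothesis JOmega : J Omega.
Hypothesis Jbeta : J (beta gamma V).

Let J0 : J 0. Proof. by case: idJ. Qed.
Let JD a b : J a -> J b -> J (a + b). Proof. by case: idJ => _ _ H _; exact: H. Qed.
Let JM a b : smooth_form a -> J b -> J (wedge a b).
Proof. by case: idJ => _ _ _ H sa Jb; case: (H a b sa Jb). Qed.
Let JF f b : smooth f -> J b -> J (fmul f b).
Proof. by move=> sf Jb; rewrite -wedge_fun; apply: JM => //; exact: smooth_mono. Qed.
Let JN b : J b -> J (- b).
Proof.
move=> Jb; have -> : - b = fmul (fun=> -1) b.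
  apply/funext => K; apply/funext => p.
  by rewrite dform_opp /fmul mulN1r.
by apply: JF => //; exact: smooth_cst.
Qed.

(** The index sets whose monomials, with arbitrary smooth coefficients, lie in the
    ideal [J]. *)
Definition full A := forall f, smooth f -> J (mono f A).

Lemma full_sup A B : B \subset A -> full B -> full A.
Proof.
move=> BA fB f sf.
have D : [disjoint (A :\: B)%SET & B]%B.
  rewrite -setI_eq0; apply/eqP/finset.setP => x.
  by rewrite !inE; case: (x \in B); rewrite ?andbF.
have -> : mono f A = wedge (mono (fun p => wsign (A :\: B)%SET B * f p) (A :\: B)%SET)
                           (mono (fun=> 1) B).
  rewrite wedge_mono // finset.setUC.
  have -> : (B :|: A :\: B)%SET = A.
    apply/finset.setP => x; rewrite !inE.
    by case: (boolP (x \in B)) => //= /(fintype.subsetP BA).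
  congr mono.
  by apply/funext => p; rewrite mulr1 mulrA -expr2 sqrr_sign mul1r.
apply: JM; last by apply: fB; exact: smooth_cst.
by apply: smooth_mono; apply: smoothM => //; exact: smooth_cst.
Qed.

Lemma full_wsign A B : [disjoint A & B]%B ->
  (forall f, smooth f -> J (wedge (mono f A) (mono (fun=> 1) B))) ->
  full (A :|: B)%SET.
Proof.
move=> AB H f sf.
have -> : mono f (A :|: B)%SET
    = wedge (mono (fun p => wsign A B * f p) A) (mono (fun=> 1) B).
  rewrite wedge_mono //; congr mono.
  by apply/funext => p; rewrite mulr1 mulrA -expr2 sqrr_sign mul1r.
by apply: H; apply: smoothM => //; exact: smooth_cst.
Qed.

(** The product of [dx_k] with [Omega] keeps only the summand of [Omega] that does
    not contain [dx_k]. *)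
Lemma full3 (k l m l' m' : 'I_5) : k \notin [set l; m]%SET -> k \in [set l'; m']%SET ->
  Omega = mono (fun=> -1) [set l; m]%SET + mono (fun=> -1) [set l'; m']%SET ->
  full (k |: [set l; m])%SET.
Proof.
move=> klm kl'm' OE; apply: full_wsign; first by rewrite disjoints1.
move=> f sf.
have : J (wedge (mono f [set k]%SET) Omega).
  by apply: JM => //; exact: smooth_mono.
rewrite OE wedgeDr (@wedge_mono0 _ _ _ [set l'; m']%SET) ?addr0; last first.
  by rewrite disjoints1 negbK.
have -> : wedge (mono f [set k]%SET) (mono (fun=> -1) [set l; m]%SET)
    = - wedge (mono f [set k]%SET) (mono (fun=> 1) [set l; m]%SET).
  rewrite !wedge_mono ?disjoints1 //.
  apply/funext => K; apply/funext => p.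
  by rewrite dform_opp /mono; ring.
by move/JN; rewrite opprK.
Qed.

(** Without [dS], a monomial of degree at least three misses at most one of [t],
    [q], [E], [B], so it contains one of the two summands of [Omega] and a further
    factor. *)
Lemma full_noS A : iS \notin A -> (2 < #|A|)%N -> full A.
Proof.
have OC : Omega = mono (fun=> -1) [set iq; iB]%SET
                + mono (fun=> -1) [set it; iE]%SET.
  by rewrite addrC Omega_mono.
have tq : full (iq |: [set it; iE])%SET.
  by apply: full3 Omega_mono; rewrite !inE.
have tB : full (iB |: [set it; iE])%SET.
  by apply: full3 Omega_mono; rewrite !inE.
have qt : full (it |: [set iq; iB])%SET.
  by apply: full3 OC; rewrite !inE.
have qE : full (iE |: [set iq; iB])%SET.
  by apply: full3 OC; rewrite !inE.
move=> /negbTE nS; rewrite card_sum5 nS.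
have S3 x y z : x \in A -> y \in A -> z \in A -> (x |: [set y; z])%SET \subset A.
  move=> xA yA zA; apply/fintype.subsetP => u; rewrite !inE.
  by case/or3P => /eqP ->.
case tA : (it \in A); case qA : (iq \in A); case EA : (iE \in A);
  case BA : (iB \in A) => //= _.
all: first [ by apply: full_sup tq; exact: S3 | by apply: full_sup tB; exact: S3
  | by apply: full_sup qt; exact: S3 | by apply: full_sup qE; exact: S3 ].
Qed.

(** The factor [dS] is traded for [omega] up to terms in [dt] and [dq], which are
    zero or fall under the preceding lemma. *)
Lemma full_big A : (2 < #|A|)%N -> full A.
Proof.
move=> A2; have [SA|SA] := boolP (iS \in A); last exact: full_noS.
pose B := (A :\ iS)%SET.
have SB : iS \notin B by rewrite !inE.
have AE : A = (B :|: [set iS])%SET by rewrite finset.setUC finset.setD1K.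
have [B2|B2] := ltnP 2 #|B|.
  by apply: full_sup (full_noS SB B2); rewrite AE finset.subsetUl.
have cB : #|B| = 2.
  by move: A2; rewrite (cardsD1 iS) SA ltnS => A2; apply/eqP; rewrite eqn_leq B2.
have D : [disjoint B & [set iS]%SET]%B by rewrite disjoint_sym disjoints1.
rewrite AE; apply: full_wsign => // f sf.
have Jk (g : M R -> R) k : smooth g -> k != iS ->
    J (wedge (mono f B) (mono g [set k]%SET)).
  move=> sg kS; have [kB|kB] := boolP (k \in B).
    by rewrite wedge_mono0 // disjoint_sym disjoints1 negbK.
  have Dk : [disjoint B & [set k]%SET]%B by rewrite disjoint_sym disjoints1.
  rewrite wedge_mono //; apply: full_noS.
  - by rewrite !inE negb_or eq_sym kS eqxx.
  - by rewrite finset.setUC cardsU1 kB cB.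
  - by apply: smoothM => //; apply: smoothM => //; exact: smooth_cst.
have := JM (smooth_mono B sf) Jomega.
rewrite omega_mono !wedgeDr => H.
have E : wedge (mono f B) (mono (fun=> 1) [set iS]%SET)
    = wedge (mono f B) (mono (xcoord iB) [set iq]%SET)
      + wedge (mono f B) (mono (xcoord iE) [set it]%SET)
      + wedge (mono f B) (mono (fun=> 1) [set iS]%SET)
      + (- wedge (mono f B) (mono (xcoord iB) [set iq]%SET)
         - wedge (mono f B) (mono (xcoord iE) [set it]%SET)).
  by rewrite -opprD addrAC subrr add0r.
rewrite E; apply: (JD H); apply: JD; apply: JN; apply: Jk => //;
  exact: smooth_xcoord.
Qed.

Lemma J_sum (I : finType) (P : pred I) (F : I -> dform R) :
  (forall x, P x -> J (F x)) -> J (\sum_(x | P x) F x).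
Proof. by move=> JFi; elim/big_ind: _. Qed.

Lemma J_big a : smooth_form a -> (forall p, a finset.set0 p = 0) ->
  (forall i p, a [set i]%SET p = 0) -> (forall i j p, alt a i j p = 0) -> J a.
Proof.
move=> sa a0 a1 a2.
have sumE (F : {set 'I_5} -> dform R) K p :
    (\sum_(A : {set 'I_5} | (2 < #|A|)%N) F A) K p
    = \sum_(A : {set 'I_5} | (2 < #|A|)%N) F A K p.
  by elim/big_rec2: _ => // A x y _ <-.
have small K p : (#|K| <= 2)%N ->
    (\sum_(A : {set 'I_5} | (2 < #|A|)%N) mono (a A) A) K p = 0.
  move=> K2; rewrite sumE big1 // => A A2; rewrite /mono.
  by have [KA|] := eqVneq K A; [rewrite -KA ltnNge K2 in A2|rewrite mul0r].
suff -> : a = \sum_(A : {set 'I_5} | (2 < #|A|)%N) mono (a A) A.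
  by apply: J_sum => A A2; apply: full_big.
apply: dform_eq.
- by move=> p; rewrite a0 small // cards0.
- by move=> i p; rewrite a1 small // cards1.
- move=> i j p; rewrite a2 /alt small ?mulr0 // cards2.
  by case: (_ != _).
- move=> K p K2; rewrite sumE (bigD1 K) //= /mono eqxx mul1r big1 ?addr0 //.
  by move=> A /andP[_ /negbTE AK]; rewrite eq_sym AK mul0r.
Qed.

(** In degree two, [a] is [omega] times the one-form of its [dS]-coefficients plus
    its reduction, and the equations of [in_ideal] make the reduction a combination
    [f Omega + g beta]. *)
Lemma in_ideal_gen a : in_ideal gamma V a -> J a.
Proof.
case=> sa ca.
have sal i j := smooth_alt i j sa; have sr i j := smooth_red i j sa.
pose eta : dform R := fun K p => \sum_j (K == [set j]%SET)%:R * alt a iS j p.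
have seta : smooth_form eta.
  by move=> K; apply: smooth_sum => j _; apply: smoothM => //; exact: smooth_cst.
have eta0 p : eta finset.set0 p = 0.
  rewrite /eta big1 // => j _.
  by rewrite eq_sym -finset.cards_eq0 cards1 mul0r.
have eta1 i p : eta [set i]%SET p = alt a iS i p.
  rewrite /eta (bigD1 i) //= eqxx mul1r big1 ?addr0 // => j ji.
  by rewrite (inj_eq finset.set1_inj) eq_sym (negbTE ji) mul0r.
(* The reductions of Omega and beta have coefficients -1 at dt dE and
   - gamma / 2 at dt dB. *)
pose f p := - red a it iE p.
pose g p := - (2 / gamma) * red a it iB p.
have sf : smooth f by exact: smoothN.
have sg : smooth g by apply: smoothM => //; exact: smooth_cst.
pose b := fmul (a [set iS]%SET) omega + wedge omega eta + fmul f Omega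
          + fmul g (beta gamma V).
have bE K p : b K p = a [set iS]%SET p * omega K p + wedge omega eta K p
    + f p * Omega K p + g p * beta gamma V K p by [].
have Jb : J b.
  apply: JD; first apply: JD; first apply: JD.
  - by apply: JF => //; exact: sa.
  - by have [_ _ _ H] := idJ; have [] := H eta omega seta Jomega.
  - exact: JF.
  - exact: JF.
have altb i j p : alt b i j p = omega_coef i p * alt a iS j p - omega_coef j p * alt a iS i p
    + f p * alt Omega i j p + g p * alt (beta gamma V) i j p.
  rewrite /b 3!alt_add !alt_fmul alt_omega alt_wedge omega_0 eta0 !omega_1 !eta1.
  by ring.
have sb : smooth_form b by have [H _ _ _] := idJ; exact: H.
have -> : a = b + (a - b) by rewrite addrC subrK.
apply: (JD Jb); apply: J_big.
- move=> K; have -> : (a - b) K = (fun p => a K p + - b K p) by [].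
  by apply: smoothD => //; exact: smoothN.
- move=> p; have [a0 _ _] := ca p.
  rewrite dform_add dform_opp bE omega_0 Omega_0 beta_0 // wedge_0 omega_0 a0.
  ring.
- move=> i p; have [_ a1 _] := ca p.
  rewrite dform_add dform_opp bE Omega_1 beta_1 // wedge_1 omega_0 omega_1.
  by rewrite eta0 (a1 i); ring.
- have key i j p : red a i j p
      = f p * alt Omega i j p + g p * alt (beta gamma V) i j p ->
      alt (a - b) i j p = 0.
    move=> E; have -> : alt (a - b) i j p = alt a i j p - alt b i j p.
      by rewrite /alt -mulrBr.
    have -> : alt a i j p = red a i j p + omega_coef i p * alt a iS j p
        - omega_coef j p * alt a iS i p.
      by rewrite /red (alt_anti a i iS); ring.
    by rewrite altb E; ring.
  have antisym i j p : alt (a - b) i j p = 0 -> alt (a - b) j i p = 0.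
    by move=> E; rewrite alt_anti E oppr0.
  move=> i j p.
  wlog ij : i j / (i < j)%N.
    move=> H; case: (ltngtP i j) => [ij|ji|/val_inj ->].
    - exact: H.
    - by apply: antisym; exact: H.
    - exact: alt_diag.
  apply: key.
  have [_ _ [c1 c2 c3 c4]] := ca p.
  rewrite alt_Omega alt_beta // -!val_eqE /f /g.
  have c4' : red a it iq p = 2 / gamma * ham V p * red a it iB p.
    apply: (mulfI gamma0); rewrite c4; by field.
  move: ij; elim/ord5_ind: i; elim/ord5_ind: j => //= _;
    rewrite ?red_Sl ?(red_anti _ _ iS) ?red_Sl ?c1 ?c2 ?c4' ?c3; try ring.
  all: by field.
Qed.

End Generation.

Lemma HJB_idealE (R : realType) (gamma : R) (V : R -> R -> R) (a : dform R) :
  gamma != 0 -> smooth (ham V) ->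
  HJB_ideal gamma V a <-> in_ideal gamma V a.
Proof.
move=> g0 sV; split; first exact: HJB_in_ideal.
move=> Ia J [idJ gJ]; apply: (@in_ideal_gen R gamma V) => //; apply: gJ.
- by constructor 1.
- by constructor 2.
- by constructor 3.
Qed.

(** * The determining equations *)

(** The differential calculus used to solve the determining equations. They are
    solved over an abstract calculus: the argument is differential algebra, and it
    uses of the commutation of second derivatives the last rule only. *)
Record is_calculus (R : realType) (X : Type) (D : 'I_5 -> (X -> R) -> X -> R)
    (S : (X -> R) -> Prop) (x : 'I_5 -> X -> R) : Prop := IsCalculus {
  calc_cst : forall c : R, S (fun=> c);
  calc_coord : forall i, S (x i);
  calc_add : forall f g, S f -> S g -> S (fun p => f p + g p);
  calc_mul : forall f g, S f -> S g -> S (fun p => f p * g p);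
  calc_opp : forall f, S f -> S (fun p => - f p);
  calc_D : forall k f, S f -> S (D k f);
  D_cst : forall k (c : R) p, D k (fun=> c) p = 0;
  D_coord : forall k i p, D k (x i) p = (k == i)%:R;
  D_add : forall k f g p, S f -> S g ->
    D k (fun p => f p + g p) p = D k f p + D k g p;
  D_mul : forall k f g p, S f -> S g ->
    D k (fun p => f p * g p) p = D k f p * g p + f p * D k g p;
  D_opp : forall k f p, S f -> D k (fun p => - f p) p = - D k f p;
  D_D0 : forall i k f, S f -> (forall p, D i f p = 0) ->
    forall p, D i (D k f) p = 0 }.

Lemma M_calculus (R : realType) : is_calculus (@pd R) smooth xcoord.
Proof.
split.
- exact: smooth_cst.
- exact: smooth_xcoord.
- exact: smoothD.
- exact: smoothM.
- exact: smoothN.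
- move=> k f; exact: smooth_pd.
- exact: pd_cst.
- exact: pd_xcoord.
- exact: pd_add.
- exact: pd_mul.
- exact: pd_opp.
- exact: pd_pd0.
Qed.

Section AbstractCalculus.
Context {R : realType} {X : Type} (D : 'I_5 -> (X -> R) -> X -> R)
  (S : (X -> R) -> Prop) (x : 'I_5 -> X -> R).
Hypothesis calc : is_calculus D S x.
Implicit Types (f g : X -> R) (p q : X).

Ltac smooth_tac := by repeat first [assumption | apply: (calc_cst calc) |
  apply: (calc_coord calc) | apply: (calc_D calc) | apply: (calc_add calc) |
  apply: (calc_mul calc) | apply: (calc_opp calc)].

Ltac derive_tac := repeat first
  [ rewrite (D_add calc); [|smooth_tac|smooth_tac]
  | rewrite (D_mul calc); [|smooth_tac|smooth_tac]
  | rewrite (D_opp calc); [|smooth_tac]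
  | rewrite (D_cst calc)
  | rewrite (D_coord calc) ].

(* The identities to be checked are polynomial in the values of the functions
   involved, which are replaced by plain variables. *)
Ltac abstract_atoms := repeat match goal with
  | |- context [D ?k ?f ?q] => generalize (D k f q)
  | |- context [x ?k ?q] => generalize (x k q)
  | |- context [?f ?q] => is_var f;
      match type of q with X => generalize (f q) end
  end; intros.
Ltac mring := abstract_atoms; ring.
Ltac mfield := abstract_atoms; by field.

Lemma D_ext k f g : (forall p, f p = g p) -> forall p, D k f p = D k g p.
Proof. by move=> fg p; have -> : f = g by apply/funext. Qed.

Section StructureEquations.

(** The functions [a], [b], [c], [e], [m] stand for the components of the field along
    [t], [q], [S], [E], [B], the function [v] for the potential. The hypotheses [H1]
    to [H4] say that the field preserves the line of [omega], and [H5] to [H7] that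
    the Lie derivative of [beta] satisfies the equations of the ideal. *)
Variables (gamma : R) (a b c e m v : X -> R).
Hypothesis gamma0 : gamma != 0.
Hypotheses (sa : S a) (sb : S b) (sc : S c) (se : S e) (sm : S m) (sv : S v).
Let h p : R := x iE p + x iB p * x iB p / 2 - v p.
Hypothesis v0 : forall k p, k != iq -> D k v p = 0.
Hypothesis H1 : forall p, x iE p * D iE a p + x iB p * D iE b p + D iE c p = 0.
Hypothesis H2 : forall p, x iE p * D iB a p + x iB p * D iB b p + D iB c p = 0.
Let lambda p := x iE p * D iS a p + x iB p * D iS b p + D iS c p.
Hypothesis H3 : forall p,
  e p + x iE p * D it a p + x iB p * D it b p + D it c p = x iE p * lambda p.
Hypothesis H4 : forall p,
  m p + x iE p * D iq a p + x iB p * D iq b p + D iq c p = x iB p * lambda p.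
Hypothesis H5 : forall p, D iE a p = 0.
Hypothesis H6 : forall p, - (h p * D iE b p + gamma / 2 * D iE m p)
  = - (gamma / 2) * (D iq a p - x iB p * D iS a p) + h p * D iB a p.
Hypothesis H7 : forall p,
  gamma * (- (- (b p * D iq v p) + e p + x iB p * m p)
           - (D it a p - x iE p * D iS a p) * h p
           - h p * (D iq b p - x iB p * D iS b p)
           - gamma / 2 * (D iq m p - x iB p * D iS m p))
  = 2 * h p * (- (gamma / 2) * (D it a p - x iE p * D iS a p)
               - h p * D iB b p - gamma / 2 * D iB m p).
Hypothesis H8 : forall p, D iS c p = 0.

(** With [G = B b + c], the first equations say that the contact Hamiltonian
    [E a + G] generates the field, while [a] and [G] do not depend on [E]. Then [H6]
    is affine in [E] through [h] alone, and its [E]-derivative forces [D iB a = 0];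
    what is left is affine in [B]. *)
Lemma structure_time p : [/\ D iB a p = 0, D iS a p = 0, D iq a p = 0
  & D iE b p = 0].
Proof.
have aE k q : D iE (D k a) q = 0 by exact: (D_D0 calc).
pose G p := x iB p * b p + c p.
have sG : S G by rewrite /G; smooth_tac.
have GD k q : D k G q = (k == iB)%:R * b q + x iB q * D k b q + D k c q.
  by rewrite /G; derive_tac.
have G_E q : D iE G q = 0.
  rewrite GD; have := H1 q; rewrite H5.
  by rewrite -!val_eqE /= => E; rewrite -[RHS]E; mring.
clearbody G.
have GE k q : D iE (D k G) q = 0 by exact: (D_D0 calc).
have bE q : b q = D iB G q + x iE q * D iB a q.
  rewrite GD; have := H2 q.
  by rewrite eqxx /= => E; rewrite -[LHS]addr0 -E; mring.
have b_E q : D iE b q = D iB a q.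
  rewrite (D_ext iE bE); derive_tac; rewrite GE aE eqxx /=; mring.
have mE q : m q = x iB q * (x iE q * D iS a q) + x iB q * D iS G q
    - x iE q * D iq a q - D iq G q.
  rewrite !GD -!val_eqE /=; have := H4 q; rewrite /lambda => /eqP.
  rewrite -subr_eq0 => /eqP E; apply/eqP; rewrite -subr_eq0; apply/eqP.
  by rewrite -[RHS]E; mring.
have m_E q : D iE m q = x iB q * D iS a q - D iq a q.
  rewrite (D_ext iE mE); derive_tac; rewrite !GE !aE -!val_eqE /=; mring.
have K6 q : 2 * (x iE q + x iB q * x iB q / 2 - v q) * D iB a q
    - gamma * (D iq a q - x iB q * D iS a q) = 0.
  have := H6 q; rewrite b_E m_E /h => /eqP; rewrite -subr_eq0 => /eqP E.
  by rewrite -[RHS]oppr0 -E; mfield.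
have a_B q : D iB a q = 0.
  have := D_ext iE K6 q; derive_tac; rewrite !aE v0 // -!val_eqE /= => E.
  have E2 : 2 * D iB a q = 0 by rewrite -[RHS]E; mring.
  by move/eqP: E2; rewrite mulf_eq0 pnatr_eq0 /= => /eqP.
have aB k q : D iB (D k a) q = 0 by exact: (D_D0 calc).
have K q : D iq a q - x iB q * D iS a q = 0.
  have := K6 q; rewrite a_B mulr0 sub0r => /eqP.
  by rewrite oppr_eq0 mulf_eq0 (negbTE gamma0) => /eqP.
have a_S q : D iS a q = 0.
  have := D_ext iB K q; derive_tac; rewrite !aB -!val_eqE /= => E.
  by rewrite -[RHS]oppr0 -E; mring.
split=> //; last by rewrite b_E.
by have := K p; rewrite a_S mulr0 subr0.
Qed.

Lemma structure_time_only k p : k != it -> D k a p = 0.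
Proof.
have [aB aS aq _] := structure_time p.
by elim/ord5_ind: k => // _; exact: H5.
Qed.

Let aa j k p : j != it -> D j (D k a) p = 0.
Proof. by move=> jt; apply: (D_D0 calc) => // q; exact: structure_time_only. Qed.

(** Now [H7] is a polynomial of degree two in [E]: its second derivative gives
    [D iB b = 0], and the first one, affine in [B], determines [D iS b] and
    [D iq b]. The rest of [H7] is affine in [B] again and yields [D iq c] and the
    final equation. *)
Lemma structure_space_action : (forall k p, k \in [:: iS; iE; iB] -> D k b p = 0) /\
  [/\ forall k p, k \in [:: iS; iE; iB] -> D k c p = 0,
      forall p, D iq b p = D it a p / 2,
      forall p, D iq c p = - D it b p &
  [/\ forall p, m p = - (D it a p / 2) * x iB p + D it b p,
      forall p, e p = - (D it b p * x iB p) - D it a p * x iE p - D it c p &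
      forall p, D iq v p * b p + D it c p + v p * D it a p
                - gamma / 2 * D iq (D it b) p = 0 ]].
Proof.
have b_E q : D iE b q = 0 by have [] := structure_time q.
have bE k' q : D iE (D k' b) q = 0 by exact: (D_D0 calc).
have c_E q : D iE c q = 0.
  by have := H1 q; rewrite b_E structure_time_only // !mulr0 !add0r.
have cE k' q : D iE (D k' c) q = 0 by exact: (D_D0 calc).
have cS k' q : D iS (D k' c) q = 0 by exact: (D_D0 calc).
have lE q : lambda q = x iB q * D iS b q.
  by rewrite /lambda H8 structure_time_only //; mring.
have mE q : m q = x iB q * (x iB q * D iS b q) - x iB q * D iq b q - D iq c q.
  have := H4 q; rewrite lE structure_time_only // => E; rewrite -E; mring.
have eE q : e q = x iE q * (x iB q * D iS b q) - x iE q * D it a q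
    - x iB q * D it b q - D it c q.
  have := H3 q; rewrite lE => E; rewrite -E; mring.
have m_E q : D iE m q = 0.
  rewrite (D_ext iE mE); derive_tac; rewrite !bE !cE -!val_eqE /=; mring.
have mmE k' q : D iE (D k' m) q = 0 by exact: (D_D0 calc).
have e_E q : D iE e q = x iB q * D iS b q - D it a q.
  rewrite (D_ext iE eE); derive_tac; rewrite !bE !cE aa // -!val_eqE /=; mring.
have K7 q : gamma * (b q * D iq v q - e q - x iB q * m q
       - (x iE q + x iB q * x iB q / 2 - v q) * (D iq b q - x iB q * D iS b q)
       - gamma / 2 * (D iq m q - x iB q * D iS m q))
    + 2 * ((x iE q + x iB q * x iB q / 2 - v q)
           * (x iE q + x iB q * x iB q / 2 - v q) * D iB b q)
    + (x iE q + x iB q * x iB q / 2 - v q) * gamma * D iB m q = 0.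
  have := H7 q; rewrite /h (@structure_time_only iS) // => /eqP.
  by rewrite -subr_eq0 => /eqP E; rewrite -[RHS]E; mfield.
have v_E q : D iE v q = 0 by rewrite v0.
have vE k' q : D iE (D k' v) q = 0 by exact: (D_D0 calc).
have K8 q : gamma * (- (x iB q * D iS b q - D it a q)
       - (D iq b q - x iB q * D iS b q))
    + 4 * ((x iE q + x iB q * x iB q / 2 - v q) * D iB b q)
    + gamma * D iB m q = 0.
  have := D_ext iE K7 q; derive_tac.
  rewrite !bE !mmE e_E b_E m_E vE v_E -!val_eqE /= => E.
  by rewrite -[RHS]E; mfield.
have b_B q : D iB b q = 0.
  have := D_ext iE K8 q; derive_tac.
  rewrite !bE !mmE aa // v_E -!val_eqE /= => E.
  have E2 : 4 * D iB b q = 0 by rewrite -[RHS]E; mring.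
  by move/eqP: E2; rewrite mulf_eq0 pnatr_eq0 /= => /eqP.
have bB k' q : D iB (D k' b) q = 0 by exact: (D_D0 calc).
have c_B q : D iB c q = 0.
  by have := H2 q; rewrite b_B structure_time_only // !mulr0 !add0r.
have cB k' q : D iB (D k' c) q = 0 by exact: (D_D0 calc).
have m_B q : D iB m q = 2 * x iB q * D iS b q - D iq b q.
  rewrite (D_ext iB mE); derive_tac; rewrite !bB !cB -!val_eqE /=; mring.
have K9 q : D it a q - 2 * D iq b q + 2 * x iB q * D iS b q = 0.
  have := K8 q; rewrite b_B m_B => E.
  by apply: (mulfI gamma0); rewrite mulr0 -[RHS]E; mring.
have b_S q : D iS b q = 0.
  have := D_ext iB K9 q; derive_tac; rewrite !bB aa // -!val_eqE /= => E.
  have E2 : 2 * D iS b q = 0 by rewrite -[RHS]E; mring.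
  by move/eqP: E2; rewrite mulf_eq0 pnatr_eq0 /= => /eqP.
have b_q q : D iq b q = D it a q / 2.
  have := K9 q; rewrite b_S mulr0 addr0 => /eqP; rewrite subr_eq0 => /eqP ->.
  by mfield.
have bS k' q : D iS (D k' b) q = 0 by exact: (D_D0 calc).
have m_S q : D iS m q = 0.
  rewrite (D_ext iS mE); derive_tac; rewrite !bS !cS -!val_eqE /=; mring.
have b_qq q : D iq (D iq b) q = 0.
  rewrite (D_ext iq b_q); derive_tac; rewrite aa //; mring.
have mE' q : m q = - (D it a q / 2) * x iB q - D iq c q.
  by rewrite mE b_S b_q; mring.
have m_q q : D iq m q = - D iq (D iq c) q.
  rewrite (D_ext iq mE'); derive_tac; rewrite aa // -!val_eqE /=; mring.
have K10 q : b q * D iq v q + x iB q * D it b q + D it c q + x iB q * D iq c q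
    + v q * D it a q + gamma / 2 * D iq (D iq c) q = 0.
  have := K7 q; rewrite b_B m_B m_S m_q b_S b_q mE' eE b_S => E.
  by apply: (mulfI gamma0); rewrite mulr0 -[RHS]E; mfield.
have vB k' q : D iB (D k' v) q = 0.
  by apply: (D_D0 calc) => // p; exact: v0.
have c_q q : D iq c q = - D it b q.
  have := D_ext iB K10 q; derive_tac.
  rewrite !bB !cB (D_D0 calc iq (calc_D calc iq sc) (cB iq)) vB b_B (@v0 iB) // aa //.
  rewrite -!val_eqE /= => E; apply/eqP; rewrite -subr_eq0; apply/eqP.
  by rewrite -[RHS]E; mring.
have inSEB (P : 'I_5 -> Prop) : P iS -> P iE -> P iB -> forall k, k \in [:: iS; iE; iB] -> P k.
  by move=> ? ? ? k; rewrite !inE => /or3P[] /eqP ->.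
split=> [k p|]; first by apply: (inSEB (fun k => D k b p = 0)).
split=> //; first by move=> k p; apply: (inSEB (fun k => D k c p = 0)).
split.
- by move=> p; rewrite mE' c_q; mring.
- by move=> p; rewrite eE b_S; mring.
- move=> p; have := K10 p; rewrite c_q (D_ext iq c_q); derive_tac => E.
  by rewrite -[RHS]E; mring.
Qed.

(** Integrating the relations for [b] and [c] in [q] leaves two constants of
    integration, [l] and [s], which with [a] determine the field. *)
Lemma structure_equations : exists l s,
  [/\ S l, S s, forall k p, k != it -> D k a p = 0,
      forall k p, k != it -> D k l p = 0 & forall k p, k != it -> D k s p = 0]
  /\ forall p,
  [/\ b p = D it a p * x iq p / 2 + l p,
      c p = - (D it (D it a) p / 4 * (x iq p * x iq p) + D it l p * x iq p - s p),
      m p = - (D it a p / 2) * x iB p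
            + (D it (D it a) p / 2 * x iq p + D it l p),
      e p = - (D it (D it a) p * x iq p / 2 + D it l p) * x iB p
            - D it a p * x iE p
            + (D it (D it (D it a)) p / 4 * (x iq p * x iq p)
               + D it (D it l) p * x iq p - D it s p) &
      - D iq v p * (x iq p * D it a p / 2 + l p) - D it s p
      + x iq p * x iq p * D it (D it (D it a)) p / 4
      + x iq p * D it (D it l) p - v p * D it a p
      + gamma / 4 * D it (D it a) p = 0].
Proof.
pose l p := b p - x iq p * D it a p / 2.
pose s p := c p + x iq p * x iq p * D it (D it a) p / 4 + x iq p * D it l p.
exists l, s; have [b0 [c0 b_q c_q [mE eE ode]]] := structure_space_action.
have sl : S l by rewrite /l; smooth_tac.
have lD k p : D k l p = D k b p - ((k == iq)%:R * D it a p / 2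
    + x iq p * D k (D it a) p / 2).
  by rewrite /l; derive_tac; mring.
have bE p : b p = D it a p * x iq p / 2 + l p by rewrite /l; mring.
have l0 k p : k != it -> D k l p = 0.
  rewrite lD => kt; rewrite aa //.
  have [->|kq] := eqVneq k iq; first by rewrite b_q /=; mring.
  rewrite b0 /=; first by mring.
  by move: k kt kq; apply: ord5_ind.
clearbody l.
have ll k p j : k != it -> D k (D j l) p = 0.
  by move=> kt; apply: (D_D0 calc) => // q; exact: l0.
have aaa i j k p : i != it -> D i (D j (D k a)) p = 0.
  by move=> kt; apply: (D_D0 calc) => [|q]; [smooth_tac|exact: aa].
have b_t p : D it b p = D it (D it a) p / 2 * x iq p + D it l p.
  by rewrite lD -!val_eqE /=; mring.
have b_tq p : D iq (D it b) p = D it (D it a) p / 2.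
  rewrite (D_ext iq b_t); derive_tac; rewrite aaa // ll // -!val_eqE /=; mring.
have ss : S s by rewrite /s; smooth_tac.
have sD k p : D k s p = D k c p + ((k == iq)%:R * x iq p * D it (D it a) p / 2
    + x iq p * x iq p * D k (D it (D it a)) p / 4)
    + ((k == iq)%:R * D it l p + x iq p * D k (D it l) p).
  by rewrite /s; derive_tac; mfield.
have sE p : s p = c p + x iq p * x iq p * D it (D it a) p / 4
    + x iq p * D it l p by [].
have s0 k p : k != it -> D k s p = 0.
  rewrite sD => kt; rewrite aaa // ll //.
  have [->|kq] := eqVneq k iq; first by rewrite c_q b_t /=; mring.
  rewrite c0 /=; first by mring.
  by move: k kt kq; apply: ord5_ind.
clearbody s; split.
  by split=> // k p; exact: structure_time_only.
move=> p.
have c_t : D it c p = D it s p - x iq p * x iq p * D it (D it (D it a)) p / 4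
    - x iq p * D it (D it l) p.
  by rewrite sD -!val_eqE /=; mring.
split=> //.
- by rewrite sE; mring.
- by rewrite mE b_t.
- by rewrite eE b_t c_t; mring.
- have := ode p; rewrite b_tq c_t bE => E.
  by rewrite -[RHS]oppr0 -E; mfield.
Qed.

End StructureEquations.

(** Conversely, the Jacobian matrix of the fields found above; the functions of time
    enter through their derivatives only. *)
Section FieldDerivatives.

Variables (T T1 T2 T3 l l1 l2 s s1 : X -> R).
Hypotheses (sT : S T) (sT1 : S T1) (sT2 : S T2) (sT3 : S T3) (sl : S l)
  (sl1 : S l1) (sl2 : S l2) (ss : S s) (ss1 : S s1).
Hypothesis dT1 : forall k p, D k T1 p = (k == it)%:R * T2 p.
Hypothesis dT2 : forall k p, D k T2 p = (k == it)%:R * T3 p.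
Hypothesis dl : forall k p, D k l p = (k == it)%:R * l1 p.
Hypothesis dl1 : forall k p, D k l1 p = (k == it)%:R * l2 p.
Hypothesis ds : forall k p, D k s p = (k == it)%:R * s1 p.

Lemma D_Nq k p : D k (fun p => T1 p * x iq p / 2 + l p) p
  = (k == it)%:R * (T2 p * x iq p / 2 + l1 p) + (k == iq)%:R * (T1 p / 2).
Proof. by derive_tac; rewrite dT1 dl; ring. Qed.

Lemma D_NS k p :
  D k (fun p => - (T2 p / 4 * (x iq p * x iq p) + l1 p * x iq p - s p)) p
  = - ((k == it)%:R * (T3 p / 4 * (x iq p * x iq p) + l2 p * x iq p - s1 p)
       + (k == iq)%:R * (T2 p * x iq p / 2 + l1 p)).
Proof. by derive_tac; rewrite dT2 dl1 ds; field. Qed.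

Lemma D_NB k p :
  D k (fun p => - (T1 p / 2) * x iB p + (T2 p / 2 * x iq p + l1 p)) p
  = (k == it)%:R * (- (T2 p / 2) * x iB p + (T3 p / 2 * x iq p + l2 p))
    + (k == iB)%:R * - (T1 p / 2) + (k == iq)%:R * (T2 p / 2).
Proof. by derive_tac; rewrite dT1 dT2 dl1; ring. Qed.

Lemma D_NE k p :
  D k (fun p => - (T2 p * x iq p / 2 + l1 p) * x iB p - T1 p * x iE p
          + (T3 p / 4 * (x iq p * x iq p) + l2 p * x iq p - s1 p)) p
  = (k == it)%:R * (- (T3 p * x iq p / 2 + l2 p) * x iB p - T2 p * x iE p)
    + (k == iB)%:R * - (T2 p * x iq p / 2 + l1 p) - (k == iE)%:R * T1 p
    + (k == iq)%:R * (- (T2 p / 2) * x iB p + (T3 p * x iq p / 2 + l2 p))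
    + (D k T3 p / 4 * (x iq p * x iq p) + D k l2 p * x iq p - D k s1 p).
Proof. by derive_tac; rewrite dT1 dT2 dl1; field. Qed.

End FieldDerivatives.

End AbstractCalculus.

(** * Isovectors for the potential C / q^2 + D q^2 *)

(* The identities to be checked are polynomial in the values of the functions
   involved, which are replaced by plain variables. *)
Ltac abstract_atoms := repeat match goal with
  | |- context [pd ?k ?f ?q] => generalize (pd k f q)
  | |- context [vcomp ?N ?k ?q] => generalize (vcomp N k q)
  | |- context [xcoord ?k ?q] => generalize (xcoord k q)
  | |- context [?f ?q] => is_var f;
      match type of q with M _ => generalize (f q) end
  end; intros.

Section Isovectors.
Context {R : realType}.
Variables (gamma C D : R).
Hypothesis gamma0 : gamma != 0.
Implicit Types (N : vfield R) (p : M R) (i j k : 'I_5).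

Definition pot p : R := potential C D (xcoord it p) (xcoord iq p).

Lemma xq_neq0 p : xcoord iq p != 0.
Proof. exact: lt0r_neq0 (val_gt0 p). Qed.

Lemma xq2_neq0 p : xcoord iq p ^+ 2 != 0.
Proof. by rewrite expf_neq0 // xq_neq0. Qed.

Lemma smooth_pot : smooth pot.
Proof.
rewrite /pot /potential; apply: smoothD; apply: smoothM;
  try exact: smooth_cst; last by apply: smoothX; exact: smooth_xcoord.
by apply: smoothV; [exact: xq2_neq0|apply: smoothX; exact: smooth_xcoord].
Qed.

Lemma pd_pot k p : pd k pot p = (k == iq)%:R
  * (- (2 * C / xcoord iq p ^+ 3) + 2 * D * xcoord iq p).
Proof.
have sq : smooth (@xcoord R iq) by exact: smooth_xcoord.
have sq2 : smooth (fun p : M R => xcoord iq p ^+ 2) by exact: smoothX.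
have sV := smoothV xq2_neq0 sq2.
have sc (x : R) : smooth (fun _ : M R => x) by exact: smooth_cst.
rewrite (_ : pot = fun p => C * (xcoord iq p ^+ 2)^-1 + D * xcoord iq p ^+ 2) //.
rewrite pd_add; [|exact: smoothM|exact: smoothM].
rewrite pd_scale // pd_scale // (pdV _ _ xq2_neq0 (smooth_diffble sq2)).
rewrite pd_sqr // pd_xcoord; have := xq_neq0 p.
by move: (_ == _)%:R (xcoord iq p) => e q q0; field.
Qed.

Lemma hamE p : ham (potential C D) p
  = xcoord iE p + xcoord iB p * xcoord iB p / 2 - pot p.
Proof. by rewrite /ham expr2. Qed.

Lemma smooth_ham : smooth (ham (potential C D)).
Proof.
apply: smoothD; last by apply: smoothN; exact: smooth_pot.
apply: smoothD; first exact: smooth_xcoord.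
by apply: smoothM; [apply: smoothX; exact: smooth_xcoord|exact: smooth_cst].
Qed.

Lemma pd_ham k p : pd k (ham (potential C D)) p
  = (k == iE)%:R + (k == iB)%:R * xcoord iB p - pd k pot p.
Proof.
have sB : smooth (@xcoord R iB) by exact: smooth_xcoord.
have sE : smooth (@xcoord R iE) by exact: smooth_xcoord.
have sV := smooth_pot.
have s2 : smooth (fun p : M R => xcoord iB p * xcoord iB p / 2).
  by apply: smoothM; [exact: smoothM|exact: smooth_cst].
rewrite (pd_ext k hamE) pd_add; [|exact: smoothD|exact: smoothN].
rewrite pd_add // pd_opp // pd_mul; [|exact: smoothM|exact: smooth_cst].
rewrite pd_cst pd_mul // !pd_xcoord.
by move: (_ == _)%:R (_ == _)%:R (xcoord iB p) (pd _ _ _) => a b c d; field.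
Qed.

Local Notation beta' := (beta gamma (potential C D)).

Lemma pd_red_beta i j k p : pd k (red beta' i j) p
  = pd k (ham (potential C D)) p
    * ((i == iq)%:R * (j == it)%:R - (j == iq)%:R * (i == it)%:R).
Proof.
have sh := smooth_ham.
pose c1 : R := (i == iq)%:R * (j == it)%:R - (j == iq)%:R * (i == it)%:R.
pose c2 : R := gamma / 2
  * ((i == iB)%:R * (j == it)%:R - (j == iB)%:R * (i == it)%:R).
have E q : red beta' i j q = ham (potential C D) q * c1 + c2.
  by rewrite red_beta // alt_beta.
have sc (x : R) : smooth (fun _ : M R => x) by exact: smooth_cst.
rewrite (pd_ext k E) pd_add //; last exact: smoothM.
by rewrite pd_mul // !pd_cst mulr0 !addr0.
Qed.

Definition preserves_omega N := forall i p, lie_omega N i p = omega_coef i p * lie_omega N iS p.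

Lemma red_lie_preserving N (a : dform R) i j p :
  smooth_vfield N -> smooth_form a -> preserves_omega N ->
  red (lie_deriv N a) i j p
    = \sum_k (vcomp N k p * pd k (red a i j) p
              + Dred N i k p * red a k j p - Dred N j k p * red a k i p).
Proof.
by move=> sN sa oN; rewrite red_lie // (oN i) (oN j) !subrr !mul0r subr0 addr0.
Qed.

Lemma HCD_equations N : HCD gamma C D N ->
  [/\ smooth_vfield N, preserves_omega N,
      forall p, pd iS (vcomp N iS) p = 0 &
      forall p, let r i j := red (lie_deriv N beta') i j p in
        [/\ r iq iE = 0, r iE iB = 0, r it iE = r iq iB
          & gamma * r it iq = 2 * ham (potential C D) p * r it iB]].
Proof.
move=> [[sN GN] NS].
have sV := smooth_ham.
have GN' a : in_ideal gamma (potential C D) a ->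
    in_ideal gamma (potential C D) (lie_deriv N a).
  by move=> /HJB_idealE Ia; apply/HJB_idealE => //; apply: GN; exact: Ia.
have [] := @GN' omega; first by apply: in_ideal_gens => //; constructor 1.
move=> _ Io; have [] := @GN' beta'.
  by apply: in_ideal_gens => //; constructor 3.
move=> _ Ib; split; [exact: sN| |exact: NS|].
  by move=> i p; have [_ /(_ i) + _] := Io p; rewrite !lie_omegaE.
by move=> p; have [_ _ H] := Ib p; exact: H.
Qed.

Lemma lie_omega_explicit N i p : lie_omega N i p
  = xcoord iE p * pd i (vcomp N it) p + xcoord iB p * pd i (vcomp N iq) p
    + pd i (vcomp N iS) p + (i == it)%:R * vcomp N iE p
    + (i == iq)%:R * vcomp N iB p.
Proof.
rewrite /lie_omega sum5 !pd_omega_coef -!val_eqE /omega_coef /=.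
by move: (_ == _)%:R (_ == _)%:R => x y; abstract_atoms; ring.
Qed.

End Isovectors.

(** * Profiles *)

Section Profiles.
Context {R : realType}.
Implicit Types (N : vfield R) (p : M R) (i j k : 'I_5) (T l s : R -> R).

Definition at_time (t : R) : M R.
Proof.
apply: (@mkM R (\row_k [:: t; 1; 0; 0; 0]`_k)).
by rewrite mxE /= ltr01.
Defined.

Lemma xcoord_at_time t k : xcoord k (at_time t) = [:: t; 1; 0; 0; 0]`_k.
Proof. by rewrite /xcoord mxE. Qed.

Definition set_coord p k (y : R) (ky : (k == iq) ==> (0 < y)) : M R.
Proof.
apply: (@mkM R (\row_j (if j == k then y else val p 0 j))).
rewrite mxE eq_sym; case: ifP ky => [_ //|_ _]; exact: val_gt0.
Defined.

(** Any point is joined to the one on the reference line by four moves parallel to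
    the axes. *)
Lemma time_only (f : M R -> R) : smooth f ->
  (forall k p, k != it -> pd k f p = 0) ->
  forall p, f p = f (at_time (xcoord it p)).
Proof.
move=> sf f0.
have step k (y : R) (ky : (k == iq) ==> (0 < y)) p :
    k != it -> f p = f (set_coord p ky).
  move=> kt; apply: (pd0_invar (i := k) sf) => [q|j jk]; first exact: f0.
  by rewrite /xcoord /= mxE (negbTE jk).
move=> p.
have hq : (iq == iq) ==> (0 < (1 : R)) by rewrite ltr01 implybT.
have hS : (iS == iq) ==> (0 < (0 : R)) by [].
have hE : (iE == iq) ==> (0 < (0 : R)) by [].
have hB : (iB == iq) ==> (0 < (0 : R)) by [].
rewrite (step _ _ hq p) // (step _ _ hS) // (step _ _ hE) // (step _ _ hB) //.
congr f; apply: xcoord_inj; apply: ord5_ind;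
  by rewrite xcoord_at_time /xcoord /= !mxE /= ?mxE.
Qed.

Lemma is_derive_at_time (f : M R -> R) (t : R) : smooth f ->
  is_derive t 1 (fun t : R => f (at_time t)) (pd it f (at_time t)).
Proof.
move=> sf; set d : 'rV[R]_5 := delta_mx 0 it.
have E u : val (at_time u) = u *: d + val (at_time 0).
  apply/rowP; apply: ord5_ind; rewrite !mxE /= ?mulr0 ?add0r ?mulr1 ?addr0 //.
have dm : derivable (ext f) (val (at_time t)) d.
  by apply: diffble_derivable; exact: smooth_diffble.
rewrite E in dm; have := is_derive_line dm.
rewrite -E -[X in is_derive _ _ _ X]/(pd it f (at_time t)).
rewrite (_ : (fun u : R => ext f (u *: d + val (at_time 0)))
  = (fun u => f (at_time u))) //.
by apply/funext => u; rewrite -E ext_val.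
Qed.

(** The ordinary differential equations to which the determining equations reduce.
    The derivatives [T1], [T2], [l1] are kept as data, so that a profile is a solution
    of a first-order linear system with six unknowns and constant coefficients. *)
Record profile (gamma C D : R) T l s (T1 T2 l1 : R -> R) : Prop := Profile {
  profT : forall t : R, is_derive t 1 T (T1 t);
  profT1 : forall t : R, is_derive t 1 T1 (T2 t);
  profT2 : forall t : R, is_derive t 1 T2 (8 * D * T1 t);
  profl : forall t : R, is_derive t 1 l (l1 t);
  profl1 : forall t : R, is_derive t 1 l1 (2 * D * l t);
  profs : forall t : R, is_derive t 1 s (gamma / 4 * T2 t);
  profC : forall t, C * l t = 0 }.

Lemma is_derive_derive1 (f g : R -> R) :
  (forall t : R, is_derive t 1 f (g t)) -> derive1 f = g.
Proof. by move=> fg; apply/funext => t; rewrite derive1E; have [_ ->] := fg t. Qed.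

Lemma field_ofE (T T1 T2 T3 l l1 l2 s s1 : R -> R) :
  (forall t : R, is_derive t 1 T (T1 t)) ->
  (forall t : R, is_derive t 1 T1 (T2 t)) ->
  (forall t : R, is_derive t 1 T2 (T3 t)) ->
  (forall t : R, is_derive t 1 l (l1 t)) ->
  (forall t : R, is_derive t 1 l1 (l2 t)) ->
  (forall t : R, is_derive t 1 s (s1 t)) ->
  field_of T l s = fun p =>
    let t := xcoord it p in let q := xcoord iq p in
    let E := xcoord iE p in let B := xcoord iB p in
    \row_(k < 5)
    [:: T t; T1 t * q / 2 + l t;
        - (T2 t / 4 * (q * q) + l1 t * q - s t);
        - (T2 t * q / 2 + l1 t) * B - T1 t * E
          + (T3 t / 4 * (q * q) + l2 t * q - s1 t);
        - (T1 t / 2) * B + (T2 t / 2 * q + l1 t)]`_k.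
Proof.
move=> dT dT1 dT2 dl dl1 ds.
have ET1 := is_derive_derive1 dT; have El1 := is_derive_derive1 dl.
have ET2 : derive1n 2 T = T2.
  by rewrite derive1nS derive1n1 ET1 (is_derive_derive1 dT1).
have phiE t q : phi T l s t q = T2 t / 4 * (q * q) + l1 t * q - s t.
  by rewrite /phi ET2 El1 expr2.
apply/funext => p; apply/rowP => k; rewrite !mxE ET1 ET2 El1 phiE.
have -> : derive1 (fun u => phi T l s u (xcoord iq p)) (xcoord it p)
    = T3 (xcoord it p) / 4 * (xcoord iq p * xcoord iq p)
      + l2 (xcoord it p) * xcoord iq p - s1 (xcoord it p).
  move: (xcoord it p) (xcoord iq p) => t q.
  have H (u : R) : is_derive u 1 (fun u : R => phi T l s u q)
      (T3 u / 4 * (q * q) + l2 u * q - s1 u).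
    rewrite (_ : (fun u => phi T l s u q)
        = (q * q / 4) *: T2 + q *: l1 - s); last first.
      by apply/funext => x; rewrite phiE !fctE /GRing.scale /=; ring.
    have H := is_deriveB (is_deriveD (is_deriveZ (q * q / 4) (dT2 u))
      (is_deriveZ q (dl1 u))) (ds u).
    apply: (is_derive_eq H); rewrite /GRing.scale /=.
    by move: (T3 u) (l2 u) (s1 u) => x y z; ring.
  by rewrite (is_derive_derive1 H).
have -> // : derive1 (phi T l s (xcoord it p)) (xcoord iq p)
    = T2 (xcoord it p) / 2 * xcoord iq p + l1 (xcoord it p).
move: (xcoord it p) (xcoord iq p) => t q.
have H (u : R) : is_derive u 1 (phi T l s t) (T2 t / 2 * u + l1 t).
  rewrite (_ : phi T l s t
      = (T2 t / 4) *: ((id : R -> R) * id) + l1 t *: id - cst (s t)); last first.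
    by apply/funext => x; rewrite phiE !fctE.
  have di := is_derive_id u (1 : R).
  have H := is_deriveB (is_deriveD (is_deriveZ (T2 t / 4) (is_deriveM di di))
    (is_deriveZ (l1 t) di)) (is_derive_cst (s t) u 1).
  apply: (is_derive_eq H); rewrite /GRing.scale /=.
  by move: (T2 t) (l1 t) => x y; field.
by rewrite (is_derive_derive1 H).
Qed.

End Profiles.

(** * Every isovector comes from a profile *)

Section Necessity.
Context {R : realType}.
Variables (gamma C D : R).
Hypothesis gamma0 : gamma != 0.
Implicit Types (N : vfield R) (p : M R).
Local Notation beta' := (beta gamma (potential C D)).
Local Notation H p :=
  (xcoord iE p + xcoord iB p * xcoord iB p / 2 - pot C D p).

Lemma red_lie_beta N p (r := fun i j => red (lie_deriv N beta') i j p)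
    (d := fun i k => pd i (vcomp N k) p) :
  smooth_vfield N -> preserves_omega N ->
  [/\ r iE iB = - (gamma / 2) * d iE it,
      r it iE = - (H p * d iE iq + gamma / 2 * d iE iB),
      r iq iB = - (gamma / 2) * (d iq it - xcoord iB p * d iS it)
                + H p * d iB it,
      r it iq = - (- (vcomp N iq p * pd iq (pot C D) p) + vcomp N iE p
                   + xcoord iB p * vcomp N iB p)
                - (d it it - xcoord iE p * d iS it) * H p
                - H p * (d iq iq - xcoord iB p * d iS iq)
                - gamma / 2 * (d iq iB - xcoord iB p * d iS iB) &
      r it iB = - (gamma / 2) * (d it it - xcoord iE p * d iS it)
                - H p * d iB iq - gamma / 2 * d iB iB /\
      r iq iE = H p * d iE it].
Proof.
move=> sN oN.
have sb : smooth_form beta' by apply: smooth_beta; exact: smooth_ham.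
rewrite {}/r {}/d; split; last split;
  rewrite red_lie_preserving // sum5 !pd_red_beta // !red_beta // !alt_beta //;
  rewrite !hamE !pd_ham !pd_pot /Dred -!val_eqE /omega_coef /=;
  move: (- (2 * C / _) + _) => Vq; abstract_atoms; ring.
Qed.

(** The structure equations provide the functions of time; the values of a profile
    are read off on the reference line. *)
Lemma HCD_profile N : HCD gamma C D N ->
  exists T l s T1 T2 l1, profile gamma C D T l s T1 T2 l1 /\ N = field_of T l s.
Proof.
move=> /(HCD_equations gamma0) [sN oN NS rb].
have sp := smooth_pot C D.
have v0 k p : k != iq -> pd k (pot C D) p = 0.
  by move=> /negbTE kq; rewrite pd_pot kq mul0r.
have lo i p := etrans (esym (lie_omega_explicit N i p)) (oN i p).
have lam p : lie_omega N iS p = xcoord iE p * pd iS (vcomp N it) p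
    + xcoord iB p * pd iS (vcomp N iq) p + pd iS (vcomp N iS) p.
  by rewrite lie_omega_explicit -!val_eqE /= !mul0r !addr0.
have H1 p : xcoord iE p * pd iE (vcomp N it) p
    + xcoord iB p * pd iE (vcomp N iq) p + pd iE (vcomp N iS) p = 0.
  by have := lo iE p; rewrite -!val_eqE /omega_coef /= !mul0r !addr0.
have H2 p : xcoord iE p * pd iB (vcomp N it) p
    + xcoord iB p * pd iB (vcomp N iq) p + pd iB (vcomp N iS) p = 0.
  by have := lo iB p; rewrite -!val_eqE /omega_coef /= !mul0r !addr0.
have H3 p : vcomp N iE p + xcoord iE p * pd it (vcomp N it) p
    + xcoord iB p * pd it (vcomp N iq) p + pd it (vcomp N iS) p
    = xcoord iE p * (xcoord iE p * pd iS (vcomp N it) p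
    + xcoord iB p * pd iS (vcomp N iq) p + pd iS (vcomp N iS) p).
  have := lo it p; rewrite lam -!val_eqE /omega_coef /=; apply: etrans.
  by abstract_atoms; ring.
have H4 p : vcomp N iB p + xcoord iE p * pd iq (vcomp N it) p
    + xcoord iB p * pd iq (vcomp N iq) p + pd iq (vcomp N iS) p
    = xcoord iB p * (xcoord iE p * pd iS (vcomp N it) p
    + xcoord iB p * pd iS (vcomp N iq) p + pd iS (vcomp N iS) p).
  have := lo iq p; rewrite lam -!val_eqE /omega_coef /=; apply: etrans.
  by abstract_atoms; ring.
have H5 p : pd iE (vcomp N it) p = 0.
  have [_ + _ _] := rb p; have [-> _ _ _ _] := red_lie_beta p sN oN.
  move=> /eqP; rewrite mulf_eq0 oppr_eq0 mulf_eq0 (negbTE gamma0) /=.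
  by rewrite invr_eq0 pnatr_eq0 /= => /eqP.
have H6 p : - (H p * pd iE (vcomp N iq) p + gamma / 2 * pd iE (vcomp N iB) p)
  = - (gamma / 2) * (pd iq (vcomp N it) p - xcoord iB p * pd iS (vcomp N it) p)
    + H p * pd iB (vcomp N it) p.
  by have [_ _ + _] := rb p; have [_ -> -> _ _] := red_lie_beta p sN oN.
have H7 p := let: And4 _ _ _ e := rb p in e.
have {}H7 p : gamma * (- (- (vcomp N iq p * pd iq (pot C D) p) + vcomp N iE p
                   + xcoord iB p * vcomp N iB p)
           - (pd it (vcomp N it) p - xcoord iE p * pd iS (vcomp N it) p) * H p
           - H p * (pd iq (vcomp N iq) p - xcoord iB p * pd iS (vcomp N iq) p)
           - gamma / 2 * (pd iq (vcomp N iB) p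
                          - xcoord iB p * pd iS (vcomp N iB) p))
  = 2 * H p * (- (gamma / 2) * (pd it (vcomp N it) p
                                - xcoord iE p * pd iS (vcomp N it) p)
               - H p * pd iB (vcomp N iq) p - gamma / 2 * pd iB (vcomp N iB) p).
  have := H7 p; have [_ _ _ -> [-> _]] := red_lie_beta p sN oN.
  by rewrite hamE.
have [lf [sf [[sl ss a0 l0 s0] eqs]]] := structure_equations (M_calculus R)
  gamma0 (sN it) (sN iq) (sN iS) (sN iE) (sN iB) sp v0 H1 H2 H3 H4 H5 H6 H7 NS.
clear H1 H2 H3 H4 H5 H6 H7 lo lam rb; set a := vcomp N it in a0 eqs.
have sa : smooth a := sN it.
have pda k p : k != it -> pd k (pd it a) p = 0.
  by move=> kt; apply: pd_pd0 => // q; exact: a0.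
have pdda k p : k != it -> pd k (pd it (pd it a)) p = 0.
  move=> kt; apply: pd_pd0 => // [|q]; first exact: smooth_pd.
  exact: pda.
have pdl k p : k != it -> pd k (pd it lf) p = 0.
  by move=> kt; apply: pd_pd0 => // q; exact: l0.
have sa1 := smooth_pd it sa; have sa2 := smooth_pd it sa1.
have sl1 := smooth_pd it sl.
have ode p : [/\ pd it (pd it (pd it a)) p = 8 * D * pd it a p,
    pd it (pd it lf) p = 2 * D * lf p, pd it sf p = gamma / 4 * pd it (pd it a) p
    & C * lf p = 0].
  have sa3 := smooth_pd it sa2; have sl2 := smooth_pd it sl1.
  have ss1 := smooth_pd it ss.
  have red_t (f : M R -> R) : smooth f -> (forall k p, k != it -> pd k f p = 0) ->
      forall p q, xcoord it p = xcoord it q -> f p = f q.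
    by move=> sf' f0 u v uv; rewrite (time_only sf' f0) uv -(time_only sf' f0).
  (* The last structure equation times q^3 is a polynomial in q, whose four
     coefficients vanish because it vanishes at q = 1, 2, 3, 4. *)
  have key (q : R) (q0 : 0 < q) :
      (pd it (pd it (pd it a)) p / 4 - 2 * D * pd it a p) * q ^+ 5
      + (pd it (pd it lf) p - 2 * D * lf p) * q ^+ 4
      + (gamma / 4 * pd it (pd it a) p - pd it sf p) * q ^+ 3
      + 2 * (C * lf p) = 0.
    have q0' : (iq == iq) ==> (0 < q) by rewrite q0 implybT.
    pose p' := set_coord p q0'.
    have pt : xcoord it p = xcoord it p' by rewrite /xcoord /= mxE.
    have qE : xcoord iq p' = q by rewrite /xcoord /= mxE.
    have [_ _ _ _] := eqs p'.
    rewrite pd_pot eqxx {1}/pot /potential qE mul1r.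
    rewrite -(red_t _ sa1 pda _ _ pt) -(red_t _ sl l0 _ _ pt).
    rewrite -(red_t _ sa2 pdda _ _ pt).
    rewrite -(red_t _ sa3 _ _ _ pt); last first.
      by move=> k u kt; apply: pd_pd0 => // v; exact: pdda.
    rewrite -(red_t _ sl2 _ _ _ pt); last first.
      by move=> k u kt; apply: pd_pd0 => // v; exact: pdl.
    rewrite -(red_t _ ss1 _ _ _ pt); last first.
      by move=> k u kt; apply: pd_pd0 => // v; exact: s0.
    have qn0 : q != 0 by rewrite lt0r_neq0.
    move=> E; rewrite -[RHS](mulr0 (q ^+ 3)) -E.
    by clear -qn0 gamma0; abstract_atoms; field.
  have k1 := key 1 ltr01; have k2 := key 2 (ltr0Sn _ _).
  have k3 := key 3 (ltr0Sn _ _); have k4 := key 4 (ltr0Sn _ _).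
  clear -k1 k2 k3 k4.
  move: k1 k2 k3 k4.
  set A := pd it (pd it (pd it a)) p / 4 - _.
  set B := pd it (pd it lf) p - _.
  set S := gamma / 4 * _ - _.
  set W := C * lf p.
  move=> k1 k2 k3 k4.
  have [A0 B0 S0 W0] : [/\ A = 0, B = 0, S = 0 & W = 0].
    by clear -k1 k2 k3 k4; split; lra.
  split; last exact: W0.
  - by move: A0; rewrite /A; abstract_atoms; lra.
  - by move: B0; rewrite /B; abstract_atoms; lra.
  - by move: S0; rewrite /S; abstract_atoms; lra.
pose T t := a (at_time t); pose T1 t := pd it a (at_time t).
pose T2 t := pd it (pd it a) (at_time t).
pose l t := lf (at_time t); pose l1 t := pd it lf (at_time t).
pose s t := sf (at_time t).
exists T, l, s, T1, T2, l1.
have dT (t : R) : is_derive t 1 T (T1 t) by exact: is_derive_at_time.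
have dT1 (t : R) : is_derive t 1 T1 (T2 t) by exact: is_derive_at_time.
have dT2 (t : R) : is_derive t 1 T2 (8 * D * T1 t).
  have [E _ _ _] := ode (at_time t); rewrite -E; exact: is_derive_at_time.
have dl (t : R) : is_derive t 1 l (l1 t) by exact: is_derive_at_time.
have dl1 (t : R) : is_derive t 1 l1 (2 * D * l t).
  have [_ E _ _] := ode (at_time t); rewrite -E; exact: is_derive_at_time.
have ds (t : R) : is_derive t 1 s (gamma / 4 * T2 t).
  have [_ _ E _] := ode (at_time t); rewrite -E; exact: is_derive_at_time.
split; first by split=> // t; have [] := ode (at_time t).
rewrite (field_ofE dT dT1 dT2 dl dl1 ds); apply/funext => p; apply/rowP => k.
rewrite mxE -[LHS]/(vcomp N k p) /T /T1 /T2 /l /l1 /s.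
rewrite -(time_only sa a0) -(time_only sa1 pda) -(time_only sa2 pdda).
rewrite -(time_only sl l0) -(time_only sl1 pdl) -(time_only ss s0).
have [d1 d2 d3 _] := ode p; have [e1 e2 e3 e4 _] := eqs p.
elim/ord5_ind: k => //=.
by rewrite e4 d1 d2 d3.
Qed.

End Necessity.

(** * Every profile gives an isovector *)

(** The pointwise linear algebra behind the invariance of the ideal: [r] is the
    reduced two-form, [dr] and [dh] are derivatives of [r] and of the
    Hamiltonian [h] along the coordinates, and [d] is the reduced Jacobian. *)
Lemma quotient_algebra (R : realType) (gamma h x1 x2 y z : R) (n dh : 'I_5 -> R)
    (d r : 'I_5 -> 'I_5 -> R) (dr : 'I_5 -> 'I_5 -> 'I_5 -> R)
    (L := fun i j => \sum_k (n k * dr k i j + d i k * r k j - d j k * r k i)) :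
  gamma != 0 ->
  [/\ [/\ d iq it = 0, d iE it = 0 & d iB it = 0],
      [/\ d it it = x1, d iq iq = x1 / 2, d iE iq = 0 & d iB iq = 0],
      [/\ d it iB = z, d iq iB = x2 / 2, d iE iB = 0 & d iB iB = - (x1 / 2)] &
      [/\ d it iq = y, d iq iE = z, d iE iE = - x1 & d iB iE = - y]] ->
  (forall i j, r i j = - r j i) -> (forall j, r iS j = 0) ->
  r iq iE = 0 -> r iE iB = 0 -> r it iE = r iq iB ->
  r it iq = 2 / gamma * (h * r it iB) ->
  (forall k, dr k iq iE = 0) -> (forall k, dr k iE iB = 0) ->
  (forall k, dr k it iE = dr k iq iB) ->
  (forall k, dr k it iq = 2 / gamma * (dh k * r it iB + h * dr k it iB)) ->
  \sum_k n k * dh k = - (x1 * h + gamma / 4 * x2) ->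
  [/\ L iq iE = 0, L iE iB = 0, L it iE = L iq iB
    & gamma * L it iq = 2 * h * L it iB].
Proof.
move=> g0 [[qt Et Bt] [tt qq Eq Bq] [tB qB EB BB] [tq qE EE BE]] anti rS
  rqE rEB rtE rtq dqE dEB dtE dtq dh0.
have diag i : r i i = 0.
  have /eqP := anti i i; rewrite -subr_eq0 opprK -mulr2n mulrn_eq0 /=.
  by move/eqP.
have rEt := anti iE it; have rEq := anti iE iq; have rBt := anti iB it.
have rBq := anti iB iq; have rBE := anti iB iE; have rqt := anti iq it.
move: dh0; rewrite /L !sum5 => dh0.
rewrite !rS !rEt !rEq !rBt !rBq !rBE !rqt !diag !rqE !rEB !rtE !rtq.
rewrite !dqE !dEB !dtE !dtq ?qt ?Et ?Bt ?tt ?qq ?Eq ?Bq ?tB ?qB ?EB ?BB ?tq ?qE ?EE ?BE.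
split; [ring|ring|field|].
  by rewrite g0.
rewrite -[LHS]addr0 -[X in _ + X](subrr (2 * r it iB * (- (x1 * h + gamma / 4 * x2)))).
rewrite -{2}dh0.
by field.
Qed.

Section Sufficiency.
Context {R : realType}.
Variables (gamma C D : R) (T l s T1 T2 l1 : R -> R).
Hypothesis gamma0 : gamma != 0.
Hypothesis prof : profile gamma C D T l s T1 T2 l1.
Implicit Types (p : M R) (i j k : 'I_5).
Let N := field_of T l s.

Let at_t (h : R -> R) : M R -> R := fun p => h (xcoord it p).

Lemma pd_time k (h h' : R -> R) p : (forall t : R, is_derive t 1 h (h' t)) ->
  pd k (at_t h) p = (k == it)%:R * at_t h' p.
Proof. exact: pd_comp. Qed.

Lemma smooth_profile : [/\ smooth (at_t T), smooth (at_t T1), smooth (at_t T2)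
  & [/\ smooth (at_t l), smooth (at_t l1) & smooth (at_t s)]].
Proof.
have [dT dT1 dT2 dl dl1 ds _] := prof.
pose P (f : M R -> R) :=
  exists2 h, List.In h [:: T; T1; T2; l; l1; s] & f = at_t h.
have PP f : P f -> diffble f /\ forall k, ring_closure P (pd k f).
  case=> h + ->.
  have key (h' h'' : R -> R) (c : R) :
      (forall t : R, is_derive t 1 h' (c * h'' t)) -> P (at_t h'') ->
      diffble (at_t h') /\ (forall k, ring_closure P (pd k (at_t h'))).
    move=> dh Ph; split=> [|k].
      by apply: diffble_comp => t; have [] := dh t.
    have -> : pd k (at_t h') = fun p => ((k == it)%:R * c) * at_t h'' p.
      by apply/funext => p; rewrite (pd_time k p dh) mulrA.
    by apply: closure_mul; [exact: closure_cst|exact: closure_base].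
  have one (h1 h2 : R -> R) : (forall t : R, is_derive t 1 h1 (h2 t)) ->
      forall t : R, is_derive t 1 h1 (1 * h2 t).
    by move=> dh t; rewrite mul1r.
  have inP h' : List.In h' [:: T; T1; T2; l; l1; s] -> P (at_t h').
    by exists h'.
  case=> [<-|[<-|[<-|[<-|[<-|[<-|//]]]]]].
  - by apply: (key T T1 1 (one _ _ dT)); apply: inP; right; left.
  - by apply: (key T1 T2 1 (one _ _ dT1)); apply: inP; do 2 right; left.
  - by apply: (key T2 T1 (8 * D)) => //; apply: inP; right; left.
  - by apply: (key l l1 1 (one _ _ dl)); apply: inP; do 4 right; left.
  - by apply: (key l1 l (2 * D)) => //; apply: inP; do 3 right; left.
  - by apply: (key s T2 (gamma / 4)) => //; apply: inP; do 2 right; left.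
have sP h : List.In h [:: T; T1; T2; l; l1; s] -> smooth (at_t h).
  by move=> hh; apply: (smooth_ring_closure PP); apply: closure_base; exists h.
by split; [| | |split]; apply: sP; rewrite /=; tauto.
Qed.

Lemma prof_comp : vcomp N it = at_t T /\
  [/\ vcomp N iq = (fun p => at_t T1 p * xcoord iq p / 2 + at_t l p),
      vcomp N iS = (fun p => - (at_t T2 p / 4 * (xcoord iq p * xcoord iq p)
                                + at_t l1 p * xcoord iq p - at_t s p)),
      vcomp N iE = (fun p => - (at_t T2 p * xcoord iq p / 2 + at_t l1 p) * xcoord iB p
         - at_t T1 p * xcoord iE p
         + (8 * D * at_t T1 p / 4 * (xcoord iq p * xcoord iq p)
            + 2 * D * at_t l p * xcoord iq p - gamma / 4 * at_t T2 p)) &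
      vcomp N iB = (fun p => - (at_t T1 p / 2) * xcoord iB p
         + (at_t T2 p / 2 * xcoord iq p + at_t l1 p))].
Proof.
have [dT dT1 dT2 dl dl1 ds _] := prof.
have NE := field_ofE dT dT1 dT2 dl dl1 ds.
by split; [|split]; apply/funext => p; rewrite /vcomp /N NE mxE.
Qed.

Lemma field_derivatives :
  [/\ forall k p, pd k (vcomp N it) p = (k == it)%:R * at_t T1 p,
      forall k p, pd k (vcomp N iq) p
        = (k == it)%:R * (at_t T2 p * xcoord iq p / 2 + at_t l1 p)
          + (k == iq)%:R * (at_t T1 p / 2),
      forall k p, pd k (vcomp N iS) p
        = - ((k == it)%:R * (8 * D * at_t T1 p / 4 * (xcoord iq p * xcoord iq p)
                             + 2 * D * at_t l p * xcoord iq p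
                             - gamma / 4 * at_t T2 p)
             + (k == iq)%:R * (at_t T2 p * xcoord iq p / 2 + at_t l1 p)),
      forall k p, pd k (vcomp N iB) p
        = (k == it)%:R * (- (at_t T2 p / 2) * xcoord iB p
            + (8 * D * at_t T1 p / 2 * xcoord iq p + 2 * D * at_t l p))
          + (k == iB)%:R * - (at_t T1 p / 2) + (k == iq)%:R * (at_t T2 p / 2) &
      forall k p, pd k (vcomp N iE) p
        = (k == it)%:R * (- (8 * D * at_t T1 p * xcoord iq p / 2
                             + 2 * D * at_t l p) * xcoord iB p
                          - at_t T2 p * xcoord iE p
                          + (8 * D * at_t T2 p / 4 * (xcoord iq p * xcoord iq p)
                             + 2 * D * at_t l1 p * xcoord iq p
                             - gamma / 4 * (8 * D * at_t T1 p)))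
          + (k == iB)%:R * - (at_t T2 p * xcoord iq p / 2 + at_t l1 p)
          - (k == iE)%:R * at_t T1 p
          + (k == iq)%:R * (- (at_t T2 p / 2) * xcoord iB p
              + (8 * D * at_t T1 p * xcoord iq p / 2 + 2 * D * at_t l p))].
Proof.
have [dT dT1 dT2 dl dl1 ds _] := prof.
have [sT sT1 sT2 [sl sl1 ss]] := smooth_profile.
have [ET [Eq ES EE EB]] := prof_comp.
have sc (y : R) : smooth (fun _ : M R => y) by exact: smooth_cst.
pose T3 (t : R) : R := 8 * D * T1 t. pose l2 (t : R) : R := 2 * D * l t.
pose s1 (t : R) : R := gamma / 4 * T2 t.
have sT3 : smooth (at_t T3) by exact: smoothM.
have sl2 : smooth (at_t l2) by exact: smoothM.
have ss1 : smooth (at_t s1) by exact: smoothM.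
have pT1 k p := pd_time k p dT1; have pT2 k p := pd_time k p dT2.
have pl k p := pd_time k p dl; have pl1 k p := pd_time k p dl1.
have ps k p := pd_time k p ds.
have calc := M_calculus R.
split=> k p.
- by rewrite ET (pd_time k p dT).
- by rewrite Eq; exact: (D_Nq calc sT1 sl pT1 pl).
- by rewrite ES; exact: (D_NS calc sT2 sl1 ss pT2 pl1 ps).
- by rewrite EB; exact: (D_NB calc sT1 sT2 sl1 pT1 pT2 pl1).
- rewrite EE.
  have -> := @D_NE _ _ _ _ _ calc _ _ _ _ _ _ sT1 sT2 sT3 sl1 sl2 ss1 pT1 pT2 pl1 k p.
  have pT3 : pd k (at_t T3) p = (k == it)%:R * (8 * D * at_t T2 p).
    by rewrite pd_scale // pT1 mulrCA.
  have pl2 : pd k (at_t l2) p = (k == it)%:R * (2 * D * at_t l1 p).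
    by rewrite pd_scale // pl mulrCA.
  have ps1 : pd k (at_t s1) p = (k == it)%:R * (gamma / 4 * (8 * D * at_t T1 p)).
    by rewrite pd_scale // pT2 mulrCA.
  rewrite pT3 pl2 ps1 /at_t /T3 /l2 /s1.
  move: (T1 _) (T2 _) (l _) (l1 _) => x1 x2 x3 x4; abstract_atoms; ring.
Qed.

Lemma smooth_field : smooth_vfield N.
Proof.
have [sT sT1 sT2 [sl sl1 ss]] := smooth_profile.
have [ET [Eq ES EE EB]] := prof_comp.
have sc (y : R) : smooth (fun _ : M R => y) by exact: smooth_cst.
have sx i : smooth (@xcoord R i) by exact: smooth_xcoord.
apply: ord5_ind; rewrite ?ET ?Eq ?ES ?EE ?EB //;
  by repeat first [assumption | exact: sc | exact: sx | apply: smoothD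
    | apply: smoothM | apply: smoothN].
Qed.

Lemma field_lie_omega i p : lie_omega N i p = 0.
Proof.
have [dNt dNq dNS _ _] := field_derivatives.
have [_ [_ _ EE EB]] := prof_comp.
rewrite lie_omega_explicit dNt dNq dNS EE EB.
move: (at_t T1 p) (at_t T2 p) (at_t l p) (at_t l1 p) => x1 x2 x3 x4.
move: (xcoord iE p) (xcoord iB p) (xcoord iq p) => y1 y2 y3.
by move: (i == it)%:R (i == iq)%:R => b1 b2; field.
Qed.

(** The potential meets the differential equations of the profile here: the terms
    in [q^2], [q], [1] and [q^-3] cancel separately. *)
Lemma field_ham p : \sum_k vcomp N k p * pd k (ham (potential C D)) p
  = - (at_t T1 p * ham (potential C D) p + gamma / 4 * at_t T2 p).
Proof.
have [_ [Eq _ EE EB]] := prof_comp.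
have Cl : C * at_t l p = 0 by have [_ _ _ _ _ _] := prof; exact.
rewrite sum5 !pd_ham !pd_pot -!val_eqE /= hamE Eq EE EB /pot /potential.
move: (at_t T1 p) (at_t T2 p) (at_t l p) (at_t l1 p) (xq_neq0 p) Cl.
move: (vcomp N it p) (vcomp N iS p) => n1 n2 x1 x2 x3 x4.
move: (xcoord iE p) (xcoord iB p) (xcoord iq p) => y1 y2 y3 y30 Cl.
apply/eqP; rewrite -subr_eq0; apply/eqP.
rewrite [LHS](_ : _ = 2 / y3 ^+ 3 * (C * x3)); first by rewrite Cl mulr0.
by field.
Qed.

(** The field preserves [omega] itself, so in degree one its Lie derivative only
    acts on the factor of [omega], and in degree two it acts on reductions. *)
Lemma field_preserves_ideal (a : dform R) :
  in_ideal gamma (potential C D) a ->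
  in_ideal gamma (potential C D) (lie_deriv N a).
Proof.
have sN := smooth_field.
have oN : preserves_omega N by move=> i p; rewrite !field_lie_omega mulr0.
case=> sa ca; split; first exact: smooth_lie.
have a0 p : a finset.set0 p = 0 by have [] := ca p.
have a1 i p : a [set i]%SET p = omega_coef i p * a [set iS]%SET p by have [_ + _] := ca p.
have aqE p : red a iq iE p = 0 by have [_ _ []] := ca p.
have aEB p : red a iE iB p = 0 by have [_ _ []] := ca p.
have atE p : red a it iE p = red a iq iB p by have [_ _ []] := ca p.
have atq p : red a it iq p = 2 / gamma * (ham (potential C D) p * red a it iB p).
  have [_ _ [_ _ _ E]] := ca p; apply: (mulfI gamma0); rewrite E.
  by move: (ham _ _) (red _ _ _ _) => x y; field.
have sr i j := smooth_red i j sa; have sh := smooth_ham C D.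
have d0 k p : pd k (a finset.set0) p = 0 by rewrite (pd_ext k a0) pd_cst.
have dqE k p : pd k (red a iq iE) p = 0 by rewrite (pd_ext k aqE) pd_cst.
have dEB k p : pd k (red a iE iB) p = 0 by rewrite (pd_ext k aEB) pd_cst.
have dtE k p : pd k (red a it iE) p = pd k (red a iq iB) p by exact: pd_ext.
have dtq k p : pd k (red a it iq) p = 2 / gamma
    * (pd k (ham (potential C D)) p * red a it iB p
       + ham (potential C D) p * pd k (red a it iB) p).
  by rewrite (pd_ext k atq) pd_scale ?pd_mul //; exact: smoothM.
move=> p; split.
- by rewrite lie_0 big1 // => k _; rewrite d0 mulr0.
- move=> i; have E j : lie_deriv N a [set j]%SET p
      = omega_coef j p * \sum_k vcomp N k p * pd k (a [set iS]%SET) p.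
    have -> : lie_deriv N a [set j]%SET p = lie_omega N j p * a [set iS]%SET p
        + omega_coef j p * \sum_k vcomp N k p * pd k (a [set iS]%SET) p.
      rewrite lie_1 // /lie_omega mulr_sumr mulr_suml -big_split /=.
      apply: eq_bigr => k _; rewrite (pd_ext k (a1 j)) (a1 k).
      rewrite (pd_mul k p (smooth_omega_coef j) (sa [set iS]%SET)).
      by move: (omega_coef j p) (omega_coef k p) (a _ _) => x1 x2 x3; abstract_atoms; ring.
    by rewrite field_lie_omega mul0r add0r.
  by rewrite !E {2}/omega_coef /= mul1r.
have [dNt dNq dNS dNB dNE] := field_derivatives.
have r0 i j : red a i j p = - red a j i p := red_anti a i j p.
have L i j := @red_lie_preserving R N a i j p sN sa oN.
have [] := @quotient_algebra _ gamma (ham (potential C D) p) (at_t T1 p)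
  (at_t T2 p) (at_t T2 p * xcoord iq p / 2 + at_t l1 p)
  (- (at_t T2 p / 2) * xcoord iB p
     + (8 * D * at_t T1 p * xcoord iq p / 2 + 2 * D * at_t l p))
  (fun k => vcomp N k p) (fun k => pd k (ham (potential C D)) p)
  (fun i k => Dred N i k p) (fun i j => red a i j p)
  (fun k i j => pd k (red a i j) p) gamma0 _ r0 (fun j => red_Sl a j p)
  (aqE p) (aEB p) (atE p) (atq p) (fun k => dqE k p) (fun k => dEB k p)
  (fun k => dtE k p) (fun k => dtq k p) (field_ham p).
- rewrite /Dred !dNt !dNq !dNB !dNE.
  rewrite -!val_eqE /omega_coef /=.
  move: (at_t T1 p) (at_t T2 p) (at_t l p) (at_t l1 p) => x1 x2 x3 x4.
  by abstract_atoms; repeat split; ring.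
- by move=> *; rewrite !L; split.
Qed.

Lemma profile_HCD : HCD gamma C D N.
Proof.
split; last first.
  have [_ _ dNS _ _] := field_derivatives; move=> p.
  by rewrite dNS -!val_eqE /= !mul0r addr0 oppr0.
split; first exact: smooth_field.
have sh := smooth_ham C D.
move=> a /(HJB_idealE _ gamma0 sh) Ia; apply/(HJB_idealE _ gamma0 sh).
exact: field_preserves_ideal.
Qed.

End Sufficiency.

(** * Linear equations of second order *)

Section LinearODE.
Context {R : realType}.
Implicit Types (f g y z : R -> R) (k t : R).

(** The solutions [c] and [s] of [y'' = k y] with initial values [(1, 0)] and
    [(0, 1)]. *)
Definition fundamental k c s : Prop :=
  [/\ forall t : R, is_derive t 1 c (k * s t), forall t : R, is_derive t 1 s (c t),
      c 0 = 1 & s 0 = 0].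

Lemma is_derive_scaled f g (e t : R) : (forall t : R, is_derive t 1 f (g t)) ->
  is_derive t 1 (fun t => f (e * t)) (e * g (e * t)).
Proof.
move=> fg; have dg : is_derive t 1 (fun t : R => e * t) e.
  have H := is_deriveZ e (is_derive_id t (1 : R)).
  by apply: (is_derive_eq H); rewrite /GRing.scale /= mulr1.
have H := @is_derive1_comp R f (fun t => e * t) t (g (e * t)) e (fg _) dg.
by apply: (is_derive_eq H); rewrite mulrC.
Qed.

Lemma is_derive_lincomb n (a : 'I_n -> R) (f g : 'I_n -> R -> R) t :
  (forall i (t : R), is_derive t 1 (f i) (g i t)) ->
  is_derive t 1 (fun t => \sum_i a i * f i t) (\sum_i a i * g i t).
Proof.
move=> fg; have H := is_derive_sum (fun i => is_deriveZ (a i) (fg i t)).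
rewrite (_ : (fun t => _) = \sum_i a i *: f i); first exact: H.
by apply/funext => u; rewrite fct_sumE.
Qed.

Lemma is_derive_lin2 (a b : R) f f' g g' (t : R) :
  (forall t : R, is_derive t 1 f (f' t)) -> (forall t : R, is_derive t 1 g (g' t)) ->
  is_derive t 1 (fun t => a * f t + b * g t) (a * f' t + b * g' t).
Proof.
move=> df dg; exact: (is_deriveD (is_deriveZ a (df t)) (is_deriveZ b (dg t))).
Qed.

Lemma is_derive_prod f f' g g' (t : R) :
  (forall t : R, is_derive t 1 f (f' t)) -> (forall t : R, is_derive t 1 g (g' t)) ->
  is_derive t 1 (fun t => f t * g t) (f t * g' t + g t * f' t).
Proof. move=> df dg; exact: (is_deriveM (df t) (dg t)). Qed.

Lemma is_derive_mulr (a : R) f f' (t : R) :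
  (forall t : R, is_derive t 1 f (f' t)) ->
  is_derive t 1 (fun t => a * f t) (a * f' t).
Proof. move=> df; exact: (is_deriveZ a (df t)). Qed.

Lemma is_derive_ext f g (d t : R) : (forall t, f t = g t) ->
  is_derive t 1 f d -> is_derive t 1 g d.
Proof. by move=> /funext ->. Qed.

Lemma derive0_cst f : (forall t : R, is_derive t 1 f 0) -> forall t, f t = f 0.
Proof. by move=> df t; apply: is_derive_0_is_cst. Qed.

Lemma fundamental_exists k : exists c s, fundamental k c s.
Proof.
have dexp (t : R) : is_derive t 1 expR (expR t) := is_derive_expR t.
have [k0|k0|<-] := ltrgtP 0 k.
- pose e := Num.sqrt k; have e0 : e != 0 by rewrite lt0r_neq0 // sqrtr_gt0.
  have ee : e * e = k by rewrite -expr2 sqr_sqrtr // ltW.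
  have dp := fun t => @is_derive_scaled expR expR e t dexp.
  have dm := fun t => @is_derive_scaled expR expR (- e) t dexp.
  exists (fun t => 2^-1 * expR (e * t) + 2^-1 * expR (- e * t)).
  exists (fun t => (2 * e)^-1 * expR (e * t) + - (2 * e)^-1 * expR (- e * t)).
  split=> [t|t||].
  + apply: is_derive_eq (is_derive_lin2 _ _ t dp dm) _; rewrite -ee.
    by move: (expR _) (expR _) => x y; field.
  + apply: is_derive_eq (is_derive_lin2 _ _ t dp dm) _.
    by move: (expR _) (expR _) => x y; field.
  + by rewrite !mulr0 expR0; field.
  + by rewrite !mulr0 expR0; field.
- pose e := Num.sqrt (- k); have e0 : e != 0.
    by rewrite lt0r_neq0 // sqrtr_gt0 oppr_gt0.
  have ee : - (e * e) = k by rewrite -expr2 sqr_sqrtr ?oppr_ge0 ?opprK // ltW.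
  have ds := fun t => @is_derive_scaled sin cos e t (@is_derive_sin R).
  have dc := fun t => @is_derive_scaled cos (fun t => - sin t) e t (@is_derive_cos R).
  exists (fun t => cos (e * t)), (fun t => e^-1 * sin (e * t)).
  split=> [t|t||].
  + apply: is_derive_eq (dc t) _; rewrite -ee.
    by move: (sin _) => x; field.
  + have H := is_deriveZ e^-1 (ds t); apply: is_derive_eq H _.
    by rewrite /GRing.scale /= mulrA mulVf // mul1r.
  + by rewrite mulr0 cos0.
  + by rewrite mulr0 sin0 mulr0.
- exists (fun=> 1), id; split=> // t; last exact: is_derive_id.
  by rewrite mul0r; exact: is_derive_cst.
Qed.

(** The Wronskians of [y] with [c] and [s] are constant, hence zero, and they
    determine [y] and [z] since the Wronskian of [c] and [s] is one. *)
Lemma linear_ode_unique k y z : (forall t : R, is_derive t 1 y (z t)) ->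
  (forall t : R, is_derive t 1 z (k * y t)) -> y 0 = 0 -> z 0 = 0 ->
  forall t, y t = 0 /\ z t = 0.
Proof.
move=> dy dz y0 z0; have [c [s [dc ds c0 s0]]] := fundamental_exists k.
have wr f g f' g' h : (forall t : R, is_derive t 1 f (f' t)) ->
    (forall t : R, is_derive t 1 g (g' t)) ->
    h = (fun t => f t + -1 * g t) ->
    (forall t, f' t = g' t) -> forall t, h t = h 0.
  move=> df dg -> fg; apply: derive0_cst => t.
  have H := is_derive_lin2 1 (-1) t df dg.
  apply: is_derive_ext (is_derive_eq H _) => [u|]; first by rewrite mul1r.
  by rewrite fg; ring.
have W t : c t * c t - k * (s t * s t) = 1.
  have := @wr _ _ _ _ (fun t => c t * c t - k * (s t * s t))
    (fun t => is_derive_prod t dc dc)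
    (fun t => is_derive_mulr k t (fun t => is_derive_prod t ds ds)).
  move=> -> //.
  by rewrite c0 s0; ring.
    by apply/funext => u; ring.
  by move=> u; ring.
have A t : y t * c t - z t * s t = 0.
  have := @wr _ _ _ _ (fun t => y t * c t - z t * s t)
    (fun t => is_derive_prod t dy dc) (fun t => is_derive_prod t dz ds).
  move=> -> //; first by rewrite y0 z0; ring.
    by apply/funext => u; ring.
  by move=> u; ring.
have B t : z t * c t - k * (y t * s t) = 0.
  have := @wr _ _ _ _ (fun t => z t * c t - k * (y t * s t))
    (fun t => is_derive_prod t dz dc)
    (fun t => is_derive_mulr k t (fun t => is_derive_prod t dy ds)).
  move=> -> //; first by rewrite y0 z0; ring.
    by apply/funext => u; ring.
  by move=> u; ring.
move=> t; split.
  have -> : y t = y t * (c t * c t - k * (s t * s t)) by rewrite W mulr1.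
  have -> : y t * (c t * c t - k * (s t * s t))
      = c t * (y t * c t - z t * s t) + s t * (z t * c t - k * (y t * s t)).
    by move: (y t) (z t) (c t) (s t) => a b u v; ring.
  by rewrite A B !mulr0 addr0.
have -> : z t = z t * (c t * c t - k * (s t * s t)) by rewrite W mulr1.
have -> : z t * (c t * c t - k * (s t * s t))
    = c t * (z t * c t - k * (y t * s t)) + k * s t * (y t * c t - z t * s t).
  by move: (y t) (z t) (c t) (s t) => a b u v; ring.
by rewrite A B !mulr0 addr0.
Qed.

End LinearODE.

(** * Linear spaces of profiles *)

Section ProfileSpaces.
Context {R : realType}.
Variables (gamma : R).
Hypothesis gamma0 : gamma != 0.
Implicit Types (C D : R) (T l s : R -> R).

Lemma HCD_profileE C D N : HCD gamma C D N <->
  exists T l s T1 T2 l1, profile gamma C D T l s T1 T2 l1 /\ N = field_of T l s.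
Proof.
split; first exact: HCD_profile.
by case=> [T [l [s [T1 [T2 [l1 [prof ->]]]]]]]; exact: profile_HCD prof.
Qed.

Lemma profile_sub C D T l s T1 T2 l1 :
  profile gamma C D T l s T1 T2 l1 -> profile gamma 0 D T l s T1 T2 l1.
Proof. by case=> *; split=> // t; rewrite mul0r. Qed.

Lemma profile_lincomb C D n (c : 'I_n -> R) (T l s T1 T2 l1 : 'I_n -> R -> R) :
  (forall i, profile gamma C D (T i) (l i) (s i) (T1 i) (T2 i) (l1 i)) ->
  profile gamma C D
    (fun t => \sum_i c i * T i t) (fun t => \sum_i c i * l i t)
    (fun t => \sum_i c i * s i t) (fun t => \sum_i c i * T1 i t)
    (fun t => \sum_i c i * T2 i t) (fun t => \sum_i c i * l1 i t).
Proof.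
move=> P.
have dT i := profT (P i); have dT1 i := profT1 (P i); have dT2 i := profT2 (P i).
have dl i := profl (P i); have dl1 i := profl1 (P i); have ds i := profs (P i).
split=> t.
- exact: is_derive_lincomb.
- exact: is_derive_lincomb.
- have := is_derive_lincomb c t dT2.
  by rewrite mulr_sumr; congr is_derive; apply: eq_bigr => i _; rewrite mulrCA.
- exact: is_derive_lincomb.
- have := is_derive_lincomb c t dl1.
  by rewrite mulr_sumr; congr is_derive; apply: eq_bigr => i _; rewrite mulrCA.
- have := is_derive_lincomb c t ds.
  by rewrite mulr_sumr; congr is_derive; apply: eq_bigr => i _; rewrite mulrCA.
- by rewrite mulr_sumr big1 // => i _; rewrite mulrCA (profC (P i)) mulr0.
Qed.

Lemma field_profileE C D T l s T1 T2 l1 (p : M R) k :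
  profile gamma C D T l s T1 T2 l1 ->
  field_of T l s p 0 k =
    let t := xcoord it p in let q := xcoord iq p in
    let E := xcoord iE p in let B := xcoord iB p in
    [:: T t; T1 t * q / 2 + l t;
        - (T2 t / 4 * (q * q) + l1 t * q - s t);
        - (T2 t * q / 2 + l1 t) * B - T1 t * E
          + (8 * D * T1 t / 4 * (q * q) + 2 * D * l t * q - gamma / 4 * T2 t);
        - (T1 t / 2) * B + (T2 t / 2 * q + l1 t)]`_k.
Proof.
case=> dT dT1 dT2 dl dl1 ds _.
by rewrite (field_ofE dT dT1 dT2 dl dl1 ds) mxE.
Qed.

Lemma field_lincomb C D n (c : 'I_n -> R) (T l s T1 T2 l1 : 'I_n -> R -> R) :
  (forall i, profile gamma C D (T i) (l i) (s i) (T1 i) (T2 i) (l1 i)) ->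
  field_of (fun t => \sum_i c i * T i t) (fun t => \sum_i c i * l i t)
    (fun t => \sum_i c i * s i t) = \sum_i c i *: field_of (T i) (l i) (s i).
Proof.
move=> P; apply/funext => p; apply/rowP => k.
have -> : (\sum_i c i *: field_of (T i) (l i) (s i)) p 0 k
    = \sum_i c i * field_of (T i) (l i) (s i) p 0 k.
  elim/big_rec2: _ => [|i x N _ E]; first by rewrite mxE.
  rewrite -[(_ + N) p]/((c i *: field_of (T i) (l i) (s i)) p + N p) mxE E.
  by rewrite mxE.
rewrite (field_profileE p k (profile_lincomb c P)).
under [RHS]eq_bigr => i _ do rewrite (field_profileE p k (P i)).
move: (xcoord it p) (xcoord iq p) (xcoord iE p) (xcoord iB p) => t q E B.
by elim/ord5_ind: k => /=; rewrite // !(mulr_suml, mulr_sumr, =^~ sumrN,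
  =^~ big_split) /=; apply: eq_bigr => i _;
  move: (T1 i t) (T2 i t) (l i t) (l1 i t) (s i t) (c i) => x1 x2 x3 x4 x5 x6;
  ring.
Qed.

(** The pairs [(T1, T2)] and [(l, l1)] solve equations of the form [y'' = k y]. *)
Lemma profile_unique C D T l s T1 T2 l1 :
  profile gamma C D T l s T1 T2 l1 ->
  T 0 = 0 -> T1 0 = 0 -> T2 0 = 0 -> l 0 = 0 -> l1 0 = 0 -> s 0 = 0 ->
  forall t, [/\ T t = 0, l t = 0 & s t = 0].
Proof.
move=> [dT dT1 dT2 dl dl1 ds _] zT zT1 zT2 zl zl1 zs t.
have T10 u := linear_ode_unique dT1 dT2 zT1 zT2 u.
have l0 u := linear_ode_unique dl dl1 zl zl1 u.
split; last 1 first.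
- rewrite (derive0_cst _ t) // => u.
  by have [_ E] := T10 u; have := ds u; rewrite E mulr0.
- rewrite (derive0_cst _ t) // => u.
  by have [E _] := T10 u; have := dT u; rewrite E.
- by have [] := l0 t.
Qed.

Lemma field_zero C D T l s T1 T2 l1 :
  profile gamma C D T l s T1 T2 l1 -> field_of T l s = 0 ->
  [/\ T 0 = 0, T1 0 = 0 & T2 0 = 0] /\ [/\ l 0 = 0, l1 0 = 0 & s 0 = 0].
Proof.
move=> prof F0; have [dT dT1 _ dl _ _ _] := prof.
have comp p k : field_of T l s p 0 k = 0.
  by rewrite F0 -[(0 : vfield R) p]/(0 : 'rV[R]_5) mxE.
have zder (f g : R -> R) : (forall t : R, is_derive t 1 f (g t)) ->
    (forall t, f t = 0) -> forall t, g t = 0.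
  move=> fg /funext f0 t; have [_ <-] := fg t.
  by rewrite f0; exact: derive_cst.
have at0 (t : R) : xcoord it (at_time t) = t by rewrite xcoord_at_time.
have at1 (t : R) : xcoord iq (at_time t) = 1 by rewrite xcoord_at_time.
have zT t : T t = 0.
  by have := comp (at_time t) it; rewrite (field_profileE _ _ prof) /= at0.
have zT1 := zder _ _ dT zT; have zT2 := zder _ _ dT1 zT1.
have zl t : l t = 0.
  have := comp (at_time t) iq; rewrite (field_profileE _ _ prof) /= at0 at1 zT1.
  by rewrite !mul0r add0r.
have zl1 := zder _ _ dl zl.
split; split=> //.
have := comp (at_time 0) iS; rewrite (field_profileE _ _ prof) /= at0 at1 zT2 zl1.
by rewrite !mul0r !add0r opprK.
Qed.

End ProfileSpaces.

Section Jets.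
Context {R : realType}.
Variables (gamma : R).
Hypothesis gamma0 : gamma != 0.

(** The initial values of a linear combination of profiles. By [profile_unique] they
    determine the combination. *)
Definition jet n (T l s T1 T2 l1 : 'I_n -> R -> R) (c : 'I_n -> R) : seq R :=
  [seq \sum_i c i * (f : 'I_n -> R -> R) i 0 | f <- [:: T; T1; T2; l; l1; s]].

(** The uniqueness theorem applied to the difference of the two sides, written as a
    linear combination of two profiles. *)
Lemma profile_span C D n (T l s T1 T2 l1 : 'I_n -> R -> R)
    (T' l' s' T1' T2' l1' : R -> R) (c : 'I_n -> R) :
  (forall i, profile gamma C D (T i) (l i) (s i) (T1 i) (T2 i) (l1 i)) ->
  profile gamma C D T' l' s' T1' T2' l1' ->
  jet T l s T1 T2 l1 c = [:: T' 0; T1' 0; T2' 0; l' 0; l1' 0; s' 0] ->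
  field_of T' l' s' = \sum_i c i *: field_of (T i) (l i) (s i).
Proof.
move=> P P' [jT jT1 jT2 jl jl1 js].
rewrite -(field_lincomb c P).
have Q := profile_lincomb c P.
pose X (b : 'I_2) (u v : R -> R) : R -> R := if b == 0 then u else v.
pose a (b : 'I_2) : R := if b == 0 then 1 else -1.
have PX (b : 'I_2) : profile gamma C D (X b T' (fun t => \sum_i c i * T i t))
    (X b l' (fun t => \sum_i c i * l i t)) (X b s' (fun t => \sum_i c i * s i t))
    (X b T1' (fun t => \sum_i c i * T1 i t)) (X b T2' (fun t => \sum_i c i * T2 i t))
    (X b l1' (fun t => \sum_i c i * l1 i t)).
  by rewrite /X; case: ifP.
have sum2 (u v : R -> R) t : \sum_b a b * X b u v t = u t - v t.
  by rewrite big_ord_recl big_ord1 /a /X /= mul1r mulN1r.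
have zero := profile_unique (profile_lincomb a PX).
have {}zero t : [/\ T' t = \sum_i c i * T i t, l' t = \sum_i c i * l i t
    & s' t = \sum_i c i * s i t].
  have [] := zero _ _ _ _ _ _ t; rewrite ?sum2 ?jT ?jT1 ?jT2 ?jl ?jl1 ?js ?subrr //.
  by move=> /eqP + /eqP + /eqP; rewrite !subr_eq0 => /eqP ? /eqP ? /eqP ?.
by congr field_of; apply/funext => t; have [] := zero t.
Qed.

Lemma profile_lin_indep C D n (T l s T1 T2 l1 : 'I_n -> R -> R) :
  (forall i, profile gamma C D (T i) (l i) (s i) (T1 i) (T2 i) (l1 i)) ->
  (forall c, jet T l s T1 T2 l1 c = [:: 0; 0; 0; 0; 0; 0] -> forall i, c i = 0) ->
  lin_indep (fun i => field_of (T i) (l i) (s i)).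
Proof.
move=> P inj c; rewrite -(field_lincomb c P).
move=> /(field_zero (profile_lincomb c P)) [[T0 T10 T20] [l0 l10 s0]].
by apply: inj; rewrite /jet /= T0 T10 T20 l0 l10 s0.
Qed.

End Jets.

(** * Brackets *)

Section Bracket.
Context {R : realType}.
Variables (gamma C D : R).
Hypothesis gamma0 : gamma != 0.

Lemma is_derive_wronskian (f f' g g' h h' k k' : R -> R) (t : R) :
  (forall t : R, is_derive t 1 f (f' t)) -> (forall t : R, is_derive t 1 g (g' t)) ->
  (forall t : R, is_derive t 1 h (h' t)) -> (forall t : R, is_derive t 1 k (k' t)) ->
  is_derive t 1 (fun t => f t * g t - h t * k t)
    (f t * g' t + g t * f' t - (h t * k' t + k t * h' t)).
Proof.
move=> df dg dh dk.
exact: (is_deriveB (is_derive_prod t df dg) (is_derive_prod t dh dk)).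
Qed.

(** The function [U] is the bracket of the vector fields [T d/dt] and [T' d/dt] on
    the line. The solutions of [T''' = 8 D T'] are closed under it: they are
    spanned by the products of two solutions of [y'' = 2 D y] and form a copy of
    [sl_2]. *)
Lemma profile_bracket (T s T1 T2 l1 T' s' T1' T2' l1' : R -> R)
    (U := fun t => T t * T1' t - T' t * T1 t)
    (U1 := fun t => T t * T2' t - T' t * T2 t)
    (U2 := fun t => (T1 t * T2' t - T1' t * T2 t) + 8 * D * U t) :
  profile gamma C D T (fun=> 0) s T1 T2 l1 ->
  profile gamma C D T' (fun=> 0) s' T1' T2' l1' ->
  profile gamma C D U (fun=> 0) (fun t => gamma / 4 * U1 t) U1 U2 (fun=> 0).
Proof.
case=> dT dT1 dT2 _ _ _ _ [dT' dT1' dT2' _ _ _ _].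
have dU (t : R) : is_derive t 1 U (U1 t).
  apply: is_derive_eq (is_derive_wronskian t dT dT1' dT' dT1) _.
  rewrite /U1; move: (T t) (T1 t) (T2 t) (T' t) (T1' t) (T2' t) => *; ring.
have dU1 (t : R) : is_derive t 1 U1 (U2 t).
  apply: is_derive_eq (is_derive_wronskian t dT dT2' dT' dT2) _.
  rewrite /U2 /U.
  move: (T t) (T1 t) (T2 t) (T' t) (T1' t) (T2' t) => *; ring.
split=> //.
- move=> t; have dW u := is_derive_wronskian u dT1 dT2' dT1' dT2.
  apply: is_derive_eq (is_deriveD (dW t) (is_derive_mulr (8 * D) t dU)) _.
  rewrite /U1 /=.
  move: (T t) (T1 t) (T2 t) (T' t) (T1' t) (T2' t) => *; ring.
- by move=> t; exact: is_derive_cst.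
- by move=> t; rewrite mulr0; exact: is_derive_cst.
- by move=> t; exact: is_derive_mulr.
- by move=> t; rewrite mulr0.
Qed.

Lemma bracket_field (T s T1 T2 l1 T' s' T1' T2' l1' : R -> R) :
  profile gamma C D T (fun=> 0) s T1 T2 l1 ->
  profile gamma C D T' (fun=> 0) s' T1' T2' l1' ->
  bracket (field_of T (fun=> 0) s) (field_of T' (fun=> 0) s')
  = field_of (fun t => T t * T1' t - T' t * T1 t) (fun=> 0)
      (fun t => gamma / 4 * (T t * T2' t - T' t * T2 t)).
Proof.
move=> P P'; apply/funext => p; apply/rowP => k.
rewrite (field_profileE p k (profile_bracket P P')) mxE sum5.
have l10 (m : R -> R) : (forall t : R, is_derive t 1 (fun=> 0) (m t)) -> m = fun=> 0.
  by move=> dm; apply/funext => t; have [_ <-] := dm t; exact: derive_cst.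
have El := l10 _ (profl P); have El' := l10 _ (profl P').
have [Xt [Xq XS XE XB]] := prof_comp P.
have [Yt [Yq YS YE YB]] := prof_comp P'.
have [Xdt Xdq XdS XdB XdE] := field_derivatives P.
have [Ydt Ydq YdS YdB YdE] := field_derivatives P'.
have [l0 l0'] : l1 (xcoord it p) = 0 /\ l1' (xcoord it p) = 0 by rewrite El El'.
rewrite Xt Xq XS XE XB Yt Yq YS YE YB l0 l0'.
elim/ord5_ind: k;
  [rewrite !Xdt !Ydt|rewrite !Xdq !Ydq|rewrite !XdS !YdS|rewrite !XdE !YdE|
   rewrite !XdB !YdB]; rewrite ?l0 ?l0' -!val_eqE /=;
  move: (xcoord it p) (xcoord iq p) (xcoord iE p) (xcoord iB p) => t q E B;
  move: (T t) (T1 t) (T2 t) (s t) (T' t) (T1' t) (T2' t) (s' t)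
    => x1 x2 x3 x4 y1 y2 y3 y4; by field.
Qed.

End Bracket.

(** * The generators *)

Section Generators.
Context {R : realType}.
Variables (gamma : R).
Hypothesis gamma0 : gamma != 0.

Lemma sum4 (V : nmodType) (F : 'I_4 -> V) : \sum_k F k
  = F (@Ordinal 4 0 isT) + F (@Ordinal 4 1 isT)
    + F (@Ordinal 4 2 isT) + F (@Ordinal 4 3 isT).
Proof.
rewrite !big_ord_recl big_ord0 addr0 !addrA.
by congr (_ + _ + _ + _); congr F; exact/val_inj.
Qed.

Lemma ord4_ind (P : 'I_4 -> Prop) :
  P (@Ordinal 4 0 isT) -> P (@Ordinal 4 1 isT) -> P (@Ordinal 4 2 isT) ->
  P (@Ordinal 4 3 isT) -> forall i, P i.
Proof.
move=> h0 h1 h2 h3 [[|[|[|[|//]]]] lti].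
- by rewrite (_ : Ordinal lti = @Ordinal 4 0 isT) //; exact/val_inj.
- by rewrite (_ : Ordinal lti = @Ordinal 4 1 isT) //; exact/val_inj.
- by rewrite (_ : Ordinal lti = @Ordinal 4 2 isT) //; exact/val_inj.
- by rewrite (_ : Ordinal lti = @Ordinal 4 3 isT) //; exact/val_inj.
Qed.



Lemma profile_time C D (T s T1 T2 : R -> R) :
  (forall t : R, is_derive t 1 T (T1 t)) -> (forall t : R, is_derive t 1 T1 (T2 t)) ->
  (forall t : R, is_derive t 1 T2 (8 * D * T1 t)) ->
  (forall t : R, is_derive t 1 s (gamma / 4 * T2 t)) ->
  profile gamma C D T (fun=> 0) s T1 T2 (fun=> 0).
Proof.
move=> dT dT1 dT2 ds; split=> t.
- exact: dT.
- exact: dT1.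
- exact: dT2.
- exact: is_derive_cst.
- by rewrite mulr0; exact: is_derive_cst.
- exact: ds.
- by rewrite mulr0.
Qed.

Lemma profile_cst C D (x y : R) :
  profile gamma C D (fun=> x) (fun=> 0) (fun=> y) (fun=> 0) (fun=> 0) (fun=> 0).
Proof.
split=> t; rewrite ?mulr0 //; exact: is_derive_cst.
Qed.

Lemma profile_exp C D (e : R) : e != 0 -> 8 * D = e * e ->
  profile gamma C D (fun t => expR (e * t) / e) (fun=> 0)
    (fun t => gamma / 4 * expR (e * t)) (fun t => expR (e * t))
    (fun t => e * expR (e * t)) (fun=> 0).
Proof.
move=> e0 ee.
have d (t : R) := @is_derive_scaled R expR expR e t (@is_derive_expR R).
have H1 (t : R) : is_derive t 1 (fun t => expR (e * t) / e) (expR (e * t)).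
  have H := is_derive_mulr e^-1 t d.
  apply: (is_derive_ext _ (is_derive_eq H _)) => [u|]; first by rewrite mulrC.
  by move: (expR _) => x; field.
have H3 (t : R) : is_derive t 1 (fun t => e * expR (e * t)) (8 * D * expR (e * t)).
  have H := is_derive_mulr e t d; apply: (is_derive_eq H).
  by rewrite ee mulrA.
exact: (profile_time C H1 d H3 (fun t => is_derive_mulr (gamma / 4) t d)).
Qed.

Lemma profile_sin C D (e : R) : e != 0 -> 8 * D = - (e * e) ->
  profile gamma C D (fun t => sin (e * t) / e) (fun=> 0)
    (fun t => gamma / 4 * cos (e * t)) (fun t => cos (e * t))
    (fun t => e * - sin (e * t)) (fun=> 0).
Proof.
move=> e0 ee.
have ds (t : R) := @is_derive_scaled R sin cos e t (@is_derive_sin R).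
have dc (t : R) :=
  @is_derive_scaled R cos (fun t => - sin t) e t (@is_derive_cos R).
have H1 (t : R) : is_derive t 1 (fun t => sin (e * t) / e) (cos (e * t)).
  have H := is_derive_mulr e^-1 t ds.
  apply: (is_derive_ext _ (is_derive_eq H _)) => [u|]; first by rewrite mulrC.
  by move: (cos _) => x; field.
have H3 (t : R) : is_derive t 1 (fun t => e * - sin (e * t)) (8 * D * cos (e * t)).
  have H := is_derive_mulr (- e) t ds.
  apply: (is_derive_ext _ (is_derive_eq H _)) => [u|].
    by rewrite mulNr mulrN.
  by rewrite ee; move: (cos _) => x; ring.
exact: (profile_time C H1 dc H3 (fun t => is_derive_mulr (gamma / 4) t dc)).
Qed.

Lemma profile_cos C D (e : R) : e != 0 -> 8 * D = - (e * e) ->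
  profile gamma C D (fun t => - (cos (e * t) / e)) (fun=> 0)
    (fun t => gamma / 4 * sin (e * t)) (fun t => sin (e * t))
    (fun t => e * cos (e * t)) (fun=> 0).
Proof.
move=> e0 ee.
have ds (t : R) := @is_derive_scaled R sin cos e t (@is_derive_sin R).
have dc (t : R) :=
  @is_derive_scaled R cos (fun t => - sin t) e t (@is_derive_cos R).
have H1 (t : R) : is_derive t 1 (fun t => - (cos (e * t) / e)) (sin (e * t)).
  have H := is_derive_mulr (- e^-1) t dc.
  apply: (is_derive_ext _ (is_derive_eq H _)) => [u|]; first by rewrite mulNr mulrC.
  by move: (sin _) => x; field.
have H3 (t : R) : is_derive t 1 (fun t => e * cos (e * t)) (8 * D * sin (e * t)).
  have H := is_derive_mulr e t dc; apply: (is_derive_eq H).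
  by rewrite ee; move: (sin _) => x; ring.
exact: (profile_time C H1 ds H3 (fun t => is_derive_mulr (gamma / 4) t ds)).
Qed.

Lemma profile_sqr C :
  profile gamma C 0 (fun t => t ^+ 2) (fun=> 0) (fun t => gamma / 2 * t)
    (fun t => 2 * t) (fun=> 2) (fun=> 0).
Proof.
have d1 (t : R) : is_derive t 1 (fun t : R => t) 1 := is_derive_id t (1 : R).
have H1 (t : R) : is_derive t 1 (fun t : R => t ^+ 2) (2 * t).
  apply: (is_derive_ext _ (is_derive_eq (is_derive_prod t d1 d1) _)) => [u|].
    by rewrite expr2.
  by rewrite mulr1 mulr2n mulrDl mul1r.
have H2 (t : R) : is_derive t 1 (fun t : R => 2 * t) 2.
  by apply: (is_derive_eq (is_derive_mulr 2 t d1)); rewrite mulr1.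
have H3 (t : R) : is_derive t 1 (fun _ : R => 2 : R) (8 * 0 * (2 * t)).
  by rewrite mulr0 mul0r; exact: is_derive_cst.
have H4 (t : R) : is_derive t 1 (fun t : R => gamma / 2 * t) (gamma / 4 * 2).
  by apply: (is_derive_eq (is_derive_mulr (gamma / 2) t d1)); field.
exact: (profile_time C H1 H2 H3 H4).
Qed.

Lemma profile_id C :
  profile gamma C 0 (fun t => t) (fun=> 0) (fun=> 0)
    (fun=> 1) (fun=> 0) (fun=> 0).
Proof.
split=> t; rewrite ?mulr0 ?mul0r //; try exact: is_derive_cst.
exact: is_derive_id.
Qed.

(** In each of the three cases the matrix of initial values of the generators is
    invertible: the exponential or trigonometric generators have independent values
    of [(T1, T2)] at [0], and the two constant ones fix [T] and [s]. *)
Lemma Pdata_profiles D :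
  let T i := (tnth (Pdata gamma D) i).1 in
  let s i := (tnth (Pdata gamma D) i).2 in
  exists T1 T2 : 'I_4 -> R -> R,
  [/\ forall C i, profile gamma C D (T i) (fun=> 0) (s i) (T1 i) (T2 i) (fun=> 0),
      forall x0 x1 x2 y, exists c : 'I_4 -> R,
        [/\ \sum_i c i * T i 0 = x0, \sum_i c i * T1 i 0 = x1,
            \sum_i c i * T2 i 0 = x2 & \sum_i c i * s i 0 = y] &
      forall c : 'I_4 -> R, \sum_i c i * T i 0 = 0 -> \sum_i c i * T1 i 0 = 0 ->
        \sum_i c i * T2 i 0 = 0 -> \sum_i c i * s i 0 = 0 -> forall i, c i = 0].
Proof.
move=> T s; rewrite /T /s /Pdata; case: ltrP => [D0|D0]; last case: eqP => [->|/eqP D1].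
- set e := Num.sqrt (8 * D).
  have e0 : e != 0 by rewrite lt0r_neq0 // sqrtr_gt0 mulr_gt0.
  have ee : 8 * D = e * e by rewrite -expr2 sqr_sqrtr // ltW // mulr_gt0.
  exists (fun i => nth (fun=> 0) [:: (fun t => expR (e * t));
    (fun t => expR (- e * t))] i).
  exists (fun i => nth (fun=> 0) [:: (fun t => e * expR (e * t));
    (fun t => - e * expR (- e * t))] i).
  split.
  + move=> C; apply: ord4_ind; rewrite /=; try exact: profile_cst.
      exact: profile_exp.
    have -> : (fun t => - (expR (- (e * t)) / e))
        = (fun t => expR (- e * t) / - e).
      by apply/funext => t; rewrite mulNr invrN mulrN.
    have -> : (fun t => gamma / 4 * expR (- (e * t)))
        = (fun t => gamma / 4 * expR (- e * t)).
      by apply/funext => t; rewrite mulNr.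
    by apply: profile_exp; rewrite ?oppr_eq0 // mulrNN.
  + move=> x0 x1 x2 y.
    exists (fun i => [:: (x1 + x2 / e) / 2; (x1 - x2 / e) / 2; x0 - x2 / (e * e);
                         y - gamma / 4 * x1]`_i).
    rewrite !sum4 /= !mulr0 ?oppr0 !expR0.
    by split; field.
  + move=> c; rewrite !sum4 /= !mulr0 ?oppr0 !expR0.
    set c0 := c _; set c1 := c _; set c2 := c _; set c3 := c _.
    move=> h0 h1 h2 h3.
    have h1' : c0 = - c1.
      by apply/eqP; rewrite -subr_eq0 opprK -h1; apply/eqP; ring.
    have h2' : c0 = c1.
      apply/eqP; rewrite -subr_eq0; apply/eqP; apply: (mulfI e0).
      by rewrite mulr0 -h2; ring.
    have z1 : c1 = 0 by lra.
    have z0 : c0 = 0 by rewrite h2'.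
    have z2 : c2 = 0 by move: h0; rewrite z0 z1 !(mul0r, add0r, mulr1, mulr0, addr0).
    have z3 : c3 = 0 by move: h3; rewrite z0 z1 !(mul0r, add0r, mulr1, mulr0, addr0).
    by apply: ord4_ind.
- exists (fun i => nth (fun=> 0) [:: (fun t => 2 * t); (fun=> 1)] i).
  exists (fun i => nth (fun=> 0) [:: (fun=> 2)] i).
  split.
  + move=> C; apply: ord4_ind; rewrite /=; try exact: profile_cst.
      exact: profile_sqr.
    exact: profile_id.
  + move=> x0 x1 x2 y; exists (fun i => [:: x2 / 2; x1; x0; y]`_i).
    by rewrite !sum4 /=; split; field.
  + move=> c; rewrite !sum4 /=.
    set c0 := c _; set c1 := c _; set c2 := c _; set c3 := c _.
    move=> h0 h1 h2 h3.
    have z0 : c0 = 0 by lra.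
    have z1 : c1 = 0 by lra.
    have z2 : c2 = 0 by move: h0; rewrite z0 z1 !(mul0r, add0r, mulr1, mulr0, addr0).
    have z3 : c3 = 0 by move: h3; rewrite z0 z1 !(mul0r, add0r, mulr1, mulr0, addr0).
    by apply: ord4_ind.
- set e := Num.sqrt (- (8 * D)).
  have D2 : 0 < - (8 * D) by rewrite oppr_gt0 pmulr_rlt0 // lt_neqAle D1.
  have e0 : e != 0 by rewrite lt0r_neq0 // sqrtr_gt0.
  have ee : 8 * D = - (e * e) by rewrite -expr2 sqr_sqrtr ?opprK // ltW.
  exists (fun i => nth (fun=> 0) [:: (fun t => cos (e * t)); (fun t => sin (e * t))] i).
  exists (fun i => nth (fun=> 0) [:: (fun t => e * - sin (e * t));
    (fun t => e * cos (e * t))] i).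
  split.
  + move=> C; apply: ord4_ind; rewrite /=; try exact: profile_cst.
      exact: profile_sin.
    exact: profile_cos.
  + move=> x0 x1 x2 y.
    exists (fun i => [:: x1; x2 / e; x0 + x2 / (e * e); y - gamma / 4 * x1]`_i).
    rewrite !sum4 /= !mulr0 sin0 cos0.
    by split; field.
  + move=> c; rewrite !sum4 /= !mulr0 sin0 cos0.
    set c0 := c _; set c1 := c _; set c2 := c _; set c3 := c _.
    move=> h0 h1 h2 h3.
    have z0 : c0 = 0 by rewrite -h1; ring.
    have z1 : c1 = 0 by apply: (mulfI e0); rewrite mulr0 -h2; ring.
    have z2 : c2 = 0 by rewrite -h0 z1; ring.
    have z3 : c3 = 0 by rewrite -h3 z0; ring.
    by apply: ord4_ind.
Qed.

End Generators.

(** * Dimensions and inclusions *)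

Section Spaces.
Context {R : realType}.
Variables (gamma : R).
Hypothesis gamma0 : gamma != 0.
Implicit Types (C D : R) (N : vfield R).

Lemma HCD_sub0 C D : HCD gamma C D `<=` HCD gamma 0 D.
Proof.
move=> N /(HCD_profileE gamma0) [T [l [s [T1 [T2 [l1 [prof ->]]]]]]].
apply/(HCD_profileE gamma0); exists T, l, s, T1, T2, l1.
by split=> //; exact: profile_sub prof.
Qed.

Lemma PD_sub C D : PD gamma D `<=` HCD gamma C D.
Proof.
have [T1 [T2 [prof _ _]]] := Pdata_profiles gamma D.
move=> _ [c ->]; apply/(HCD_profileE gamma0).
have Q := profile_lincomb c (prof C).
by do 6 eexists; split; [exact: Q|rewrite (field_lincomb c (prof C))].
Qed.

Lemma profile_l0 C D (T l s T1 T2 l1 : R -> R) : C != 0 ->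
  profile gamma C D T l s T1 T2 l1 -> l = (fun=> 0) /\ l1 = (fun=> 0).
Proof.
move=> C0 prof.
have lz : l = fun=> 0.
  by apply/funext => t; apply: (mulfI C0); rewrite mulr0; exact: (profC prof).
split=> //; apply/funext => t; have [_ <-] := profl prof t.
by rewrite lz; exact: derive_cst.
Qed.

Lemma HCD_PD C D : C != 0 -> HCD gamma C D = PD gamma D.
Proof.
move=> C0; apply/seteqP; split; last exact: PD_sub.
move=> N /(HCD_profileE gamma0) [T [l [s [T1 [T2 [l1 [prof ->]]]]]]].
have [S1 [S2 [profs sol _]]] := Pdata_profiles gamma D.
have [lz l1z] := profile_l0 C0 prof.
have [c [h0 h1 h2 h3]] := sol (T 0) (T1 0) (T2 0) (s 0).
exists c; apply: (profile_span (profs C) prof).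
rewrite /jet /= h0 h1 h2 h3 lz l1z !big1 // => i _; exact: mulr0.
Qed.

Lemma PD_dim D : has_dim (PD gamma D) 4.
Proof.
have [S1 [S2 [profs _ inj]]] := Pdata_profiles gamma D.
exists (Pgen gamma D); split=> //; apply: (profile_lin_indep (profs 0)).
by move=> c [h0 h1 h2 _ _ h3]; exact: inj.
Qed.

(** When [C = 0] the function [l] is an arbitrary solution of [l'' = 2 D l], which
    adds two dimensions to the span of the generators. *)
Lemma HCD0_dim D : has_dim (HCD gamma 0 D) 6.
Proof.
have [S1 [S2 [profs sol inj]]] := Pdata_profiles gamma D.
have [u [v [du dv u0 v0]]] := fundamental_exists (2 * D).
pose L (k : 'I_2) := if k == 0 then u else v.
pose L1 (k : 'I_2) := if k == 0 then (fun t => 2 * D * v t) else u.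
have profL (k : 'I_2) : profile gamma 0 D (fun=> 0) (L k) (fun=> 0) (fun=> 0)
    (fun=> 0) (L1 k).
  have dL (t : R) : is_derive t 1 (L k) (L1 k t).
    by rewrite /L /L1; case: ifP => _; [exact: du|exact: dv].
  have dL1 (t : R) : is_derive t 1 (L1 k) (2 * D * L k t).
    rewrite /L /L1; case: ifP => _; last exact: du.
    exact: (is_derive_mulr (2 * D) t dv).
  split=> t; rewrite ?mulr0 ?mul0r //; try exact: is_derive_cst.
pose pick (f : 'I_4 -> R -> R) (g : 'I_2 -> R -> R) (i : 'I_(4 + 2)) : R -> R :=
  match fintype.split i with inl j => f j | inr k => g k end.
pose T := pick (fun i => (tnth (Pdata gamma D) i).1) (fun _ _ => 0).
pose s := pick (fun i => (tnth (Pdata gamma D) i).2) (fun _ _ => 0).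
pose l := pick (fun _ _ => 0) L.
pose T1 := pick S1 (fun _ _ => 0).
pose T2 := pick S2 (fun _ _ => 0).
pose l1 := pick (fun _ _ => 0) L1.
have prof i : profile gamma 0 D (T i) (l i) (s i) (T1 i) (T2 i) (l1 i).
  by rewrite /T /l /s /T1 /T2 /l1 /pick; case: (fintype.split i).
have SL j : fintype.split (lshift 2 j : 'I_(4 + 2)) = inl j := unsplitK (inl j).
have SR k : fintype.split (rshift 4 k : 'I_(4 + 2)) = inr k := unsplitK (inr k).
have pickE f g (c : 'I_(4 + 2) -> R) t : \sum_i c i * pick f g i t
    = \sum_i c (lshift 2 i) * f i t + \sum_k c (rshift 4 k) * g k t.
  rewrite big_split_ord; congr (_ + _); apply: eq_bigr => i _;
  by rewrite /pick ?SL ?SR.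
have zero n (c : 'I_n -> R) : \sum_i c i * 0 = 0.
  by rewrite big1 // => i _; rewrite mulr0.
have sum2 (c : 'I_2 -> R) : \sum_k c k * L k 0 = c ord0
    /\ \sum_k c k * L1 k 0 = c ord_max.
  have E (F : 'I_2 -> R) : \sum_k F k = F ord0 + F ord_max.
    by rewrite big_ord_recl big_ord1; congr (_ + F _); exact/val_inj.
  by rewrite !E /L /L1 /= u0 v0; split; ring.
have jetE c : jet T l s T1 T2 l1 c
  = [:: \sum_i c (lshift 2 i) * (tnth (Pdata gamma D) i).1 0;
        \sum_i c (lshift 2 i) * S1 i 0; \sum_i c (lshift 2 i) * S2 i 0;
        c (rshift 4 ord0); c (rshift 4 ord_max);
        \sum_i c (lshift 2 i) * (tnth (Pdata gamma D) i).2 0].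
  rewrite /jet /= !pickE !zero !addr0 !add0r.
  by have [-> ->] := sum2 (fun k => c (rshift 4 k)).
exists (fun i : 'I_(4 + 2) => field_of (T i) (l i) (s i)); split.
  apply: (profile_lin_indep prof) => c; rewrite jetE.
  move=> [h0 h1 h2 h4 h5 h3] i.
  have cl := inj (fun i => c (lshift 2 i)) h0 h1 h2 h3.
  rewrite -(splitK i); case: (fintype.split i) => [j|k] /=; first exact: cl.
  have [->|kn] := eqVneq k ord0; first exact: h4.
  have -> // : k = ord_max.
  by apply/val_inj => /=; case: k kn => [[|[|//]]].
apply/seteqP; split=> [N|N].
  move=> /(HCD_profileE gamma0) [T' [l' [s' [T1' [T2' [l1' [prof' ->]]]]]]].
  have [c [h0 h1 h2 h3]] := sol (T' 0) (T1' 0) (T2' 0) (s' 0).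
  pose c' (i : 'I_(4 + 2)) := match fintype.split i with
    inl j => c j | inr k => if k == ord0 then l' 0 else l1' 0 end.
  have cl j : c' (lshift 2 j) = c j.
    by rewrite /c' SL.
  have cr k : c' (rshift 4 k) = if k == ord0 then l' 0 else l1' 0.
    by rewrite /c' SR.
  exists c'; apply: (profile_span prof prof').
  rewrite jetE !cr /=; under eq_bigr => i _ do rewrite cl.
  rewrite h0; under eq_bigr => i _ do rewrite cl.
  rewrite h1; under eq_bigr => i _ do rewrite cl.
  rewrite h2; under eq_bigr => i _ do rewrite cl.
  by rewrite h3.
move=> [c ->]; apply/(HCD_profileE gamma0).
have Q := profile_lincomb c prof.
by do 6 eexists; split; [exact: Q|rewrite (field_lincomb c prof)].
Qed.

(** By [HCD_PD] with the constant [1], the span of the generators consists of the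
    profiles with [l = 0]. *)
Lemma PD_bracket D X Y : PD gamma D X -> PD gamma D Y -> PD gamma D (bracket X Y).
Proof.
have one0 : (1 : R) != 0 by exact: oner_neq0.
rewrite -(HCD_PD D one0).
move=> /(HCD_profileE gamma0) [T [l [s [T1 [T2 [l1 [P ->]]]]]]].
move=> /(HCD_profileE gamma0) [T' [l' [s' [T1' [T2' [l1' [P' ->]]]]]]].
have [lz _] := profile_l0 one0 P; have [lz' _] := profile_l0 one0 P'.
rewrite lz in P *; rewrite lz' in P' *.
rewrite (bracket_field P P'); apply/(HCD_profileE gamma0).
by do 6 eexists; split; [exact: (profile_bracket P P')|].
Qed.

Lemma PD_subalgebra D : is_lie_subalgebra (PD gamma D) (HCD gamma 0 D).
Proof.
split.
- exact: PD_sub.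
- by exists (fun=> 0); rewrite big1 // => i _; rewrite scale0r.
- move=> c _ _ [x ->] [y ->]; exists (fun i => c * x i + y i).
  rewrite scaler_sumr -big_split /=; apply: eq_bigr => i _.
  by rewrite scalerDl scalerA.
- exact: PD_bracket.
Qed.

End Spaces.

Theorem theorem6p2 (R : realType) (gamma : R) (hgamma : 0 < gamma) :
  ((forall C D : R, C != 0 -> HCD gamma C D = PD gamma D) /\
   (forall C C' D : R, C != 0 -> C' != 0 -> HCD gamma C D = HCD gamma C' D)) /\
  (forall D : R, has_dim (PD gamma D) 4) /\
  (forall D : R, has_dim (HCD gamma 0 D) 6) /\
  (forall D : R, is_lie_subalgebra (PD gamma D) (HCD gamma 0 D)) /\
  (forall C D : R, HCD gamma C D `<=` HCD gamma 0 D).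
Proof.
have g0 := lt0r_neq0 hgamma.
split; first split.
- exact: HCD_PD.
- by move=> C C' D C0 C0'; rewrite !HCD_PD.
- split; first exact: PD_dim.
  split; first exact: HCD0_dim.
  by split; [exact: PD_subalgebra|exact: HCD_sub0].
Qed.
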